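(* Let $\alpha\vdash\sigma(\alpha)$ be an inductively constructed type in which $\alpha$ occurs only positively. Let $\nu\alpha.\sigma(\alpha)=\Pi\beta.(\Pi\alpha.(!(\alpha\multimap\sigma(\alpha))\otimes\alpha\multimap\beta))\multimap\beta$, $\mathit{pack}=\Lambda\alpha.\lambda^\circ x.\Lambda\beta.\lambda^\circ f.\ f\,\alpha\,x$, $\mathit{unfold}=\Lambda\alpha.\lambda^\circ f{:}!(\alpha\multimap\sigma(\alpha)).\lambda^\circ x{:}\alpha.\ \mathit{pack}\,\alpha\,(f\otimes x)$ (of type $\Pi\alpha.(\alpha\multimap\sigma(\alpha))\to\alpha\multimap\nu\alpha.\sigma(\alpha)$), and $\mathit{out}=\lambda^\circ x{:}\nu\alpha.\sigma(\alpha).\ x\,\sigma(\nu\alpha.\sigma(\alpha))\,r$ where $r=\Lambda\alpha.\lambda^\circ y{:}!(\alpha\multimap\sigma(\alpha))\otimes\alpha.\ \mathrm{let}\ w\otimes z=y\ \mathrm{in}\ \sigma(\mathit{unfold}\,\alpha\,w)(\mathrm{let}\ !f=w\ \mathrm{in}\ f\,z)$. Let $\Xi\mid-;-\vdash f:\tau\multimap\sigma(\tau)$ be a coalgebra and $\Xi\mid-;-\vdash h:\tau\multimap\nu\alpha.\sigma(\alpha)$ a map of coalgebras from $f$ to $\mathit{out}$, i.e. $\mathit{out}\circ h$ is internally equal to $\sigma(h)\circ f$. Then in LAPL extended with the extensionality schemes and the identity extension schema it is provable that $h=_{\tau\multimap\nu\alpha.\sigma(\alpha)}\mathit{unfold}\,\tau\,(!f)$.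 (Hence $\mathit{out}$ is a final coalgebra for the endofunctor of ${\rm LinType}_\Xi$ induced by $\sigma$.)
   Context: PILL$_Y$ is the polymorphic intuitionistic/linear lambda calculus with fixed points. Types in a context $\Xi$ of type variables are given by $\sigma ::= \alpha \mid I \mid \sigma\otimes\sigma \mid \sigma\multimap\sigma \mid\ !\sigma \mid \Pi\alpha.\sigma$. Terms are typed in judgements $\Xi\mid\Gamma;\Delta\vdash t:\tau$ with an intuitionistic variable context $\Gamma$ and a linear variable context $\Delta$; the constructs are variables, $\star:I$, linear abstraction $\lambda^\circ x{:}\sigma.t$ and application $t\,u$, $t\otimes s$, $!t$ (allowed only when the linear context is empty), type abstraction $\Lambda\alpha.t$ and type application $t\,\sigma$, the eliminations $\mathrm{let}\ x\otimes y = s\ \mathrm{in}\ t$, $\mathrm{let}\ !x = s\ \mathrm{in}\ t$, $\mathrm{let}\ \star = s\ \mathrm{in}\ t$, and a constant $Y:\Pi\alpha.(\alpha\to\alpha)\to\alpha$. Here $\sigma\to\tau$ abbreviates $!\sigma\multimap\tau$. External equality of terms is generated by the $\beta$- and $\eta$-rules of all constructs, commuting conversions of the let-constructs with linear contexts, congruence, and $f\,(!(Y\,\sigma\,(!f))) = Y\,\sigma\,(!f)$. $g\circ f=\lambda^\circ x.g(f\,x)$. LAPL is an intuitionistic higher-order predicate logic over PILL$_Y$ with contexts $\Xi\mid\Gamma\mid\Theta$, where $\Theta$ declares relation variables and admissible relation variables $R:\mathrm{AdmRel}(\sigma,\tau)$; propositions include internal equality $t=_\sigma u$ (externally equal terms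 are internally equal), $\rho(t,u)$ for definable relations, connectives and quantifiers over types, terms, relations and admissible relations. Admissible relations are a designated class of definable relations containing equality relations and graphs $\langle f\rangle=(x,y).f\,x=y$ of linear terms. Each type $\sigma(\vec\alpha)$ has a relational interpretation $\sigma[\vec\rho]$ at admissible relations $\vec\rho$, with $\alpha_i[\vec\rho]\equiv\rho_i$, $(\sigma\multimap\sigma')[\vec\rho](f,g)\Leftrightarrow\forall x,y.\ \sigma[\vec\rho](x,y)\supset\sigma'[\vec\rho](f\,x,g\,y)$, $(!\sigma)[\vec\rho](!x,!y)$ whenever $\sigma[\vec\rho](x,y)$, $(\sigma\otimes\sigma')[\vec\rho](x\otimes x',y\otimes y')$ whenever $\sigma[\vec\rho](x,y)$ and $\sigma'[\vec\rho](x',y')$, and $(\Pi\beta.\sigma)[\vec\rho](t,u)\Leftrightarrow\forall\beta,\beta'.\forall R:\mathrm{AdmRel}(\beta,\beta').\ \sigma[\vec\rho,R](t\,\beta,u\,\beta')$. The extensionality schemes are $(\forall x.\ t\,x=u\,x)\supset t=_{\sigma\multimap\tau}u$ and $(\forall\alpha.\ t\,\alpha=u\,\alpha)\supset t=_{\Pi\alpha.\tau}u$; the identity extension schema is $\forall\vec\alpha.\ \sigma[eq_{\vec\alpha}]\equiv eq_{\sigma(\vec\alpha)}$ for every type $\sigma(\vec\alpha)$, $eq$ denoting internal equality. ${\rm LinType}_\Xi$ is the category with objects types in context $\Xi$ and morphisms terms $\Xi\mid-;-\vdash f:\sigma\multimap\tau$ modulo internal equality provable in LAPL plus extensionality and identity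 extension. A type is inductively constructed if it is built from type variables and closed types using $\multimap,\otimes,I,!,\Pi$; positive/negative occurrences are as usual ($\multimap$ reverses polarity in its argument). For such $\sigma(\alpha)$ with $\alpha$ only positive, the functorial action $\sigma(f):\sigma(\tau)\multimap\sigma(\tau')$ of $f:\tau\multimap\tau'$ is the term defined by structural induction: $\alpha(f)=f$; closed types act by identity; $(\sigma_1\multimap\sigma_2)(f)=\lambda^\circ h.\ \sigma_2(f)\circ h\circ\sigma_1(f)$ (with $\sigma_1(f)$ going backwards); $\otimes$ componentwise; $(!\sigma_1)(f)=\lambda^\circ x.\mathrm{let}\ !y=x\ \mathrm{in}\ !(\sigma_1(f)\,y)$; $(\Pi\omega.\sigma_1)(f)=\lambda^\circ z.\Lambda\omega.\sigma_1(f)(z\,\omega)$.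
   Formalization: In the printed r the linearly bound w is used twice, so out is not a well-typed term; it is read as ''let w⊗z=y in let !v=w in σ(unfold α (!v))(let !f=!v in f z)'', that is, with w opened once and replaced by !v in both places. *)

(* Defs.v *)
From Stdlib Require Import List Arith Bool.
Import ListNotations.

(** * Syntax of PILL_Y

    De Bruijn indices throughout, with separate index spaces for type
    variables, term variables and relation variables.  Intuitionistic and
    linear term variables share one index space; they are told apart by the
    context (see [decl]). *)

Inductive ty : Type :=
| TVar (i : nat)
| TOne
| TTensor (s t : ty)
| TLolli (s t : ty)
| TBang (s : ty)
| TPi (s : ty).

Inductive tm : Type :=
| Var (i : nat)
| Star
| YC
| Lam (s : ty) (t : tm)
| App (t u : tm)
| Tens (t u : tm)
| Bang (t : tm)
| TLam (t : tm)
| TApp (t : tm) (s : ty)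
| LetStar (s t : tm)
| LetTens (s t : tm)   (* let x (x) y = s in t: in t, x is 1 and y is 0 *)
| LetBang (s t : tm).

(** ** Renaming and parallel substitution *)

Definition scons {A : Type} (a : A) (s : nat -> A) (i : nat) : A :=
  match i with 0 => a | S j => s j end.

Definition idn (i : nat) : nat := i.

Definition upren (xi : nat -> nat) : nat -> nat :=
  scons 0 (fun i => S (xi i)).

Fixpoint ren_ty (xi : nat -> nat) (s : ty) : ty :=
  match s with
  | TVar i => TVar (xi i)
  | TOne => TOne
  | TTensor a b => TTensor (ren_ty xi a) (ren_ty xi b)
  | TLolli a b => TLolli (ren_ty xi a) (ren_ty xi b)
  | TBang a => TBang (ren_ty xi a)
  | TPi a => TPi (ren_ty (upren xi) a)
  end.

Definition up_ty (th : nat -> ty) : nat -> ty :=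
  scons (TVar 0) (fun i => ren_ty S (th i)).

Fixpoint subst_ty (th : nat -> ty) (s : ty) : ty :=
  match s with
  | TVar i => th i
  | TOne => TOne
  | TTensor a b => TTensor (subst_ty th a) (subst_ty th b)
  | TLolli a b => TLolli (subst_ty th a) (subst_ty th b)
  | TBang a => TBang (subst_ty th a)
  | TPi a => TPi (subst_ty (up_ty th) a)
  end.

(* sigma(tau), for sigma in a context whose last variable is alpha *)
Definition inst_ty (t : ty) (s : ty) : ty := subst_ty (scons t TVar) s.

Fixpoint ren_tm (xi zeta : nat -> nat) (t : tm) : tm :=
  match t with
  | Var i => Var (zeta i)
  | Star => Star
  | YC => YC
  | Lam s t => Lam (ren_ty xi s) (ren_tm xi (upren zeta) t)
  | App t u => App (ren_tm xi zeta t) (ren_tm xi zeta u)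
  | Tens t u => Tens (ren_tm xi zeta t) (ren_tm xi zeta u)
  | Bang t => Bang (ren_tm xi zeta t)
  | TLam t => TLam (ren_tm (upren xi) zeta t)
  | TApp t s => TApp (ren_tm xi zeta t) (ren_ty xi s)
  | LetStar s t => LetStar (ren_tm xi zeta s) (ren_tm xi zeta t)
  | LetTens s t =>
      LetTens (ren_tm xi zeta s) (ren_tm xi (upren (upren zeta)) t)
  | LetBang s t => LetBang (ren_tm xi zeta s) (ren_tm xi (upren zeta) t)
  end.

(* j fresh type variables and k fresh term variables *)
Definition shift_tm (j k : nat) : tm -> tm := ren_tm (Nat.add j) (Nat.add k).

Definition up_tm (s : nat -> tm) : nat -> tm :=
  scons (Var 0) (fun i => shift_tm 0 1 (s i)).

Fixpoint subst_tm (th : nat -> ty) (s : nat -> tm) (t : tm) : tm :=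
  match t with
  | Var i => s i
  | Star => Star
  | YC => YC
  | Lam a t => Lam (subst_ty th a) (subst_tm th (up_tm s) t)
  | App t u => App (subst_tm th s t) (subst_tm th s u)
  | Tens t u => Tens (subst_tm th s t) (subst_tm th s u)
  | Bang t => Bang (subst_tm th s t)
  | TLam t => TLam (subst_tm (up_ty th) (fun i => shift_tm 1 0 (s i)) t)
  | TApp t a => TApp (subst_tm th s t) (subst_ty th a)
  | LetStar t u => LetStar (subst_tm th s t) (subst_tm th s u)
  | LetTens t u => LetTens (subst_tm th s t) (subst_tm th (up_tm (up_tm s)) u)
  | LetBang t u => LetBang (subst_tm th s t) (subst_tm th (up_tm s) u)
  end.

(** ** Typing *)

(* Xi |- s, where Xi is the context with n type variables *)
Fixpoint wf_ty (n : nat) (s : ty) : bool :=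
  match s with
  | TVar i => i <? n
  | TOne => true
  | TTensor a b | TLolli a b => wf_ty n a && wf_ty n b
  | TBang a => wf_ty n a
  | TPi a => wf_ty (S n) a
  end.

(** A pair of contexts [Gamma; Delta] is one list of declarations: [Int s]
    belongs to Gamma, [Lin s] to Delta, and [Gone] holds the place of a linear
    variable that has been given to another part of the term, so that splitting
    Delta does not renumber variables. *)
Inductive decl : Type :=
| Int (s : ty)
| Lin (s : ty)
| Gone.

Definition shift_decl (d : decl) : decl :=
  match d with
  | Int s => Int (ren_ty S s)
  | Lin s => Lin (ren_ty S s)
  | Gone => Gone
  end.

(* The linear part of the context is empty. *)
Definition nolin (X : list decl) : Prop :=
  forall i s, nth_error X i <> Some (Lin s).

(* The linear part of the context is exactly the variable i : s. *)
Definition only_lin (X : list decl) (i : nat) (s : ty) : Prop :=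
  nth_error X i = Some (Lin s) /\
  forall j s', nth_error X j = Some (Lin s') -> j = i.

(* Gamma; Delta, Delta'  splits into  Gamma; Delta  and  Gamma; Delta'. *)
Inductive split : list decl -> list decl -> list decl -> Prop :=
| split_nil : split [] [] []
| split_int s X X1 X2 :
    split X X1 X2 -> split (Int s :: X) (Int s :: X1) (Int s :: X2)
| split_left s X X1 X2 :
    split X X1 X2 -> split (Lin s :: X) (Lin s :: X1) (Gone :: X2)
| split_right s X X1 X2 :
    split X X1 X2 -> split (Lin s :: X) (Gone :: X1) (Lin s :: X2)
| split_gone X X1 X2 :
    split X X1 X2 -> split (Gone :: X) (Gone :: X1) (Gone :: X2).

Definition TArr (s t : ty) : ty := TLolli (TBang s) t.

Definition ty_Y : ty := TPi (TArr (TArr (TVar 0) (TVar 0)) (TVar 0)).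

Inductive typed (n : nat) : list decl -> tm -> ty -> Prop :=
| ty_var_int X i s :
    nth_error X i = Some (Int s) -> nolin X -> typed n X (Var i) s
| ty_var_lin X i s :
    only_lin X i s -> typed n X (Var i) s
| ty_star X : nolin X -> typed n X Star TOne
| ty_fix X : nolin X -> typed n X YC ty_Y
| ty_lam X s t s' :
    wf_ty n s = true -> typed n (Lin s :: X) t s' ->
    typed n X (Lam s t) (TLolli s s')
| ty_app X X1 X2 t u s s' :
    split X X1 X2 -> typed n X1 t (TLolli s s') -> typed n X2 u s ->
    typed n X (App t u) s'
| ty_tens X X1 X2 t u s s' :
    split X X1 X2 -> typed n X1 t s -> typed n X2 u s' ->
    typed n X (Tens t u) (TTensor s s')
| ty_bang X t s :
    nolin X -> typed n X t s -> typed n X (Bang t) (TBang s)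
| ty_tlam X t s :
    typed (S n) (map shift_decl X) t s -> typed n X (TLam t) (TPi s)
| ty_tapp X t s s' :
    wf_ty n s' = true -> typed n X t (TPi s) ->
    typed n X (TApp t s') (inst_ty s' s)
| ty_letstar X X1 X2 t u s :
    split X X1 X2 -> typed n X1 t TOne -> typed n X2 u s ->
    typed n X (LetStar t u) s
| ty_lettens X X1 X2 t u s1 s2 s :
    split X X1 X2 -> typed n X1 t (TTensor s1 s2) ->
    typed n (Lin s2 :: Lin s1 :: X2) u s ->
    typed n X (LetTens t u) s
| ty_letbang X X1 X2 t u s1 s :
    split X X1 X2 -> typed n X1 t (TBang s1) ->
    typed n (Int s1 :: X2) u s ->
    typed n X (LetBang t u) s.

(** ** External equality *)

(* Linear contexts C[-]: the hole is not under a [Bang]. *)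
Inductive lctx : Type :=
| CHole
| CLam (s : ty) (C : lctx)
| CAppL (C : lctx) (u : tm)
| CAppR (t : tm) (C : lctx)
| CTensL (C : lctx) (u : tm)
| CTensR (t : tm) (C : lctx)
| CTLam (C : lctx)
| CTApp (C : lctx) (s : ty)
| CLetStarL (C : lctx) (u : tm)
| CLetStarR (t : tm) (C : lctx)
| CLetTensL (C : lctx) (u : tm)
| CLetTensR (t : tm) (C : lctx)
| CLetBangL (C : lctx) (u : tm)
| CLetBangR (t : tm) (C : lctx).

(* C[t]; the variables bound by C are captured. *)
Fixpoint plug (C : lctx) (t : tm) : tm :=
  match C with
  | CHole => t
  | CLam s C => Lam s (plug C t)
  | CAppL C u => App (plug C t) u
  | CAppR u C => App u (plug C t)
  | CTensL C u => Tens (plug C t) u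
  | CTensR u C => Tens u (plug C t)
  | CTLam C => TLam (plug C t)
  | CTApp C s => TApp (plug C t) s
  | CLetStarL C u => LetStar (plug C t) u
  | CLetStarR u C => LetStar u (plug C t)
  | CLetTensL C u => LetTens (plug C t) u
  | CLetTensR u C => LetTens u (plug C t)
  | CLetBangL C u => LetBang (plug C t) u
  | CLetBangR u C => LetBang u (plug C t)
  end.

(* Numbers of term variables and of type variables bound at the hole. *)
Fixpoint btm (C : lctx) : nat :=
  match C with
  | CHole => 0
  | CLam _ C | CLetBangR _ C => S (btm C)
  | CLetTensR _ C => S (S (btm C))
  | CAppL C _ | CAppR _ C | CTensL C _ | CTensR _ C | CTLam C | CTApp C _
  | CLetStarL C _ | CLetStarR _ C | CLetTensL C _ | CLetBangL C _ => btm C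
  end.

Fixpoint bty (C : lctx) : nat :=
  match C with
  | CHole => 0
  | CTLam C => S (bty C)
  | CLam _ C | CAppL C _ | CAppR _ C | CTensL C _ | CTensR _ C | CTApp C _
  | CLetStarL C _ | CLetStarR _ C | CLetTensL C _ | CLetTensR _ C
  | CLetBangL C _ | CLetBangR _ C => bty C
  end.

(* Renaming of the free term variables of a linear context. *)
Fixpoint ren_lctx (zeta : nat -> nat) (C : lctx) : lctx :=
  match C with
  | CHole => CHole
  | CLam s C => CLam s (ren_lctx (upren zeta) C)
  | CAppL C u => CAppL (ren_lctx zeta C) (ren_tm idn zeta u)
  | CAppR u C => CAppR (ren_tm idn zeta u) (ren_lctx zeta C)
  | CTensL C u => CTensL (ren_lctx zeta C) (ren_tm idn zeta u)
  | CTensR u C => CTensR (ren_tm idn zeta u) (ren_lctx zeta C)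
  | CTLam C => CTLam (ren_lctx zeta C)
  | CTApp C s => CTApp (ren_lctx zeta C) s
  | CLetStarL C u => CLetStarL (ren_lctx zeta C) (ren_tm idn zeta u)
  | CLetStarR u C => CLetStarR (ren_tm idn zeta u) (ren_lctx zeta C)
  | CLetTensL C u =>
      CLetTensL (ren_lctx zeta C) (ren_tm idn (upren (upren zeta)) u)
  | CLetTensR u C =>
      CLetTensR (ren_tm idn zeta u) (ren_lctx (upren (upren zeta)) C)
  | CLetBangL C u => CLetBangL (ren_lctx zeta C) (ren_tm idn (upren zeta) u)
  | CLetBangR u C => CLetBangR (ren_tm idn zeta u) (ren_lctx (upren zeta) C)
  end.

(** [pull p k] moves a block of p variables, bound outside k other ones, to
    the innermost position.  It compares the scope of u in
    [let p = t in C[u]] with its scope in [C[let p = t in u]], where p binds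
    p variables and C binds k. *)
Definition pull (p k i : nat) : nat :=
  if i <? k then p + i else if i <? k + p then i - k else i.

(** [exteq n X t u s] is  Xi | Gamma; Delta |- t = u : s.  Every rule relates
    terms of type s; where this does not follow from the premises about
    subterms, both sides are required to be typed. *)
Inductive exteq (n : nat) : list decl -> tm -> tm -> ty -> Prop :=
(* equivalence *)
| eq_refl X t s : typed n X t s -> exteq n X t t s
| eq_sym X t u s : exteq n X t u s -> exteq n X u t s
| eq_trans X t u v s : exteq n X t u s -> exteq n X u v s -> exteq n X t v s
(* congruence *)
| eq_lam X s t t' s' :
    wf_ty n s = true -> exteq n (Lin s :: X) t t' s' ->
    exteq n X (Lam s t) (Lam s t') (TLolli s s')
| eq_app X X1 X2 t t' u u' s s' :
    split X X1 X2 -> exteq n X1 t t' (TLolli s s') -> exteq n X2 u u' s ->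
    exteq n X (App t u) (App t' u') s'
| eq_tens X X1 X2 t t' u u' s s' :
    split X X1 X2 -> exteq n X1 t t' s -> exteq n X2 u u' s' ->
    exteq n X (Tens t u) (Tens t' u') (TTensor s s')
| eq_bang X t t' s :
    nolin X -> exteq n X t t' s -> exteq n X (Bang t) (Bang t') (TBang s)
| eq_tlam X t t' s :
    exteq (S n) (map shift_decl X) t t' s ->
    exteq n X (TLam t) (TLam t') (TPi s)
| eq_tapp X t t' s s' :
    wf_ty n s' = true -> exteq n X t t' (TPi s) ->
    exteq n X (TApp t s') (TApp t' s') (inst_ty s' s)
| eq_letstar X X1 X2 t t' u u' s :
    split X X1 X2 -> exteq n X1 t t' TOne -> exteq n X2 u u' s ->
    exteq n X (LetStar t u) (LetStar t' u') s
| eq_lettens X X1 X2 t t' u u' s1 s2 s :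
    split X X1 X2 -> exteq n X1 t t' (TTensor s1 s2) ->
    exteq n (Lin s2 :: Lin s1 :: X2) u u' s ->
    exteq n X (LetTens t u) (LetTens t' u') s
| eq_letbang X X1 X2 t t' u u' s1 s :
    split X X1 X2 -> exteq n X1 t t' (TBang s1) ->
    exteq n (Int s1 :: X2) u u' s ->
    exteq n X (LetBang t u) (LetBang t' u') s
(* beta *)
| eq_beta_lam X a t u s :
    typed n X (App (Lam a t) u) s ->
    typed n X (subst_tm TVar (scons u Var) t) s ->
    exteq n X (App (Lam a t) u) (subst_tm TVar (scons u Var) t) s
| eq_beta_tlam X t a s :
    typed n X (TApp (TLam t) a) s ->
    typed n X (subst_tm (scons a TVar) Var t) s ->
    exteq n X (TApp (TLam t) a) (subst_tm (scons a TVar) Var t) s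
| eq_beta_star X t s :
    typed n X (LetStar Star t) s -> typed n X t s ->
    exteq n X (LetStar Star t) t s
| eq_beta_tens X t1 t2 u s :
    typed n X (LetTens (Tens t1 t2) u) s ->
    typed n X (subst_tm TVar (scons t2 (scons t1 Var)) u) s ->
    exteq n X (LetTens (Tens t1 t2) u)
              (subst_tm TVar (scons t2 (scons t1 Var)) u) s
| eq_beta_bang X t u s :
    typed n X (LetBang (Bang t) u) s ->
    typed n X (subst_tm TVar (scons t Var) u) s ->
    exteq n X (LetBang (Bang t) u) (subst_tm TVar (scons t Var) u) s
(* eta *)
| eq_eta_lam X t a s :
    wf_ty n a = true -> typed n X t (TLolli a s) ->
    exteq n X (Lam a (App (shift_tm 0 1 t) (Var 0))) t (TLolli a s)
| eq_eta_tlam X t s :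
    typed n X t (TPi s) ->
    exteq n X (TLam (TApp (shift_tm 1 0 t) (TVar 0))) t (TPi s)
| eq_eta_star X t :
    typed n X t TOne -> exteq n X (LetStar t Star) t TOne
| eq_eta_tens X t s1 s2 :
    typed n X t (TTensor s1 s2) ->
    exteq n X (LetTens t (Tens (Var 1) (Var 0))) t (TTensor s1 s2)
| eq_eta_bang X t s :
    typed n X t (TBang s) ->
    exteq n X (LetBang t (Bang (Var 0))) t (TBang s)
(* commuting conversions *)
| eq_comm_star X C t u s :
    typed n X (LetStar t (plug C u)) s ->
    typed n X (plug C (LetStar (shift_tm (bty C) (btm C) t) u)) s ->
    exteq n X (LetStar t (plug C u))
              (plug C (LetStar (shift_tm (bty C) (btm C) t) u)) s
| eq_comm_tens X C t u s :
    typed n X (LetTens t (plug (ren_lctx (Nat.add 2) C) u)) s ->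
    typed n X (plug C (LetTens (shift_tm (bty C) (btm C) t)
                               (ren_tm idn (pull 2 (btm C)) u))) s ->
    exteq n X (LetTens t (plug (ren_lctx (Nat.add 2) C) u))
              (plug C (LetTens (shift_tm (bty C) (btm C) t)
                               (ren_tm idn (pull 2 (btm C)) u))) s
| eq_comm_bang X C t u s :
    typed n X (LetBang t (plug (ren_lctx (Nat.add 1) C) u)) s ->
    typed n X (plug C (LetBang (shift_tm (bty C) (btm C) t)
                               (ren_tm idn (pull 1 (btm C)) u))) s ->
    exteq n X (LetBang t (plug (ren_lctx (Nat.add 1) C) u))
              (plug C (LetBang (shift_tm (bty C) (btm C) t)
                               (ren_tm idn (pull 1 (btm C)) u))) s
(* fixed points *)
| eq_fix X f s :
    nolin X -> wf_ty n s = true -> typed n X f (TArr s s) ->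
    exteq n X (App f (Bang (App (TApp YC s) (Bang f))))
              (App (TApp YC s) (Bang f)) s.

(** * The logic LAPL *)

Inductive kind : Type := KRel | KAdm.

Inductive prop : Type :=
| PEq (s : ty) (t u : tm)
| PRel (r : rel) (t u : tm)
| PTop
| PBot
| PAnd (p q : prop)
| POr (p q : prop)
| PImp (p q : prop)
| PAllTy (p : prop)
| PExTy (p : prop)
| PAll (s : ty) (p : prop)
| PEx (s : ty) (p : prop)
| PAllRel (k : kind) (s t : ty) (p : prop)
| PExRel (k : kind) (s t : ty) (p : prop)
with rel : Type :=
| RVar (i : nat)
| RAbs (s t : ty) (p : prop).   (* (x : s, y : t). p: in p, x is 1, y is 0 *)

(* The three arguments act on type, term and relation variables. *)
Fixpoint ren_prop (xi zeta chi : nat -> nat) (p : prop) : prop :=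
  match p with
  | PEq s t u => PEq (ren_ty xi s) (ren_tm xi zeta t) (ren_tm xi zeta u)
  | PRel r t u =>
      PRel (ren_rel xi zeta chi r) (ren_tm xi zeta t) (ren_tm xi zeta u)
  | PTop => PTop
  | PBot => PBot
  | PAnd p q => PAnd (ren_prop xi zeta chi p) (ren_prop xi zeta chi q)
  | POr p q => POr (ren_prop xi zeta chi p) (ren_prop xi zeta chi q)
  | PImp p q => PImp (ren_prop xi zeta chi p) (ren_prop xi zeta chi q)
  | PAllTy p => PAllTy (ren_prop (upren xi) zeta chi p)
  | PExTy p => PExTy (ren_prop (upren xi) zeta chi p)
  | PAll s p => PAll (ren_ty xi s) (ren_prop xi (upren zeta) chi p)
  | PEx s p => PEx (ren_ty xi s) (ren_prop xi (upren zeta) chi p)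
  | PAllRel k s t p =>
      PAllRel k (ren_ty xi s) (ren_ty xi t) (ren_prop xi zeta (upren chi) p)
  | PExRel k s t p =>
      PExRel k (ren_ty xi s) (ren_ty xi t) (ren_prop xi zeta (upren chi) p)
  end
with ren_rel (xi zeta chi : nat -> nat) (r : rel) : rel :=
  match r with
  | RVar i => RVar (chi i)
  | RAbs s t p =>
      RAbs (ren_ty xi s) (ren_ty xi t) (ren_prop xi (upren (upren zeta)) chi p)
  end.

Definition shift_prop (j k l : nat) : prop -> prop :=
  ren_prop (Nat.add j) (Nat.add k) (Nat.add l).

Definition shift_rel (j k l : nat) : rel -> rel :=
  ren_rel (Nat.add j) (Nat.add k) (Nat.add l).

Definition up_rel (e : nat -> rel) : nat -> rel :=
  scons (RVar 0) (fun i => shift_rel 0 0 1 (e i)).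

Fixpoint subst_prop (th : nat -> ty) (s : nat -> tm) (e : nat -> rel)
    (p : prop) : prop :=
  match p with
  | PEq a t u => PEq (subst_ty th a) (subst_tm th s t) (subst_tm th s u)
  | PRel r t u =>
      PRel (subst_rel th s e r) (subst_tm th s t) (subst_tm th s u)
  | PTop => PTop
  | PBot => PBot
  | PAnd p q => PAnd (subst_prop th s e p) (subst_prop th s e q)
  | POr p q => POr (subst_prop th s e p) (subst_prop th s e q)
  | PImp p q => PImp (subst_prop th s e p) (subst_prop th s e q)
  | PAllTy p =>
      PAllTy (subst_prop (up_ty th) (fun i => shift_tm 1 0 (s i))
                (fun i => shift_rel 1 0 0 (e i)) p)
  | PExTy p =>
      PExTy (subst_prop (up_ty th) (fun i => shift_tm 1 0 (s i))
               (fun i => shift_rel 1 0 0 (e i)) p)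
  | PAll a p =>
      PAll (subst_ty th a)
        (subst_prop th (up_tm s) (fun i => shift_rel 0 1 0 (e i)) p)
  | PEx a p =>
      PEx (subst_ty th a)
        (subst_prop th (up_tm s) (fun i => shift_rel 0 1 0 (e i)) p)
  | PAllRel k a b p =>
      PAllRel k (subst_ty th a) (subst_ty th b) (subst_prop th s (up_rel e) p)
  | PExRel k a b p =>
      PExRel k (subst_ty th a) (subst_ty th b) (subst_prop th s (up_rel e) p)
  end
with subst_rel (th : nat -> ty) (s : nat -> tm) (e : nat -> rel)
    (r : rel) : rel :=
  match r with
  | RVar i => e i
  | RAbs a b p =>
      RAbs (subst_ty th a) (subst_ty th b)
        (subst_prop th (up_tm (up_tm s)) (fun i => shift_rel 0 2 0 (e i)) p)
  end.

(* phi[s/alpha], phi[t/x], phi[t/x, u/y], phi[r/R] *)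
Definition inst_prop_ty (s : ty) : prop -> prop :=
  subst_prop (scons s TVar) Var RVar.
Definition inst_prop_tm (t : tm) : prop -> prop :=
  subst_prop TVar (scons t Var) RVar.
Definition inst_prop_tm2 (t u : tm) : prop -> prop :=
  subst_prop TVar (scons u (scons t Var)) RVar.
Definition inst_prop_rel (r : rel) : prop -> prop :=
  subst_prop TVar Var (scons r RVar).

(** ** Well-formed propositions and definable relations *)

Definition rdecl : Type := (kind * ty * ty)%type.

Definition shift_rdecl (d : rdecl) : rdecl :=
  match d with (k, s, t) => (k, ren_ty S s, ren_ty S t) end.

(* The context  Gamma; -  of the terms of the logic. *)
Definition ints (G : list ty) : list decl := map Int G.

Inductive wf_prop : nat -> list ty -> list rdecl -> prop -> Prop :=
| wf_eq n G Th s t u :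
    typed n (ints G) t s -> typed n (ints G) u s -> wf_prop n G Th (PEq s t u)
| wf_app n G Th r s s' t u :
    wf_rel n G Th r s s' -> typed n (ints G) t s -> typed n (ints G) u s' ->
    wf_prop n G Th (PRel r t u)
| wf_top n G Th : wf_prop n G Th PTop
| wf_bot n G Th : wf_prop n G Th PBot
| wf_and n G Th p q :
    wf_prop n G Th p -> wf_prop n G Th q -> wf_prop n G Th (PAnd p q)
| wf_or n G Th p q :
    wf_prop n G Th p -> wf_prop n G Th q -> wf_prop n G Th (POr p q)
| wf_imp n G Th p q :
    wf_prop n G Th p -> wf_prop n G Th q -> wf_prop n G Th (PImp p q)
| wf_allty n G Th p :
    wf_prop (S n) (map (ren_ty S) G) (map shift_rdecl Th) p ->
    wf_prop n G Th (PAllTy p)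
| wf_exty n G Th p :
    wf_prop (S n) (map (ren_ty S) G) (map shift_rdecl Th) p ->
    wf_prop n G Th (PExTy p)
| wf_all n G Th s p :
    wf_ty n s = true -> wf_prop n (s :: G) Th p -> wf_prop n G Th (PAll s p)
| wf_ex n G Th s p :
    wf_ty n s = true -> wf_prop n (s :: G) Th p -> wf_prop n G Th (PEx s p)
| wf_allrel n G Th k s t p :
    wf_ty n s = true -> wf_ty n t = true ->
    wf_prop n G ((k, s, t) :: Th) p -> wf_prop n G Th (PAllRel k s t p)
| wf_exrel n G Th k s t p :
    wf_ty n s = true -> wf_ty n t = true ->
    wf_prop n G ((k, s, t) :: Th) p -> wf_prop n G Th (PExRel k s t p)
with wf_rel : nat -> list ty -> list rdecl -> rel -> ty -> ty -> Prop :=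
| wf_rvar n G Th i k s t :
    nth_error Th i = Some (k, s, t) -> wf_rel n G Th (RVar i) s t
| wf_rabs n G Th s t p :
    wf_ty n s = true -> wf_ty n t = true ->
    wf_prop n (t :: s :: G) Th p -> wf_rel n G Th (RAbs s t p) s t.

(** ** Relational interpretation of types *)

Definition PIff (p q : prop) : prop := PAnd (PImp p q) (PImp q p).

(* r == r', for r, r' : Rel(s, t) *)
Definition requiv (s t : ty) (r r' : rel) : prop :=
  PAll s (PAll t (PIff (PRel (shift_rel 0 2 0 r) (Var 1) (Var 0))
                       (PRel (shift_rel 0 2 0 r') (Var 1) (Var 0)))).

Definition req (s : ty) : rel := RAbs s s (PEq s (Var 1) (Var 0)).

(* For r : Rel(s, t) and r' : Rel(s', t'). *)
Definition rlolli (s t s' t' : ty) (r r' : rel) : rel :=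
  RAbs (TLolli s s') (TLolli t t')
    (PAll s (PAll t
      (PImp (PRel (shift_rel 0 4 0 r) (Var 1) (Var 0))
            (PRel (shift_rel 0 4 0 r')
               (App (Var 3) (Var 1)) (App (Var 2) (Var 0)))))).

(** On I, (x) and !, the interpretation is the least admissible relation closed
    under the introduction form: x, y are related if they are related by every
    admissible S that relates the tensors (resp. the banged terms, resp. the
    two stars) built from related components. *)
Definition rone : rel :=
  RAbs TOne TOne
    (PAllRel KAdm TOne TOne
      (PImp (PRel (RVar 0) Star Star) (PRel (RVar 0) (Var 1) (Var 0)))).

Definition rtensor (s t s' t' : ty) (r r' : rel) : rel :=
  RAbs (TTensor s s') (TTensor t t')
    (PAllRel KAdm (TTensor s s') (TTensor t t')
      (PImp
        (PAll s (PAll t (PAll s' (PAll t'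
          (PImp (PRel (shift_rel 0 6 1 r) (Var 3) (Var 2))
          (PImp (PRel (shift_rel 0 6 1 r') (Var 1) (Var 0))
                (PRel (RVar 0)
                   (Tens (Var 3) (Var 1)) (Tens (Var 2) (Var 0)))))))))
        (PRel (RVar 0) (Var 1) (Var 0)))).

Definition rbang (s t : ty) (r : rel) : rel :=
  RAbs (TBang s) (TBang t)
    (PAllRel KAdm (TBang s) (TBang t)
      (PImp
        (PAll s (PAll t
          (PImp (PRel (shift_rel 0 4 1 r) (Var 1) (Var 0))
                (PRel (RVar 0) (Bang (Var 1)) (Bang (Var 0))))))
        (PRel (RVar 0) (Var 1) (Var 0)))).

(* forall (beta, beta', R : AdmRel(beta, beta')). r, where s is in the scope of
   beta, t in that of beta', and r in that of beta (1), beta' (0) and R (0). *)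
Definition rpi (s t : ty) (r : rel) : rel :=
  RAbs (TPi s) (TPi t)
    (PAllTy (PAllTy (PAllRel KAdm (TVar 1) (TVar 0)
      (PRel (shift_rel 0 2 0 r)
         (TApp (Var 1) (TVar 1)) (TApp (Var 0) (TVar 0)))))).

(** [rint th th' e s] is s[e] : Rel(s(th), s(th')), where the i-th type
    variable of s is interpreted by e i : AdmRel(th i, th' i). *)
Fixpoint rint (th th' : nat -> ty) (e : nat -> rel) (s : ty) : rel :=
  match s with
  | TVar i => e i
  | TOne => rone
  | TTensor a b =>
      rtensor (subst_ty th a) (subst_ty th' a) (subst_ty th b) (subst_ty th' b)
        (rint th th' e a) (rint th th' e b)
  | TLolli a b =>
      rlolli (subst_ty th a) (subst_ty th' a) (subst_ty th b) (subst_ty th' b)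
        (rint th th' e a) (rint th th' e b)
  | TBang a => rbang (subst_ty th a) (subst_ty th' a) (rint th th' e a)
  | TPi a =>
      rpi (subst_ty (up_ty th) a) (subst_ty (up_ty th') a)
        (rint (scons (TVar 1) (fun i => ren_ty (Nat.add 2) (th i)))
              (scons (TVar 0) (fun i => ren_ty (Nat.add 2) (th' i)))
              (scons (RVar 0) (fun i => shift_rel 2 0 1 (e i))) a)
  end.

(** ** Admissible relations and provability

    [isrel n G Th k r s t] is  Xi | Gamma | Theta |- r : Rel(s, t)  or
    AdmRel(s, t), according to k.  [prv n G Th Phi p] is
    Xi | Gamma | Theta | Phi |- p  in LAPL with the extensionality schemes
    and the identity extension schema.  The two are mutually defined because
    admissible relations are closed under provable equivalence. *)
Inductive isrel :
    nat -> list ty -> list rdecl -> kind -> rel -> ty -> ty -> Prop :=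
| rel_def n G Th r s t :
    wf_rel n G Th r s t -> isrel n G Th KRel r s t
| adm_var n G Th i s t :
    nth_error Th i = Some (KAdm, s, t) -> isrel n G Th KAdm (RVar i) s t
| adm_eq n G Th s :
    wf_ty n s = true -> isrel n G Th KAdm (req s) s s
| adm_preimage n G Th r s t s' t' f g :
    isrel n G Th KAdm r s t ->
    wf_ty n s' = true -> wf_ty n t' = true ->
    typed n (ints G) f (TLolli s' s) -> typed n (ints G) g (TLolli t' t) ->
    isrel n G Th KAdm
      (RAbs s' t' (PRel (shift_rel 0 2 0 r)
                     (App (shift_tm 0 2 f) (Var 1))
                     (App (shift_tm 0 2 g) (Var 0)))) s' t'
| adm_op n G Th r s t :
    wf_ty n s = true -> wf_ty n t = true ->
    isrel n G Th KAdm r s t ->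
    isrel n G Th KAdm
      (RAbs t s (PRel (shift_rel 0 2 0 r) (Var 0) (Var 1))) t s
| adm_top n G Th s t :
    wf_ty n s = true -> wf_ty n t = true ->
    isrel n G Th KAdm (RAbs s t PTop) s t
| adm_and n G Th r r' s t :
    wf_ty n s = true -> wf_ty n t = true ->
    isrel n G Th KAdm r s t -> isrel n G Th KAdm r' s t ->
    isrel n G Th KAdm
      (RAbs s t (PAnd (PRel (shift_rel 0 2 0 r) (Var 1) (Var 0))
                      (PRel (shift_rel 0 2 0 r') (Var 1) (Var 0)))) s t
| adm_imp n G Th p r s t :
    wf_ty n s = true -> wf_ty n t = true ->
    wf_prop n G Th p -> isrel n G Th KAdm r s t ->
    isrel n G Th KAdm
      (RAbs s t (PImp (shift_prop 0 2 0 p)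
                      (PRel (shift_rel 0 2 0 r) (Var 1) (Var 0)))) s t
| adm_allty n G Th r s t :
    wf_ty n s = true -> wf_ty n t = true ->
    isrel (S n) (map (ren_ty S) G) (map shift_rdecl Th) KAdm r
      (ren_ty S s) (ren_ty S t) ->
    isrel n G Th KAdm
      (RAbs s t (PAllTy (PRel (shift_rel 0 2 0 r) (Var 1) (Var 0)))) s t
| adm_all n G Th r s t a :
    wf_ty n s = true -> wf_ty n t = true -> wf_ty n a = true ->
    isrel n (a :: G) Th KAdm r s t ->
    isrel n G Th KAdm
      (RAbs s t (PAll a (PRel (ren_rel idn (upren (Nat.add 2)) idn r)
                           (Var 2) (Var 1)))) s t
| adm_allrel n G Th r s t k a b :
    wf_ty n s = true -> wf_ty n t = true ->
    wf_ty n a = true -> wf_ty n b = true ->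
    isrel n G ((k, a, b) :: Th) KAdm r s t ->
    isrel n G Th KAdm
      (RAbs s t (PAllRel k a b
                   (PRel (shift_rel 0 2 0 r) (Var 1) (Var 0)))) s t
| adm_equiv n G Th r r' s t :
    wf_rel n G Th r' s t -> isrel n G Th KAdm r s t ->
    prv n G Th [] (requiv s t r r') ->
    isrel n G Th KAdm r' s t
with prv : nat -> list ty -> list rdecl -> list prop -> prop -> Prop :=
(* intuitionistic logic *)
| p_hyp n G Th Phi p : In p Phi -> wf_prop n G Th p -> prv n G Th Phi p
| p_topI n G Th Phi : prv n G Th Phi PTop
| p_botE n G Th Phi p :
    wf_prop n G Th p -> prv n G Th Phi PBot -> prv n G Th Phi p
| p_andI n G Th Phi p q :
    prv n G Th Phi p -> prv n G Th Phi q -> prv n G Th Phi (PAnd p q)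
| p_andE1 n G Th Phi p q : prv n G Th Phi (PAnd p q) -> prv n G Th Phi p
| p_andE2 n G Th Phi p q : prv n G Th Phi (PAnd p q) -> prv n G Th Phi q
| p_orI1 n G Th Phi p q :
    wf_prop n G Th q -> prv n G Th Phi p -> prv n G Th Phi (POr p q)
| p_orI2 n G Th Phi p q :
    wf_prop n G Th p -> prv n G Th Phi q -> prv n G Th Phi (POr p q)
| p_orE n G Th Phi p q r :
    prv n G Th Phi (POr p q) ->
    prv n G Th (p :: Phi) r -> prv n G Th (q :: Phi) r -> prv n G Th Phi r
| p_impI n G Th Phi p q :
    wf_prop n G Th p -> prv n G Th (p :: Phi) q -> prv n G Th Phi (PImp p q)
| p_impE n G Th Phi p q :
    prv n G Th Phi (PImp p q) -> prv n G Th Phi p -> prv n G Th Phi q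
| p_alltyI n G Th Phi p :
    prv (S n) (map (ren_ty S) G) (map shift_rdecl Th)
      (map (shift_prop 1 0 0) Phi) p ->
    prv n G Th Phi (PAllTy p)
| p_alltyE n G Th Phi p s :
    wf_ty n s = true -> prv n G Th Phi (PAllTy p) ->
    prv n G Th Phi (inst_prop_ty s p)
| p_extyI n G Th Phi p s :
    wf_prop n G Th (PExTy p) -> wf_ty n s = true ->
    prv n G Th Phi (inst_prop_ty s p) -> prv n G Th Phi (PExTy p)
| p_extyE n G Th Phi p q :
    wf_prop n G Th q -> prv n G Th Phi (PExTy p) ->
    prv (S n) (map (ren_ty S) G) (map shift_rdecl Th)
      (p :: map (shift_prop 1 0 0) Phi) (shift_prop 1 0 0 q) ->
    prv n G Th Phi q
| p_allI n G Th Phi s p :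
    wf_ty n s = true ->
    prv n (s :: G) Th (map (shift_prop 0 1 0) Phi) p ->
    prv n G Th Phi (PAll s p)
| p_allE n G Th Phi s p t :
    typed n (ints G) t s -> prv n G Th Phi (PAll s p) ->
    prv n G Th Phi (inst_prop_tm t p)
| p_exI n G Th Phi s p t :
    wf_prop n G Th (PEx s p) -> typed n (ints G) t s ->
    prv n G Th Phi (inst_prop_tm t p) -> prv n G Th Phi (PEx s p)
| p_exE n G Th Phi s p q :
    wf_prop n G Th q -> prv n G Th Phi (PEx s p) ->
    prv n (s :: G) Th (p :: map (shift_prop 0 1 0) Phi) (shift_prop 0 1 0 q) ->
    prv n G Th Phi q
| p_allrelI n G Th Phi k s t p :
    wf_ty n s = true -> wf_ty n t = true ->
    prv n G ((k, s, t) :: Th) (map (shift_prop 0 0 1) Phi) p ->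
    prv n G Th Phi (PAllRel k s t p)
| p_allrelE n G Th Phi k s t p r :
    isrel n G Th k r s t -> prv n G Th Phi (PAllRel k s t p) ->
    prv n G Th Phi (inst_prop_rel r p)
| p_exrelI n G Th Phi k s t p r :
    wf_prop n G Th (PExRel k s t p) -> isrel n G Th k r s t ->
    prv n G Th Phi (inst_prop_rel r p) -> prv n G Th Phi (PExRel k s t p)
| p_exrelE n G Th Phi k s t p q :
    wf_prop n G Th q -> prv n G Th Phi (PExRel k s t p) ->
    prv n G ((k, s, t) :: Th)
      (p :: map (shift_prop 0 0 1) Phi) (shift_prop 0 0 1 q) ->
    prv n G Th Phi q
(* ((x : s, y : t). p)(t1, t2)  iff  p[t1/x, t2/y] *)
| p_relI n G Th Phi s t p t1 t2 :
    wf_prop n G Th (PRel (RAbs s t p) t1 t2) ->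
    prv n G Th Phi (inst_prop_tm2 t1 t2 p) ->
    prv n G Th Phi (PRel (RAbs s t p) t1 t2)
| p_relE n G Th Phi s t p t1 t2 :
    prv n G Th Phi (PRel (RAbs s t p) t1 t2) ->
    prv n G Th Phi (inst_prop_tm2 t1 t2 p)
(* internal equality *)
| p_ext n G Th Phi s t u :
    exteq n (ints G) t u s -> prv n G Th Phi (PEq s t u)
| p_subst n G Th Phi s t u p :
    wf_prop n (s :: G) Th p -> prv n G Th Phi (PEq s t u) ->
    prv n G Th Phi (inst_prop_tm t p) -> prv n G Th Phi (inst_prop_tm u p)
(* extensionality schemes *)
| p_funext n G Th Phi s s' t u :
    wf_ty n s = true ->
    typed n (ints G) t (TLolli s s') -> typed n (ints G) u (TLolli s s') ->
    prv n G Th Phi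
      (PImp (PAll s (PEq s' (App (shift_tm 0 1 t) (Var 0))
                            (App (shift_tm 0 1 u) (Var 0))))
            (PEq (TLolli s s') t u))
| p_tyext n G Th Phi s t u :
    typed n (ints G) t (TPi s) -> typed n (ints G) u (TPi s) ->
    prv n G Th Phi
      (PImp (PAllTy (PEq s (TApp (shift_tm 1 0 t) (TVar 0))
                           (TApp (shift_tm 1 0 u) (TVar 0))))
            (PEq (TPi s) t u))
(* identity extension schema *)
| p_idext n G Th Phi s :
    wf_ty n s = true ->
    prv n G Th Phi
      (requiv s s (rint TVar TVar (fun i => req (TVar i)) s) (req s)).

Definition provable (n : nat) (p : prop) : Prop := prv n [] [] [] p.

(** * Functors induced by types *)

Inductive inductively_constructed : ty -> Prop :=
| ic_var i : inductively_constructed (TVar i)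
| ic_closed s : wf_ty 0 s = true -> inductively_constructed s
| ic_one : inductively_constructed TOne
| ic_tensor a b :
    inductively_constructed a -> inductively_constructed b ->
    inductively_constructed (TTensor a b)
| ic_lolli a b :
    inductively_constructed a -> inductively_constructed b ->
    inductively_constructed (TLolli a b)
| ic_bang a :
    inductively_constructed a -> inductively_constructed (TBang a)
| ic_pi a :
    inductively_constructed a -> inductively_constructed (TPi a).

(* All occurrences of variable k have polarity b (true: positive). *)
Fixpoint occurs_only (b : bool) (k : nat) (s : ty) : bool :=
  match s with
  | TVar i => if i =? k then b else true
  | TOne => true
  | TTensor a c => occurs_only b k a && occurs_only b k c
  | TLolli a c => occurs_only (negb b) k a && occurs_only b k c
  | TBang a => occurs_only b k a
  | TPi a => occurs_only b (S k) a
  end.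

Definition idtm (s : ty) : tm := Lam s (Var 0).

(* g o f, where s is the domain of f *)
Definition comp (s : ty) (g f : tm) : tm :=
  Lam s (App (shift_tm 0 1 g) (App (shift_tm 0 1 f) (Var 0))).

(** The action  s(th) -o s(th')  of f : th k -o th' k, where th and th' differ
    only at k.  In the domain of [TLolli] the roles of th and th' are exchanged:
    k occurs there only negatively, so f is reached only after an even number
    of exchanges. *)
Fixpoint fmap_rec (k : nat) (th th' : nat -> ty) (f : tm) (s : ty) : tm :=
  if wf_ty 0 s then idtm s else
  match s with
  | TVar i => if i =? k then f else idtm (th i)
  | TOne => idtm TOne
  | TTensor a b =>
      Lam (subst_ty th (TTensor a b))
        (LetTens (Var 0)
           (Tens (App (shift_tm 0 3 (fmap_rec k th th' f a)) (Var 1))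
                 (App (shift_tm 0 3 (fmap_rec k th th' f b)) (Var 0))))
  | TLolli a b =>
      Lam (subst_ty th (TLolli a b))
        (comp (subst_ty th' a)
           (shift_tm 0 1 (fmap_rec k th th' f b))
           (comp (subst_ty th' a)
              (Var 0)
              (shift_tm 0 1 (fmap_rec k th' th f a))))
  | TBang a =>
      Lam (subst_ty th (TBang a))
        (LetBang (Var 0)
           (Bang (App (shift_tm 0 2 (fmap_rec k th th' f a)) (Var 0))))
  | TPi a =>
      Lam (subst_ty th (TPi a))
        (TLam (App (shift_tm 0 1
                      (fmap_rec (S k) (up_ty th) (up_ty th')
                         (shift_tm 1 0 f) a))
                   (TApp (Var 0) (TVar 0))))
  end.

(* s(f) : s(t) -o s(t') for f : t -o t' *)
Definition fmap (s t t' : ty) (f : tm) : tm :=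
  fmap_rec 0 (scons t TVar) (scons t' TVar) f s.

(** * The final coalgebra

    In this section s = s(alpha) has variable 0 as its only free variable. *)

(* !(alpha -o s(alpha)) (x) alpha, in the scope of alpha *)
Definition ty_coalg (s : ty) : ty :=
  TTensor (TBang (TLolli (TVar 0) s)) (TVar 0).

Definition nu (s : ty) : ty :=
  TPi (TLolli (TPi (TLolli (ty_coalg s) (TVar 1))) (TVar 0)).

Definition pack (s : ty) : tm :=
  TLam (Lam (ty_coalg s)
    (TLam (Lam (TPi (TLolli (ty_coalg s) (TVar 1)))
      (App (TApp (Var 0) (TVar 1)) (Var 1))))).

Definition unfold (s : ty) : tm :=
  TLam (Lam (TBang (TLolli (TVar 0) s))
    (Lam (TVar 0)
      (App (TApp (pack s) (TVar 0)) (Tens (Var 1) (Var 0))))).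

(** In  let w (x) z = y in s(unfold alpha w)(let !f = w in f z)  the variable
    w : !(alpha -o s(alpha)) is bound linearly but used twice.  As usual for
    linear variables of type !(-), this stands for
      let w (x) z = y in let !v = w in
        s(unfold alpha !v)(let !f = !v in f z). *)
Definition out_arg (s : ty) : tm :=
  TLam (Lam (ty_coalg s)
    (LetTens (Var 0)
      (LetBang (Var 1)
        (App (fmap s (TVar 0) (nu s)
                (App (TApp (unfold s) (TVar 0)) (Bang (Var 0))))
             (LetBang (Bang (Var 0)) (App (Var 0) (Var 2))))))).

Definition out (s : ty) : tm :=
  Lam (nu s) (App (TApp (Var 0) (inst_ty (nu s) s)) (out_arg s)).

(** ** Coalgebras in LinType_Xi, where Xi has n variables *)

Definition is_coalg (n : nat) (s t : ty) (f : tm) : Prop :=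
  wf_ty n t = true /\ typed n [] f (TLolli t (inst_ty t s)).

(* h is a map of coalgebras from (t, f) to (t', f'). *)
Definition coalg_map (n : nat) (s t : ty) (f : tm) (t' : ty) (f' h : tm)
    : Prop :=
  typed n [] h (TLolli t t') /\
  provable n (PEq (TLolli t (inst_ty t' s))
                (comp t f' h) (comp t (fmap s t t' h) f)).

Definition final_coalg (n : nat) (s t' : ty) (f' : tm) : Prop :=
  is_coalg n s t' f' /\
  forall t f, is_coalg n s t f ->
    exists h, coalg_map n s t f t' f' h /\
      forall h', coalg_map n s t f t' f' h' ->
        provable n (PEq (TLolli t t') h' h).

(* Main.v *)
(** Only one half of the graph lemma for [sigma] is needed: [sigma[<h>]](u,
    sigma(h) u).  Identity extension at the closed type of the polymorphic term
    [/\a b. \!f. sigma(f)] relates [sigma(id)] and [sigma(h)] at [<h>], and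
    [sigma(id) = id] holds externally.

    For a map [h] of coalgebras from [f] to [out], the graph of [h] therefore
    relates [!f (x) x] to [!out (x) h x], and parametricity of [pack] gives
    [pack (!f (x) x) = g (h x)], where [g = unfold nu !out].  Applied to
    [h = unfold a !f] this says that [g] fixes every packed element.  A [z : nu]
    satisfies [g (z nu pack) = z] whenever [g] fixes the packed elements; using
    this for [g] and for the identity, [g z = z].  Hence
    [h x = g (h x) = pack (!f (x) x) = unfold tau !f x]. *)

From Stdlib Require Import List Arith Bool Lia FunctionalExtensionality.
Require Import Defs.
Import ListNotations.

(** * Renaming and substitution *)

(** Provability is an inductive predicate for which no weakening or substitution principle is
    established. Statements are therefore proved uniformly in all contexts [n G Th Phi], and a fact
    needed below further binders is cut in as a hypothesis, since the rules shift hypotheses by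
    themselves.

    Terms of the logic have only intuitionistic variables. Linear variables appear only under the
    binders of terms, and the terms substituted for them can be taken free of linear variables.

    The content of a package is an arbitrary element of a tensor whose first factor is a [!], while
    the beta rules act only on introduced terms. The gap is closed by induction principles for [!]
    and tensor: their interpretations are least admissible relations, and identity extension relates
    every element to itself.

    The only concrete relations ever instantiated are equality and preimages of equality,
    [f x = g y]; their admissibility is read off from the rules. The graph of [h] is the case
    [g = id], which is why (id, h) is the natural pair to feed into the parametricity of the
    functorial action. *)

Lemma subst_ty_ext th th' s :
  (forall i, th i = th' i) -> subst_ty th s = subst_ty th' s.
Proof. intros H; f_equal; now apply functional_extensionality. Qed.

Lemma ren_ty_subst xi s : ren_ty xi s = subst_ty (fun i => TVar (xi i)) s.
Proof.
  revert xi; induction s; intros xi; cbn; f_equal; auto.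
  rewrite IHs; apply subst_ty_ext; now intros [|i].
Qed.

(** Substitution after renaming, renaming after renaming, renaming after substitution and
    substitution after substitution come in this order, because passing a binder in a later law uses
    the earlier ones. Terms and relations follow the same order. *)
Lemma subst_ren_ty th xi s :
  subst_ty th (ren_ty xi s) = subst_ty (fun i => th (xi i)) s.
Proof.
  revert th xi; induction s; intros th xi; cbn; f_equal; auto.
  rewrite IHs; apply subst_ty_ext; now intros [|i].
Qed.

Lemma ren_ren_ty xi xi' s : ren_ty xi (ren_ty xi' s) = ren_ty (fun i => xi (xi' i)) s.
Proof. now rewrite ren_ty_subst, subst_ren_ty, (ren_ty_subst (fun i => _)). Qed.

Lemma ren_subst_ty xi th s :
  ren_ty xi (subst_ty th s) = subst_ty (fun i => ren_ty xi (th i)) s.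
Proof.
  revert th xi; induction s; intros th xi; cbn; f_equal; auto.
  rewrite IHs; apply subst_ty_ext; intros [|i]; cbn; auto.
  now rewrite !ren_ren_ty.
Qed.

Lemma subst_subst_ty th th' s :
  subst_ty th (subst_ty th' s) = subst_ty (fun i => subst_ty th (th' i)) s.
Proof.
  revert th th'; induction s; intros th th'; cbn; f_equal; auto.
  rewrite IHs; apply subst_ty_ext; intros [|i]; cbn; auto.
  now rewrite subst_ren_ty, ren_subst_ty.
Qed.

Lemma subst_ty_agree n th th' s :
  wf_ty n s = true -> (forall i, i < n -> th i = th' i) ->
  subst_ty th s = subst_ty th' s.
Proof.
  revert n th th'; induction s; intros n th th' W H; cbn [wf_ty subst_ty] in *;
    rewrite ?andb_true_iff in W;
    [now apply H, Nat.ltb_lt | f_equal; try now intuition eauto ..].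
  - apply (IHs (S n)); auto.
    intros [|i] Hi; cbn; auto; rewrite H; auto; lia.
Qed.

Lemma subst_ty_id th s : (forall i, th i = TVar i) -> subst_ty th s = s.
Proof.
  revert th; induction s; intros th H; cbn; f_equal; auto.
  apply IHs; intros [|i]; cbn; auto; now rewrite H.
Qed.

Lemma subst_ty_closed th s : wf_ty 0 s = true -> subst_ty th s = s.
Proof.
  intros W; rewrite (subst_ty_agree 0 th TVar) by (auto; lia).
  now apply subst_ty_id.
Qed.

Lemma subst_tm_ext th th' s s' t :
  (forall i, th i = th' i) -> (forall i, s i = s' i) ->
  subst_tm th s t = subst_tm th' s' t.
Proof. intros H H'; f_equal; now apply functional_extensionality. Qed.

Lemma ren_tm_subst xi zeta t :
  ren_tm xi zeta t = subst_tm (fun i => TVar (xi i)) (fun i => Var (zeta i)) t.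
Proof.
  revert xi zeta; induction t; intros xi zeta; cbn; rewrite ?ren_ty_subst;
    f_equal; auto;
    rewrite ?IHt, ?IHt2; apply subst_tm_ext; intros [|[|i]]; reflexivity.
Qed.

Lemma subst_ren_tm th s xi zeta t :
  subst_tm th s (ren_tm xi zeta t) =
  subst_tm (fun i => th (xi i)) (fun i => s (zeta i)) t.
Proof.
  revert th s xi zeta; induction t; intros th s' xi zeta; cbn;
    rewrite ?subst_ren_ty; f_equal; auto;
    rewrite ?IHt, ?IHt2; apply subst_tm_ext; intros [|[|i]]; reflexivity.
Qed.

Lemma ren_ren_tm xi zeta xi' zeta' t :
  ren_tm xi zeta (ren_tm xi' zeta' t) =
  ren_tm (fun i => xi (xi' i)) (fun i => zeta (zeta' i)) t.
Proof. now rewrite ren_tm_subst, subst_ren_tm, (ren_tm_subst (fun i => _)). Qed.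

Lemma ren_subst_tm xi zeta th s t :
  ren_tm xi zeta (subst_tm th s t) =
  subst_tm (fun i => ren_ty xi (th i)) (fun i => ren_tm xi zeta (s i)) t.
Proof.
  revert th s xi zeta; induction t; intros th s' xi zeta; cbn;
    rewrite ?ren_subst_ty; f_equal; auto;
    rewrite ?IHt, ?IHt2; apply subst_tm_ext; intros [|[|i]]; cbn; auto;
    unfold shift_tm; now rewrite ?ren_ren_ty, ?ren_ren_tm.
Qed.

Lemma subst_subst_tm th s th' s' t :
  subst_tm th s (subst_tm th' s' t) =
  subst_tm (fun i => subst_ty th (th' i)) (fun i => subst_tm th s (s' i)) t.
Proof.
  revert th s th' s'; induction t; intros th s0 th' s'; cbn;
    rewrite ?subst_subst_ty; f_equal; auto;
    rewrite ?IHt, ?IHt2; apply subst_tm_ext; intros [|[|i]]; cbn; auto;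
    unfold shift_tm;
    rewrite ?subst_ren_ty, ?ren_subst_ty, ?subst_ren_tm, ?ren_subst_tm; auto;
    (* A shift of term variables alone still renames type variables by [Nat.add 0]; the leftover
       goals remove this identity renaming. *)
    apply subst_tm_ext; intros j; cbn; unfold shift_tm;
    rewrite ?ren_ty_subst, ?subst_subst_ty, ?ren_ren_tm; auto;
    symmetry; auto using subst_ty_id.
Qed.

Lemma subst_tm_id th s t :
  (forall i, th i = TVar i) -> (forall i, s i = Var i) -> subst_tm th s t = t.
Proof.
  revert th s; induction t; intros th s' H H'; cbn;
    rewrite ?subst_ty_id by auto; f_equal; auto;
    (apply IHt || apply IHt2); auto; intros [|[|i]]; cbn;
    rewrite ?H, ?H'; reflexivity.
Qed.

(* Renaming and substitution in propositions and definable relations *)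
Scheme prop_rel_ind := Induction for prop Sort Prop
with rel_prop_ind := Induction for rel Sort Prop.
Combined Scheme prop_rel_mutind from prop_rel_ind, rel_prop_ind.

Lemma subst_rel_ext th th' s s' e e' r :
  (forall i, th i = th' i) -> (forall i, s i = s' i) -> (forall i, e i = e' i) ->
  subst_rel th s e r = subst_rel th' s' e' r.
Proof. intros; f_equal; now apply functional_extensionality. Qed.

Lemma subst_prop_ext th th' s s' e e' p :
  (forall i, th i = th' i) -> (forall i, s i = s' i) -> (forall i, e i = e' i) ->
  subst_prop th s e p = subst_prop th' s' e' p.
Proof. intros; f_equal; now apply functional_extensionality. Qed.

(** Three cases suffice because no binder introduces more than two variables at once; [RAbs]
    introduces two term variables. *)
Ltac pointwise :=
  first [apply subst_prop_ext | apply subst_rel_ext | apply subst_tm_ext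
        | apply subst_ty_ext];
  intros [|[|i]]; try reflexivity.

Lemma ren_prop_rel_subst :
  (forall p xi zeta chi, ren_prop xi zeta chi p =
     subst_prop (fun i => TVar (xi i)) (fun i => Var (zeta i))
       (fun i => RVar (chi i)) p) /\
  (forall r xi zeta chi, ren_rel xi zeta chi r =
     subst_rel (fun i => TVar (xi i)) (fun i => Var (zeta i))
       (fun i => RVar (chi i)) r).
Proof.
  apply prop_rel_mutind; intros; cbn; rewrite ?ren_ty_subst, ?ren_tm_subst;
    f_equal; auto; rewrite H; pointwise.
Qed.

Lemma ren_prop_subst xi zeta chi p :
  ren_prop xi zeta chi p =
  subst_prop (fun i => TVar (xi i)) (fun i => Var (zeta i))
    (fun i => RVar (chi i)) p.
Proof. apply ren_prop_rel_subst. Qed.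

Lemma ren_rel_subst xi zeta chi r :
  ren_rel xi zeta chi r =
  subst_rel (fun i => TVar (xi i)) (fun i => Var (zeta i))
    (fun i => RVar (chi i)) r.
Proof. apply ren_prop_rel_subst. Qed.

Lemma subst_ren_prop_rel :
  (forall p th s e xi zeta chi, subst_prop th s e (ren_prop xi zeta chi p) =
     subst_prop (fun i => th (xi i)) (fun i => s (zeta i))
       (fun i => e (chi i)) p) /\
  (forall r th s e xi zeta chi, subst_rel th s e (ren_rel xi zeta chi r) =
     subst_rel (fun i => th (xi i)) (fun i => s (zeta i))
       (fun i => e (chi i)) r).
Proof.
  apply prop_rel_mutind; intros; cbn; rewrite ?subst_ren_ty, ?subst_ren_tm;
    f_equal; auto; rewrite H; pointwise.
Qed.

Lemma subst_ren_rel th s e xi zeta chi r :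
  subst_rel th s e (ren_rel xi zeta chi r) =
  subst_rel (fun i => th (xi i)) (fun i => s (zeta i)) (fun i => e (chi i)) r.
Proof. apply subst_ren_prop_rel. Qed.

Lemma ren_ren_rel xi zeta chi xi' zeta' chi' r :
  ren_rel xi zeta chi (ren_rel xi' zeta' chi' r) =
  ren_rel (fun i => xi (xi' i)) (fun i => zeta (zeta' i))
    (fun i => chi (chi' i)) r.
Proof. now rewrite ren_rel_subst, subst_ren_rel, (ren_rel_subst (fun i => _)). Qed.

Lemma ren_subst_prop_rel :
  (forall p xi zeta chi th s e, ren_prop xi zeta chi (subst_prop th s e p) =
     subst_prop (fun i => ren_ty xi (th i)) (fun i => ren_tm xi zeta (s i))
       (fun i => ren_rel xi zeta chi (e i)) p) /\
  (forall r xi zeta chi th s e, ren_rel xi zeta chi (subst_rel th s e r) =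
     subst_rel (fun i => ren_ty xi (th i)) (fun i => ren_tm xi zeta (s i))
       (fun i => ren_rel xi zeta chi (e i)) r).
Proof.
  apply prop_rel_mutind; intros; cbn; rewrite ?ren_subst_ty, ?ren_subst_tm;
    f_equal; auto; rewrite H; pointwise; cbn;
    unfold shift_tm, shift_rel;
    now rewrite ?ren_ren_ty, ?ren_ren_tm, ?ren_ren_rel.
Qed.

Lemma ren_subst_rel xi zeta chi th s e r :
  ren_rel xi zeta chi (subst_rel th s e r) =
  subst_rel (fun i => ren_ty xi (th i)) (fun i => ren_tm xi zeta (s i))
       (fun i => ren_rel xi zeta chi (e i)) r.
Proof. apply ren_subst_prop_rel. Qed.

Lemma subst_rel_id_mut :
  (forall p th s e, (forall i, th i = TVar i) -> (forall i, s i = Var i) ->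
     (forall i, e i = RVar i) -> subst_prop th s e p = p) /\
  (forall r th s e, (forall i, th i = TVar i) -> (forall i, s i = Var i) ->
     (forall i, e i = RVar i) -> subst_rel th s e r = r).
Proof.
  apply prop_rel_mutind; intros; cbn;
    rewrite ?subst_ty_id, ?subst_tm_id by auto; f_equal; auto;
    apply H; intros [|[|j]]; cbn; rewrite ?H0, ?H1, ?H2; reflexivity.
Qed.

Lemma subst_rel_id th s e r :
  (forall i, th i = TVar i) -> (forall i, s i = Var i) ->
  (forall i, e i = RVar i) -> subst_rel th s e r = r.
Proof. apply subst_rel_id_mut. Qed.

Lemma subst_subst_prop_rel :
  (forall p th s e th' s' e', subst_prop th s e (subst_prop th' s' e' p) =
     subst_prop (fun i => subst_ty th (th' i)) (fun i => subst_tm th s (s' i))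
       (fun i => subst_rel th s e (e' i)) p) /\
  (forall r th s e th' s' e', subst_rel th s e (subst_rel th' s' e' r) =
     subst_rel (fun i => subst_ty th (th' i)) (fun i => subst_tm th s (s' i))
       (fun i => subst_rel th s e (e' i)) r).
Proof.
  apply prop_rel_mutind; intros; cbn; rewrite ?subst_subst_ty, ?subst_subst_tm;
    f_equal; auto; rewrite H; pointwise; cbn;
    unfold shift_tm, shift_rel;
    rewrite ?subst_ren_ty, ?ren_subst_ty, ?subst_ren_tm, ?ren_subst_tm,
      ?subst_ren_rel, ?ren_subst_rel; auto;
    first [apply subst_rel_ext | apply subst_tm_ext | apply subst_ty_ext];
    intros j; cbn; unfold shift_tm, shift_rel;
    rewrite ?ren_ty_subst, ?ren_tm_subst, ?ren_rel_subst, ?subst_subst_ty,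
      ?subst_subst_tm; cbn;
    try reflexivity; symmetry;
    auto using subst_ty_id, subst_tm_id, subst_rel_id.
Qed.

Lemma subst_subst_rel th s e th' s' e' r :
  subst_rel th s e (subst_rel th' s' e' r) =
  subst_rel (fun i => subst_ty th (th' i)) (fun i => subst_tm th s (s' i))
       (fun i => subst_rel th s e (e' i)) r.
Proof. apply subst_subst_prop_rel. Qed.

Lemma subst_subst_prop th s e th' s' e' r :
  subst_prop th s e (subst_prop th' s' e' r) =
  subst_prop (fun i => subst_ty th (th' i)) (fun i => subst_tm th s (s' i))
       (fun i => subst_rel th s e (e' i)) r.
Proof. apply subst_subst_prop_rel. Qed.

(** * Typing under substitution *)

Lemma wf_ty_ren n m xi s :
  wf_ty n s = true -> (forall i, i < n -> xi i < m) ->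
  wf_ty m (ren_ty xi s) = true.
Proof.
  revert n m xi; induction s; intros n m xi W H; cbn [wf_ty ren_ty] in *;
    rewrite ?andb_true_iff in *; auto; try now intuition eauto.
  - rewrite Nat.ltb_lt in *; auto.
  - apply (IHs (S n)); auto.
    intros [|j] Hj; cbn; [lia|]; specialize (H j); lia.
Qed.

Lemma wf_ty_subst n m th s :
  wf_ty n s = true -> (forall i, i < n -> wf_ty m (th i) = true) ->
  wf_ty m (subst_ty th s) = true.
Proof.
  revert n m th; induction s; intros n m th W H; cbn [wf_ty subst_ty] in *;
    rewrite ?andb_true_iff in *; auto; try now intuition eauto.
  - now apply H, Nat.ltb_lt.
  - apply (IHs (S n)); auto; intros [|i] Hi; cbn; auto.
    apply (wf_ty_ren m); [apply H; lia|lia].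
Qed.

Lemma wf_ty_shift n s : wf_ty n s = true -> wf_ty (S n) (ren_ty S s) = true.
Proof. intros; apply (wf_ty_ren n); auto; lia. Qed.

Lemma wf_ty_le n m s : wf_ty n s = true -> n <= m -> wf_ty m s = true.
Proof.
  intros W H; rewrite <- (subst_ty_id TVar s) by auto.
  apply (wf_ty_subst n); auto; intros; cbn; apply Nat.ltb_lt; lia.
Qed.

Lemma wf_inst_ty n s t :
  wf_ty n t = true -> wf_ty (S n) s = true -> wf_ty n (inst_ty t s) = true.
Proof.
  intros W W'; apply (wf_ty_subst (S n)); auto.
  intros [|i] Hi; cbn; auto; apply Nat.ltb_lt; lia.
Qed.

(** * Splitting of linear contexts *)

Definition erase_lin (X : list decl) : list decl :=
  map (fun d => match d with Lin _ => Gone | _ => d end) X.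

(** Half of a split is described by the set of positions whose linear variables it keeps;
    complementary sets give complementary halves. *)
Fixpoint part (p : nat -> bool) (X : list decl) : list decl :=
  match X with
  | [] => []
  | Lin s :: X =>
      (if p 0 then Lin s else Gone) :: part (fun i => p (S i)) X
  | d :: X => d :: part (fun i => p (S i)) X
  end.

Lemma split_part p X : split X (part p X) (part (fun i => negb (p i)) X).
Proof.
  revert p; induction X as [|[s|s|] X IH]; intros p; cbn.
  - constructor.
  - constructor; apply (IH (fun i => p (S i))).
  - destruct (p 0); cbn; constructor; apply (IH (fun i => p (S i))).
  - constructor; apply (IH (fun i => p (S i))).
Qed.

Lemma nth_part p X i :
  nth_error (part p X) i =
  match nth_error X i with
  | Some (Lin s) => Some (if p i then Lin s else Gone)
  | o => o
  end.
Proof.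
  revert p i; induction X as [|[s|s|] X IH]; intros p [|i]; cbn; auto;
    now rewrite IH.
Qed.

(** The halves of a split share their intuitionistic declarations, so a term without linear
    variables stays available in both of them. *)
Lemma erase_lin_part p X : erase_lin (part p X) = erase_lin X.
Proof.
  revert p; induction X as [|[s|s|] X IH]; intros p; cbn; f_equal;
    try apply IH; now destruct (p 0).
Qed.

Lemma split_nth X X1 X2 i :
  split X X1 X2 ->
  match nth_error X i with
  | Some (Lin s) =>
      nth_error X1 i = Some (Lin s) /\ nth_error X2 i = Some Gone \/
      nth_error X1 i = Some Gone /\ nth_error X2 i = Some (Lin s)
  | o => nth_error X1 i = o /\ nth_error X2 i = o
  end.
Proof.
  intros H; revert i; induction H; intros [|i]; cbn; auto; apply IHsplit.
Qed.

Lemma nolin_nil : nolin [].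
Proof. intros [|i] s; discriminate. Qed.

Lemma nolin_int s X : nolin X -> nolin (Int s :: X).
Proof. intros H [|i] s'; cbn; [discriminate|apply H]. Qed.

Lemma nolin_gone X : nolin X -> nolin (Gone :: X).
Proof. intros H [|i] s'; cbn; [discriminate|apply H]. Qed.

Lemma nolin_cons_inv d X : nolin (d :: X) -> nolin X.
Proof. intros H i; apply (H (S i)). Qed.

Lemma nolin_ints G : nolin (ints G).
Proof. induction G; cbn; [apply nolin_nil|now apply nolin_int]. Qed.

Lemma nolin_shift X : nolin X -> nolin (map shift_decl X).
Proof.
  intros H i s; rewrite nth_error_map; specialize (H i).
  destruct (nth_error X i) as [[]|]; cbn; try discriminate.
  exfalso; now apply (H s0).
Qed.

Lemma nolin_erase X : nolin (erase_lin X).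
Proof.
  intros i s; unfold erase_lin; rewrite nth_error_map.
  destruct (nth_error X i) as [[]|]; cbn; discriminate.
Qed.

Lemma erase_lin_nolin X : nolin X -> erase_lin X = X.
Proof.
  induction X as [|[s|s|] X IH]; intros H; cbn; f_equal;
    try (apply IH; eapply nolin_cons_inv; eassumption).
  now destruct (H 0 s).
Qed.

Lemma erase_lin_shift X :
  erase_lin (map shift_decl X) = map shift_decl (erase_lin X).
Proof.
  unfold erase_lin; rewrite !map_map; apply map_ext; now intros [].
Qed.

Lemma split_nolin X : nolin X -> split X X X.
Proof.
  induction X as [|[s|s|] X IH]; intros H; try (now destruct (H 0 s));
    constructor; apply IH; eapply nolin_cons_inv; eassumption.
Qed.

(** [P m Y t a] stands for the terms put in place of variables: for variables
    only, this gives renaming, which is then used to show that typed terms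
    qualify as well. *)
Record valued (P : nat -> list decl -> tm -> ty -> Prop) : Prop := {
  v_typed m Y t a : P m Y t a -> nolin Y -> typed m Y t a;
  v_gone m Y t a : P m Y t a -> P m (Gone :: Y) (shift_tm 0 1 t) a;
  v_int m Y t a b : P m Y t a -> P m (Int b :: Y) (shift_tm 0 1 t) a;
  v_new m Y a : P m (Int a :: Y) (Var 0) a;
  v_ty m Y t a :
    P m Y t a -> P (S m) (map shift_decl Y) (shift_tm 1 0 t) (ren_ty S a)
}.

(** Linear variables with [c i = true] are renamed to linear variables of Y;
    the others are replaced by terms without linear variables. *)
Record subst_ok (P : nat -> list decl -> tm -> ty -> Prop) (m : nat)
    (th : nat -> ty) (s : nat -> tm) (c : nat -> bool) (rho : nat -> nat)
    (X Y : list decl) : Prop := {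
  so_int i a :
    nth_error X i = Some (Int a) -> P m (erase_lin Y) (s i) (subst_ty th a);
  so_lin i a :
    nth_error X i = Some (Lin a) ->
    if c i then s i = Var (rho i) /\
                nth_error Y (rho i) = Some (Lin (subst_ty th a))
    else P m (erase_lin Y) (s i) (subst_ty th a);
  so_cover j b :
    nth_error Y j = Some (Lin b) ->
    exists i a, nth_error X i = Some (Lin a) /\ c i = true /\ rho i = j;
  so_inj i i' a a' :
    nth_error X i = Some (Lin a) -> nth_error X i' = Some (Lin a') ->
    c i = true -> c i' = true -> rho i = rho i' -> i = i'
}.

(** The split of X is transported along [rho]: Y1 keeps exactly the images of the renamed linear
    variables of X1. Injectivity of [rho] keeps images of variables of X2 out of Y1, and coverage
    shows that whatever is left over comes from X2. *)
Lemma subst_ok_split P m th s c rho X X1 X2 Y :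
  subst_ok P m th s c rho X Y -> split X X1 X2 ->
  exists Y1 Y2, split Y Y1 Y2 /\
    subst_ok P m th s c rho X1 Y1 /\ subst_ok P m th s c rho X2 Y2.
Proof.
  intros [Hi Hl Hc Hj] HS.
  (* [q] marks the renamed linear variables of X1 and [p] their images. As [rho] comes without an
     inverse, membership in the image is decided by a bounded search over the positions of X1. *)
  pose (q i := match nth_error X1 i with Some (Lin _) => c i | _ => false end).
  pose (p j := existsb (fun i => q i && (rho i =? j)) (seq 0 (length X1))).
  assert (Hp : forall j, p j = true <->
    exists i a, nth_error X1 i = Some (Lin a) /\ c i = true /\ rho i = j).
  { intros j; unfold p; rewrite existsb_exists; split.
    - intros (i & _ & H); unfold q in H.
      destruct (nth_error X1 i) as [[]|] eqn:E; cbn in H; try discriminate.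
      apply andb_true_iff in H as [H H']; apply Nat.eqb_eq in H'; eauto 6.
    - intros (i & a & H & H' & H''); exists i; split.
      + apply in_seq; cbn; split; [lia|]; apply nth_error_Some; congruence.
      + unfold q; rewrite H, H'; now apply Nat.eqb_eq. }
  assert (H1 : forall i a, nth_error X1 i = Some (Lin a) ->
     nth_error X i = Some (Lin a) /\ nth_error X2 i = Some Gone).
  { intros i a H; pose proof (split_nth _ _ _ i HS) as HH.
    destruct (nth_error X i) as [[]|]; cbn in HH; intuition congruence. }
  assert (H2 : forall i a, nth_error X2 i = Some (Lin a) ->
     nth_error X i = Some (Lin a) /\ nth_error X1 i = Some Gone).
  { intros i a H; pose proof (split_nth _ _ _ i HS) as HH.
    destruct (nth_error X i) as [[]|]; cbn in HH; intuition congruence. }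
  exists (part p Y), (part (fun i => negb (p i)) Y).
  split; [apply split_part|]; split; split.
  - intros i a H; rewrite erase_lin_part; apply Hi.
    pose proof (split_nth _ _ _ i HS) as HH.
    destruct (nth_error X i) as [[]|]; cbn in HH; intuition congruence.
  - intros i a H; destruct (H1 _ _ H) as [H' _]; specialize (Hl _ _ H').
    destruct (c i) eqn:E; rewrite ?erase_lin_part; auto.
    destruct Hl as [Hl Hl']; split; auto; rewrite nth_part, Hl'.
    replace (p (rho i)) with true; auto; symmetry; apply Hp; eauto 6.
  - intros j b H; rewrite nth_part in H; apply Hp.
    destruct (nth_error Y j) as [[]|]; try discriminate.
    destruct (p j); congruence.
  - intros i i' a a' H H'; destruct (H1 _ _ H), (H1 _ _ H'); eauto.
  - intros i a H; rewrite erase_lin_part; apply Hi.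
    pose proof (split_nth _ _ _ i HS) as HH.
    destruct (nth_error X i) as [[]|]; cbn in HH; intuition congruence.
  - intros i a H; destruct (H2 _ _ H) as [H' H'']; specialize (Hl _ _ H').
    destruct (c i) eqn:E; rewrite ?erase_lin_part; auto.
    destruct Hl as [Hl Hl']; split; auto; rewrite nth_part, Hl'.
    destruct (p (rho i)) eqn:E'; auto.
    apply Hp in E' as (i' & a' & E1 & E2 & E3); destruct (H1 _ _ E1) as [E4 _].
    assert (i' = i) by eauto; congruence.
  - intros j b H; rewrite nth_part in H.
    destruct (nth_error Y j) as [[]|] eqn:E; try discriminate.
    destruct (p j) eqn:E'; cbn in H; try discriminate.
    destruct (Hc _ _ E) as (i & a & E1 & E2 & E3).
    pose proof (split_nth _ _ _ i HS) as HH; rewrite E1 in HH.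
    destruct HH as [[HH _]|[_ HH]]; eauto 6.
    assert (p j = true) by (apply Hp; eauto 6); congruence.
  - intros i i' a a' H H'; destruct (H2 _ _ H), (H2 _ _ H'); eauto.
Qed.

(** A freshly bound linear variable is always renamed, to itself. This is why linear variables that
    are replaced and linear variables that are renamed have to coexist in [subst_ok]. *)
Lemma subst_ok_lin P m th s c rho X Y a :
  valued P -> subst_ok P m th s c rho X Y ->
  subst_ok P m th (up_tm s) (scons true c) (upren rho)
    (Lin a :: X) (Lin (subst_ty th a) :: Y).
Proof.
  intros V [Hi Hl Hc Hj]; split.
  - intros [|i] b; cbn; [discriminate|]; intros H; now apply V, Hi.
  - intros [|i] b; cbn; intros H.
    + injection H as ->; auto.
    + specialize (Hl _ _ H); destruct (c i); [|now apply V].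
      destruct Hl as [-> ?]; auto.
  - intros [|j] b; cbn; intros H.
    + exists 0, a; auto.
    + destruct (Hc _ _ H) as (i & a' & ? & ? & ?); exists (S i), a'; cbn; auto.
  - intros [|i] [|i'] b b'; cbn; try discriminate; auto.
    intros H H' C C' E; f_equal; eapply Hj; eauto.
Qed.

Lemma subst_ok_int P m th s c rho X Y a :
  valued P -> subst_ok P m th s c rho X Y ->
  subst_ok P m th (up_tm s) (scons true c) (upren rho)
    (Int a :: X) (Int (subst_ty th a) :: Y).
Proof.
  intros V [Hi Hl Hc Hj]; split.
  - intros [|i] b; cbn; intros H; [|now apply V, Hi].
    injection H as ->; apply V.
  - intros [|i] b; cbn; [discriminate|]; intros H.
    specialize (Hl _ _ H); destruct (c i); [|now apply V].
    destruct Hl as [-> ?]; auto.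
  - intros [|j] b; cbn; [discriminate|]; intros H.
    destruct (Hc _ _ H) as (i & a' & ? & ? & ?); exists (S i), a'; cbn; auto.
  - intros [|i] [|i'] b b'; cbn; try discriminate; auto.
    intros H H' C C' E; f_equal; eapply Hj; eauto.
Qed.

Lemma subst_ok_ty P m th s c rho X Y :
  valued P -> subst_ok P m th s c rho X Y ->
  subst_ok P (S m) (up_ty th) (fun i => shift_tm 1 0 (s i)) c rho
    (map shift_decl X) (map shift_decl Y).
Proof.
  intros V [Hi Hl Hc Hj].
  assert (EX : forall X i a, nth_error (map shift_decl X) i = Some (Lin a) ->
     exists a', nth_error X i = Some (Lin a') /\ a = ren_ty S a').
  { clear; intros X i a H; rewrite nth_error_map in H.
    destruct (nth_error X i) as [[]|]; try discriminate.
    injection H as <-; eauto. }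
  split.
  - intros i a H; rewrite nth_error_map in H.
    destruct (nth_error X i) as [[]|] eqn:E; try discriminate.
    injection H as <-; rewrite erase_lin_shift, subst_ren_ty.
    replace (subst_ty _ s0) with (ren_ty S (subst_ty th s0))
      by now rewrite ren_subst_ty.
    now apply V, Hi.
  - intros i a H; apply EX in H as (a' & H & ->); specialize (Hl _ _ H).
    rewrite subst_ren_ty.
    replace (subst_ty _ a') with (ren_ty S (subst_ty th a'))
      by now rewrite ren_subst_ty.
    destruct (c i).
    + destruct Hl as [-> H']; split; auto; now rewrite nth_error_map, H'.
    + rewrite erase_lin_shift; now apply V.
  - intros j b H; apply EX in H as (b' & H & ->).
    destruct (Hc _ _ H) as (i & a' & E & ? & ?).
    exists i, (ren_ty S a'); rewrite nth_error_map, E; auto.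
  - intros i i' a a' H H'; apply EX in H as (? & H & ->);
      apply EX in H' as (? & H' & ->); eauto.
Qed.

Lemma subst_ok_nolin P m th s c rho X Y :
  subst_ok P m th s c rho X Y -> nolin X -> nolin Y.
Proof.
  intros H N j b E; destruct (so_cover _ _ _ _ _ _ _ _ H _ _ E)
    as (i & a & E' & _); now apply (N i a).
Qed.

Lemma up_inst_ty th s s' :
  subst_ty th (inst_ty s' s) = inst_ty (subst_ty th s') (subst_ty (up_ty th) s).
Proof.
  unfold inst_ty; rewrite !subst_subst_ty; apply subst_ty_ext.
  intros [|i]; cbn; auto; rewrite subst_ren_ty; symmetry; now apply subst_ty_id.
Qed.

Lemma typed_subst_valued P n X t a :
  valued P -> typed n X t a ->
  forall m th s c rho Y,
  (forall i, i < n -> wf_ty m (th i) = true) ->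
  subst_ok P m th s c rho X Y ->
  typed m Y (subst_tm th s t) (subst_ty th a).
Proof.
  intros V T; induction T; intros m th s0 c rho Y W SO; cbn;
    try pose proof (subst_ok_split _ _ _ _ _ _ _ _ _ _ SO ltac:(eassumption))
      as (Y1 & Y2 & HS & SO1 & SO2);
    try pose proof (subst_ok_nolin _ _ _ _ _ _ _ _ SO ltac:(eassumption)) as NY.
  - rewrite <- (erase_lin_nolin Y) by auto.
    apply (v_typed _ V); [eapply so_int; eauto|apply nolin_erase].
  - destruct H as [H H']; pose proof (so_lin _ _ _ _ _ _ _ _ SO _ _ H) as HL.
    destruct (c i) eqn:E.
    + destruct HL as [-> HL]; apply ty_var_lin; split; auto.
      intros j b Hj; destruct (so_cover _ _ _ _ _ _ _ _ SO _ _ Hj)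
        as (i' & a' & E1 & _ & <-); now rewrite (H' _ _ E1).
    (* A linear variable of Y would be the image of a renamed linear variable of X; the only linear
       variable of X is i, and it is replaced rather than renamed. *)
    + assert (NY : nolin Y).
      { intros j b Hj; destruct (so_cover _ _ _ _ _ _ _ _ SO _ _ Hj)
          as (i' & a' & E1 & E2 & _); rewrite (H' _ _ E1) in E2; congruence. }
      rewrite <- (erase_lin_nolin Y) by auto.
      apply (v_typed _ V); auto using nolin_erase.
  - now apply ty_star.
  - now apply ty_fix.
  - apply ty_lam; [now apply (wf_ty_subst n)|].
    eapply IHT; eauto using subst_ok_lin.
  - eapply ty_app; eauto; eapply IHT1; eauto.
  - eapply ty_tens; eauto.
  - apply ty_bang; eauto.
  - apply ty_tlam; eapply IHT; [|apply subst_ok_ty; eauto].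
    intros [|i] Hi; cbn; auto; apply wf_ty_shift, W; lia.
  - rewrite up_inst_ty; apply ty_tapp; [now apply (wf_ty_subst n)|].
    eapply IHT; eauto.
  - eapply ty_letstar; eauto; eapply IHT1; eauto.
  - eapply ty_lettens; eauto; eapply IHT2; eauto using subst_ok_lin.
  - eapply ty_letbang; eauto; eapply IHT2; eauto using subst_ok_int.
Qed.

Lemma valued_var :
  valued (fun m Y t a => exists i, t = Var i /\ nth_error Y i = Some (Int a)).
Proof.
  split; intros m Y.
  - intros t a (i & -> & H) N; now apply ty_var_int.
  - intros t a (i & -> & H); now exists (S i).
  - intros t a b (i & -> & H); now exists (S i).
  - intros a; now exists 0.
  - intros t a (i & -> & H); exists i; now rewrite nth_error_map, H.
Qed.

(** The starting point for renamings and substitutions alike: at the outermost level all linear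
    variables are replaced by terms without linear variables. Entries with [c] true arise only when
    a binder is crossed. *)
Lemma subst_ok_discard P m th s X Y :
  nolin Y ->
  (forall i a, nth_error X i = Some (Int a) \/ nth_error X i = Some (Lin a) ->
     P m Y (s i) (subst_ty th a)) ->
  subst_ok P m th s (fun _ => false) (fun i => i) X Y.
Proof.
  intros N H; split; try discriminate.
  - intros; rewrite erase_lin_nolin by auto; auto.
  - intros; rewrite erase_lin_nolin by auto; auto.
  - intros j b E; now destruct (N j b).
Qed.

Lemma typed_ren n m xi zeta X Y t a :
  typed n X t a -> nolin X -> nolin Y ->
  (forall i, i < n -> xi i < m) ->
  (forall i b, nth_error X i = Some (Int b) ->
     nth_error Y (zeta i) = Some (Int (ren_ty xi b))) ->
  typed m Y (ren_tm xi zeta t) (ren_ty xi a).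
Proof.
  intros T NX NY Hx H; rewrite ren_tm_subst, ren_ty_subst.
  eapply typed_subst_valued; [apply valued_var|apply T| |].
  - intros i Hi; cbn; now apply Nat.ltb_lt, Hx.
  - apply subst_ok_discard; auto.
    intros i b [E|E]; [|now destruct (NX i b)].
    exists (zeta i); split; auto; rewrite <- ren_ty_subst; auto.
Qed.

Lemma valued_typed : valued (fun m Y t a => nolin Y -> typed m Y t a).
Proof.
  split; intros m Y; auto.
  - intros t a H N; apply nolin_cons_inv in N.
    replace a with (ren_ty (Nat.add 0) a)
      by (rewrite ren_ty_subst; now apply subst_ty_id).
    apply (typed_ren m m _ _ Y); auto using nolin_gone.
    intros i b E; cbn; rewrite E; f_equal; f_equal.
    rewrite ren_ty_subst; symmetry; now apply subst_ty_id.
  - intros t a b H N; apply nolin_cons_inv in N.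
    replace a with (ren_ty (Nat.add 0) a)
      by (rewrite ren_ty_subst; now apply subst_ty_id).
    apply (typed_ren m m _ _ Y); auto using nolin_int.
    intros i c E; cbn; rewrite E; f_equal; f_equal.
    rewrite ren_ty_subst; symmetry; now apply subst_ty_id.
  - intros a N; now apply ty_var_int.
  - intros t a H N.
    assert (nolin Y).
    { intros i b E; apply (N i (ren_ty S b)); now rewrite nth_error_map, E. }
    apply (typed_ren m (S m) _ _ Y); auto; [intros; cbn; lia|].
    intros i c E; cbn; now rewrite nth_error_map, E.
Qed.

Lemma typed_subst n m th s X Y t a :
  typed n X t a -> nolin Y ->
  (forall i, i < n -> wf_ty m (th i) = true) ->
  (forall i b, nth_error X i = Some (Int b) \/ nth_error X i = Some (Lin b) ->
     typed m Y (s i) (subst_ty th b)) ->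
  typed m Y (subst_tm th s t) (subst_ty th a).
Proof.
  intros T NY W H; eapply typed_subst_valued;
    [apply valued_typed|apply T|apply W|apply subst_ok_discard; auto].
Qed.

Lemma subst_tm_typed_id n X t a th s :
  typed n X t a -> (forall i, i < n -> th i = TVar i) ->
  (forall i, i < length X -> s i = Var i) -> subst_tm th s t = t.
Proof.
  assert (HT : forall n a th, wf_ty n a = true ->
            (forall i, i < n -> th i = TVar i) -> subst_ty th a = a).
  { intros k b th' W H; rewrite (subst_ty_agree k th' TVar) by auto.
    now apply subst_ty_id. }
  assert (HL : forall X X1 X2, split X X1 X2 ->
            length X1 = length X /\ length X2 = length X).
  { clear; induction 1; cbn; intuition. }
  assert (HU : forall k s, (forall i, i < k -> s i = Var i) ->
            forall i, i < S k -> up_tm s i = Var i).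
  { intros k s' H [|i] Hi; cbn; auto; rewrite H by lia; auto. }
  intros T; revert th s; induction T; intros th s0 Hth Hs; cbn;
    try (destruct (HL _ _ _ H) as [L1 L2]);
    try (apply Hs, nth_error_Some; first [congruence|destruct H; congruence]);
    f_equal; eauto;
    try (apply IHT1; auto; rewrite L1; auto);
    try (apply IHT2; auto; cbn; rewrite L2; auto).
  - apply IHT; [|rewrite length_map; intros; rewrite Hs by auto; reflexivity].
    intros [|i] Hi; [reflexivity|]; cbn; rewrite Hth by lia; reflexivity.
  - apply HU, HU, Hs.
  - apply HU, Hs.
Qed.

(** Typability in empty contexts serves as the notion of closed term. It lets [pack], [unfold] and
    [out] pass unchanged through substitutions, without their bodies being unfolded. *)
Lemma subst_tm_closed t a th s : typed 0 [] t a -> subst_tm th s t = t.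
Proof. intros T; apply (subst_tm_typed_id _ _ _ _ _ _ T); cbn; lia. Qed.

Lemma typed_closed t a n X :
  typed 0 [] t a -> wf_ty 0 a = true -> nolin X -> typed n X t a.
Proof.
  intros T W N; rewrite <- (subst_ty_closed TVar a) by auto.
  rewrite <- (subst_tm_closed t a TVar Var) by auto.
  eapply typed_subst; eauto; [lia|].
  intros [|i] b [H|H]; discriminate.
Qed.

(** * The functorial action preserves typing *)

Lemma subst_ty_wf1 th s :
  wf_ty 1 s = true -> th 0 = TVar 0 -> subst_ty th s = s.
Proof.
  intros W E; rewrite (subst_ty_agree 1 th TVar); auto using subst_ty_id.
  intros [|i] Hi; [auto|lia].
Qed.

(* [syn] proves equations between substituted expressions: renamings become
   substitutions, compositions are merged, and substitutions are compared
   pointwise.  [syn_hook] is extended with equations for constants. *)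
Ltac syn_hook := idtac.

Ltac syn_norm :=
  repeat progress
    (fold subst_ty; unfold ty_coalg, comp, idtm, shift_tm, shift_rel, shift_prop, inst_ty; cbn;
     rewrite ?ren_ty_subst, ?ren_tm_subst, ?ren_rel_subst, ?subst_subst_ty,
       ?subst_subst_tm, ?subst_subst_rel; syn_hook).

Ltac syn :=
  syn_norm;
  first
  [ reflexivity
  | match goal with
    | W : wf_ty 1 ?s = true |- subst_ty _ ?s = subst_ty _ ?s =>
        apply (subst_ty_agree 1 _ _ _ W);
        intros [|?] ?; [syn|exfalso; lia]
    | W : wf_ty 1 ?s = true |- subst_ty _ ?s = ?s =>
        apply (subst_ty_wf1 _ _ W); syn
    | W : wf_ty 1 ?s = true |- ?s = subst_ty _ ?s =>
        symmetry; apply (subst_ty_wf1 _ _ W); syn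
    | |- subst_ty _ ?s = subst_ty _ ?s => apply subst_ty_ext; syn_pt
    | |- subst_ty _ ?s = ?s => apply subst_ty_id; syn_pt
    | |- ?s = subst_ty _ ?s => symmetry; apply subst_ty_id; syn_pt
    | |- subst_tm _ _ ?s = subst_tm _ _ ?s => apply subst_tm_ext; syn_pt
    | |- subst_tm _ _ ?s = ?s => apply subst_tm_id; syn_pt
    | |- ?s = subst_tm _ _ ?s => symmetry; apply subst_tm_id; syn_pt
    | |- subst_rel _ _ _ ?s = subst_rel _ _ _ ?s =>
        apply subst_rel_ext; syn_pt
    | |- subst_rel _ _ _ ?s = ?s => apply subst_rel_id; syn_pt
    | |- ?s = subst_rel _ _ _ ?s => symmetry; apply subst_rel_id; syn_pt
    | |- ?f = ?g :> (_ -> _) => apply functional_extensionality; syn_pt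
    end
  | progress f_equal; syn ]
with syn_pt := intros [|[|[|?]]]; syn.

Ltac nl :=
  cbn;
  repeat first
    [ assumption | apply nolin_nil | apply nolin_int | apply nolin_gone
    | apply nolin_ints | apply nolin_shift | apply nolin_erase ].

(** The halves of a split are given by the caller, with [Gone] in the place of each variable that
    belongs to the other half; this determines the constructors to be used. *)
Ltac spl := cbn; repeat first [solve [apply split_nolin; nl] | constructor].

Lemma only_lin_here a X : nolin X -> only_lin (Lin a :: X) 0 a.
Proof.
  intros N; split; auto; intros [|j] b H; auto; now destruct (N j b).
Qed.

Lemma only_lin_gone a i X : only_lin X i a -> only_lin (Gone :: X) (S i) a.
Proof.
  intros [H H']; split; auto; intros [|j] b E; [discriminate|]; f_equal; eauto.
Qed.

Lemma only_lin_int a b i X : only_lin X i a -> only_lin (Int b :: X) (S i) a.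
Proof.
  intros [H H']; split; auto; intros [|j] c E; [discriminate|]; f_equal; eauto.
Qed.

Ltac tyv :=
  first
  [ apply ty_var_int; [reflexivity|solve [nl]]
  | apply ty_var_lin;
    repeat first [apply only_lin_gone | apply only_lin_int];
    apply only_lin_here; solve [nl] ].

Lemma typed_weaken D n X t a :
  typed n X t a -> nolin X -> nolin (D ++ X) ->
  typed n (D ++ X) (shift_tm 0 (length D) t) a.
Proof.
  intros T N N'; replace a with (ren_ty (Nat.add 0) a) by syn.
  apply (typed_ren n n _ _ X); auto.
  intros i b E; rewrite nth_error_app2 by lia.
  replace (length D + i - length D) with i by lia.
  rewrite E; f_equal; f_equal; syn.
Qed.

Lemma typed_weaken_ty n X t a :
  typed n X t a -> nolin X ->
  typed (S n) (map shift_decl X) (shift_tm 1 0 t) (ren_ty S a).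
Proof.
  intros T N; apply (typed_ren n (S n) _ _ X); auto using nolin_shift.
  - intros; cbn; lia.
  - intros i b E; cbn; now rewrite nth_error_map, E.
Qed.

Lemma typed_idtm n X a :
  wf_ty n a = true -> nolin X -> typed n X (idtm a) (TLolli a a).
Proof. intros; apply ty_lam; auto; tyv. Qed.

(** * The functorial action: substitution, typing and the identity law *)

Lemma fmap_rec_closed k th th' f s :
  wf_ty 0 s = true -> fmap_rec k th th' f s = idtm s.
Proof. intros W; destruct s; cbn [fmap_rec]; now rewrite W. Qed.

Lemma fmap_rec_subst s : forall k th th' f th0 s0,
  subst_tm th0 s0 (fmap_rec k th th' f s) =
  fmap_rec k (fun i => subst_ty th0 (th i)) (fun i => subst_ty th0 (th' i))
    (subst_tm th0 s0 f) s.
Proof.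
  induction s; intros k th th' f th0 s0;
    match goal with |- _ (fmap_rec _ _ _ _ ?s) = _ =>
      destruct (wf_ty 0 s) eqn:E;
      [ rewrite !fmap_rec_closed by auto; unfold idtm; cbn [subst_tm];
        now rewrite subst_ty_closed
      | cbn [fmap_rec]; rewrite E ] end.
  - destruct (i =? k); syn.
  - syn.
  - rewrite <- (IHs1 k th th' f th0 s0), <- (IHs2 k th th' f th0 s0); syn.
  - rewrite <- (IHs1 k th' th f th0 s0), <- (IHs2 k th th' f th0 s0); syn.
  - rewrite <- (IHs k th th' f th0 s0); syn.
  (* The induction hypothesis is needed at the substitution lifted under the type binder, whereas
     the goal shows the lifted environments; the two forms are reconciled by [syn]. *)
  - replace (fmap_rec (S k) (up_ty (fun i => subst_ty th0 (th i)))
         (up_ty (fun i => subst_ty th0 (th' i)))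
         (shift_tm 1 0 (subst_tm th0 s0 f)) s)
      with (subst_tm (up_ty th0) (fun i => shift_tm 1 0 (s0 i))
             (fmap_rec (S k) (up_ty th) (up_ty th') (shift_tm 1 0 f) s)).
    + syn.
    + rewrite IHs; f_equal; syn.
Qed.

Lemma fmap_rec_agree s : forall N k f th th' th1 th1',
  wf_ty N s = true ->
  (forall i, i < N -> th i = th1 i) -> (forall i, i < N -> th' i = th1' i) ->
  fmap_rec k th th' f s = fmap_rec k th1 th1' f s.
Proof.
  induction s; intros N k f th th' th1 th1' W H H';
    match goal with |- fmap_rec _ _ _ _ ?s = _ =>
      destruct (wf_ty 0 s) eqn:E;
      [ now rewrite !fmap_rec_closed by auto
      | cbn [fmap_rec]; rewrite E;
        rewrite ?(subst_ty_agree N th th1 s), ?(subst_ty_agree N th' th1' s)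
          by auto ] end; cbn [wf_ty] in W; rewrite ?andb_true_iff in W.
  - now rewrite H by (now apply Nat.ltb_lt).
  - reflexivity.
  - now rewrite (IHs1 N k f th th' th1 th1'), (IHs2 N k f th th' th1 th1')
      by intuition.
  - now rewrite (IHs1 N k f th' th th1' th1), (IHs2 N k f th th' th1 th1'),
      (subst_ty_agree N th' th1' s1) by intuition.
  - now rewrite (IHs N k f th th' th1 th1') by intuition.
  - rewrite (IHs (S N) _ _ _ _ (up_ty th1) (up_ty th1')); auto;
      intros [|i] Hi; cbn; auto; rewrite ?H, ?H' by lia; auto.
Qed.

Lemma wf_up_ty n N th :
  (forall i, i < N -> wf_ty n (th i) = true) ->
  forall i, i < S N -> wf_ty (S n) (up_ty th i) = true.
Proof. intros H [|i] Hi; cbn; auto; apply wf_ty_shift, H; lia. Qed.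

(** The boolean [b] is the polarity of the subtype reached so far, and it fixes the direction of [f]
    relative to [th] and [th']. The domain of a [TLolli] exchanges the environments and negates [b]
    while [f] stays the same; at variable k the occurrence condition forces [b = true], so [f] then
    points from [th k] to [th' k]. As [f] has no linear variables, it may be used in both factors of
    a tensor and under [Bang]. *)
Lemma fmap_rec_typed s : forall n N b k th th' f X,
  nolin X -> wf_ty N s = true ->
  (forall i, i < N -> wf_ty n (th i) = true) ->
  (forall i, i < N -> wf_ty n (th' i) = true) ->
  (forall i, i <> k -> th i = th' i) ->
  typed n X f (if b : bool then TLolli (th k) (th' k)
               else TLolli (th' k) (th k)) ->
  occurs_only b k s = true ->
  typed n X (fmap_rec k th th' f s) (TLolli (subst_ty th s) (subst_ty th' s)).
Proof.
  induction s; intros n N b k th th' f X NX W Wt Wt' Ha Tf Ho;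
    match goal with |- typed _ _ (fmap_rec _ _ _ _ ?s) _ =>
      assert (Ws : wf_ty n (subst_ty th s) = true)
        by (now apply (wf_ty_subst N));
      destruct (wf_ty 0 s) eqn:E;
      [ rewrite fmap_rec_closed, !subst_ty_closed by auto;
        apply typed_idtm; eauto using wf_ty_le, Nat.le_0_l
      | cbn [fmap_rec]; rewrite E ] end;
    cbn [wf_ty subst_ty occurs_only] in *; rewrite ?andb_true_iff in *.
  - destruct (Nat.eqb_spec i k) as [->|Hk].
    + now rewrite Ho in Tf.
    + rewrite <- Ha by auto; now apply typed_idtm.
  - discriminate.
  - apply ty_lam; [now apply andb_true_iff|].
    eapply (ty_lettens _ _ (Lin _ :: X) (Gone :: X)); [spl|tyv|].
    eapply (ty_tens _ _ (Gone :: Lin _ :: Gone :: X) (Lin _ :: Gone :: Gone :: X));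
      [spl| |].
    + eapply (ty_app _ _ (Gone :: Gone :: Gone :: X)
                         (Gone :: Lin _ :: Gone :: X)); [spl| |tyv].
      apply (typed_weaken [Gone; Gone; Gone]); [|nl..].
      apply (IHs1 n N b); intuition.
    + eapply (ty_app _ _ (Gone :: Gone :: Gone :: X)
                         (Lin _ :: Gone :: Gone :: X)); [spl| |tyv].
      apply (typed_weaken [Gone; Gone; Gone]); [|nl..].
      apply (IHs2 n N b); intuition.
  - assert (Ws' : wf_ty n (subst_ty th' s1) = true)
      by (apply (wf_ty_subst N); intuition).
    apply ty_lam; [now apply andb_true_iff|].
    apply ty_lam; auto.
    eapply (ty_app _ _ (Gone :: Gone :: X) (Lin _ :: Lin _ :: X)); [spl| |].
    { change (shift_tm 0 1 (shift_tm 0 1 (fmap_rec k th th' f s2)))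
        with (shift_tm 0 1 (shift_tm 0 (length [Gone]) (fmap_rec k th th' f s2))).
      apply (typed_weaken [Gone]); [|nl..].
      apply (typed_weaken [Gone]); [|nl..].
      apply (IHs2 n N b); intuition. }
    cbn; replace (ren_ty _ (subst_ty th' s1)) with (subst_ty th' s1) by syn.
    eapply (ty_app _ _ (Gone :: Lin _ :: X) (Lin _ :: Gone :: X)); [spl| |tyv].
    apply ty_lam; auto.
    eapply (ty_app _ _ (Gone :: Gone :: Lin _ :: X) (Lin _ :: Gone :: Gone :: X));
      [spl|tyv|].
    eapply (ty_app _ _ (Gone :: Gone :: Gone :: X) (Lin _ :: Gone :: Gone :: X));
      [spl| |tyv].
    replace (ren_tm _ _ _) with (shift_tm 0 3 (fmap_rec k th' th f s1)) by syn.
    apply (typed_weaken [Gone; Gone; Gone]); [|nl..].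
    apply (IHs1 n N (negb b)); intuition.
    + symmetry; auto.
    + now destruct b.
  - apply ty_lam; auto.
    eapply (ty_letbang _ _ (Lin _ :: X) (Gone :: X)); [spl|tyv|].
    apply ty_bang; [nl|].
    eapply (ty_app _ _ (Int _ :: Gone :: X) (Int _ :: Gone :: X)); [spl| |tyv].
    apply (typed_weaken [Int _; Gone]); [|nl..].
    apply (IHs n N b); intuition.
  - apply ty_lam; auto.
    apply ty_tlam.
    eapply (ty_app _ _ (Gone :: map shift_decl X)
              (Lin (ren_ty S (TPi (subst_ty (up_ty th) s))) :: map shift_decl X)).
    + cbn; apply split_right, split_nolin; nl.
    + apply (typed_weaken [Gone]); [|nl..].
      apply (IHs (S n) (S N) b);
        [nl|exact W|now apply wf_up_ty|now apply wf_up_ty| | |exact Ho].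
      * intros [|i] Hi; cbn; auto; rewrite Ha; auto.
      * apply typed_weaken_ty in Tf; auto; now destruct b.
    (* Shifting the body past a new type variable and then instantiating it at that variable gives
       the body back. *)
    + replace (subst_ty (up_ty th) s)
        with (inst_ty (TVar 0) (ren_ty (upren S) (subst_ty (up_ty th) s))) at 2
        by syn.
      apply ty_tapp; [reflexivity|]; tyv.
Qed.

Lemma fmap_rec_shift k th th' f s j :
  shift_tm 0 j (fmap_rec k th th' f s) = fmap_rec k th th' (shift_tm 0 j f) s.
Proof.
  unfold shift_tm; rewrite !ren_tm_subst, fmap_rec_subst; f_equal; syn.
Qed.

Lemma exteq_app_id n X X1 X2 g u a :
  split X X1 X2 -> nolin X1 -> wf_ty n a = true ->
  exteq n X1 g (idtm a) (TLolli a a) -> typed n X2 u a -> typed n X u a ->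
  exteq n X (App g u) u a.
Proof.
  intros HS N W Hg Tu Tu'; eapply eq_trans.
  - eapply eq_app; eauto using eq_refl.
  - apply (eq_beta_lam n X a (Var 0) u); cbn; auto.
    eapply ty_app; eauto; now apply typed_idtm.
Qed.

(** By induction the components act as identities, and what remains is the eta expansion of the
    outer constructor. The law is therefore external: the eta rules are enough, and extensionality
    is not involved. *)
Lemma fmap_rec_id s : forall k n N th X,
  nolin X -> wf_ty N s = true ->
  (forall i, i < N -> wf_ty n (th i) = true) ->
  exteq n X (fmap_rec k th th (idtm (th k)) s) (idtm (subst_ty th s))
    (TLolli (subst_ty th s) (subst_ty th s)).
Proof.
  induction s; intros k n N th X NX W Wt;
    match goal with |- exteq _ _ (fmap_rec _ _ _ _ ?s) _ _ =>
      assert (Ws : wf_ty n (subst_ty th s) = true)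
        by (now apply (wf_ty_subst N));
      destruct (wf_ty 0 s) eqn:E;
      [ rewrite fmap_rec_closed, !subst_ty_closed by auto;
        apply eq_refl, typed_idtm; eauto using wf_ty_le, Nat.le_0_l
      | cbn [fmap_rec]; rewrite E ] end;
    cbn [wf_ty subst_ty] in *; rewrite ?andb_true_iff in *;
    rewrite ?fmap_rec_shift;
    (* Shifting term variables renames the annotation of [idtm] by [Nat.add 0], which computes to
       the identity function; the shifted identity must be [idtm (th k)] again for the induction
       hypotheses to apply. *)
    try change (shift_tm 0 1 (idtm (th k)))
      with (idtm (ren_ty (fun m => m) (th k)));
    try change (shift_tm 0 2 (idtm (th k)))
      with (idtm (ren_ty (fun m => m) (th k)));
    try change (shift_tm 0 3 (idtm (th k)))
      with (idtm (ren_ty (fun m => m) (th k)));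
    try replace (ren_ty (fun m => m) (th k)) with (th k) by syn.
  - destruct (Nat.eqb_spec i k) as [->|Hk];
      now apply eq_refl, typed_idtm.
  - discriminate.
  - apply eq_lam; [now apply andb_true_iff|].
    eapply eq_trans.
    + eapply (eq_lettens _ _ (Lin _ :: X) (Gone :: X));
        [spl|apply eq_refl; tyv|].
      eapply (eq_tens _ _ (Gone :: Lin _ :: Gone :: X)
                (Lin _ :: Gone :: Gone :: X)); [spl| |].
      * eapply (exteq_app_id _ _ (Gone :: Gone :: Gone :: X)
                  (Gone :: Lin _ :: Gone :: X));
          [spl|nl|now apply Ws| |tyv|tyv].
        apply (IHs1 _ _ N); [nl|apply W|auto].
      * eapply (exteq_app_id _ _ (Gone :: Gone :: Gone :: X)
                  (Lin _ :: Gone :: Gone :: X));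
          [spl|nl|now apply Ws| |tyv|tyv].
        apply (IHs2 _ _ N); [nl|apply W|auto].
    + apply eq_eta_tens; tyv.
  - destruct Ws as [Ws1 Ws2], W as [W1 W2].
    apply eq_lam; [now apply andb_true_iff|].
    eapply eq_trans; [|apply (eq_eta_lam _ _ (Var 0)); [auto|tyv]].
    apply eq_lam; auto.
    change (shift_tm 0 1 (comp (subst_ty th s1) (Var 0)
              (fmap_rec k th th (idtm (th k)) s1)))
      with (Lam (ren_ty (fun m => m) (subst_ty th s1))
              (App (Var 2) (App (ren_tm (fun m => m) (upren S)
                 (shift_tm 0 1 (fmap_rec k th th (idtm (th k)) s1))) (Var 0)))).
    replace (ren_ty (fun m => m) (subst_ty th s1)) with (subst_ty th s1) by syn.
    replace (ren_tm (fun m => m) (upren S)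
               (shift_tm 0 1 (fmap_rec k th th (idtm (th k)) s1)))
      with (shift_tm 0 2 (fmap_rec k th th (idtm (th k)) s1)) by syn.
    rewrite !fmap_rec_shift.
    change (shift_tm 0 1 (idtm (th k)))
      with (idtm (ren_ty (fun m => m) (th k))).
    change (shift_tm 0 2 (idtm (th k)))
      with (idtm (ren_ty (fun m => m) (th k))).
    replace (ren_ty (fun m => m) (th k)) with (th k) by syn.
    assert (T1 : typed n (Lin (subst_ty th s1)
               :: Lin (TLolli (subst_ty th s1) (subst_ty th s2)) :: X)
               (App (Var 1) (Var 0)) (subst_ty th s2)).
    { eapply (ty_app _ _ (Gone :: Lin _ :: X) (Lin _ :: Gone :: X));
        [spl|tyv|tyv]. }
    eapply eq_trans; [|apply eq_refl, T1].
    (* The inner composition collapses by the identity law for the domain. The law for the codomain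
       then removes the outer one, leaving the eta expansion of the linear variable bound
       outside. *)
    assert (T2 : exteq n (Lin (subst_ty th s1)
               :: Lin (TLolli (subst_ty th s1) (subst_ty th s2)) :: X)
               (App (Lam (subst_ty th s1) (App (Var 2)
                  (App (fmap_rec k th th (idtm (th k)) s1) (Var 0)))) (Var 0))
               (App (Var 1) (Var 0)) (subst_ty th s2)).
    { eapply eq_trans.
      - eapply (eq_app _ _ (Gone :: Lin _ :: X) (Lin _ :: Gone :: X));
          [spl| |apply eq_refl; tyv].
        apply eq_lam; auto.
        eapply (eq_app _ _ (Gone :: Gone :: Lin _ :: X)
                  (Lin _ :: Gone :: Gone :: X)); [spl|apply eq_refl; tyv|].
        eapply (exteq_app_id _ _ (Gone :: Gone :: Gone :: X)
                  (Lin _ :: Gone :: Gone :: X));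
          [spl|nl|auto| |tyv|tyv].
        apply (IHs1 _ _ N); [nl|auto..].
      - apply (eq_beta_lam _ _ _ (App (Var 2) (Var 0)) (Var 0)); [|exact T1].
        eapply (ty_app _ _ (Gone :: Lin _ :: X) (Lin _ :: Gone :: X));
          [spl| |tyv].
        apply ty_lam; auto.
        eapply (ty_app _ _ (Gone :: Gone :: Lin _ :: X)
                  (Lin _ :: Gone :: Gone :: X)); [spl|tyv|tyv]. }
    eapply eq_trans.
    + eapply (eq_app _ _ (Gone :: Gone :: X) (Lin _ :: Lin _ :: X)); [spl| |exact T2].
      apply (IHs2 _ _ N); [nl|auto..].
    + eapply (exteq_app_id _ _ (Gone :: Gone :: X) (Lin _ :: Lin _ :: X));
        [spl|nl|auto|apply eq_refl, typed_idtm; [auto|nl]|exact T1..].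
  - apply eq_lam; auto.
    eapply eq_trans; [|apply eq_eta_bang; tyv].
    eapply (eq_letbang _ _ (Lin _ :: X) (Gone :: X)); [spl|apply eq_refl; tyv|].
    apply eq_bang; [nl|].
    eapply (exteq_app_id _ _ (Int _ :: Gone :: X) (Int _ :: Gone :: X));
      [spl|nl|auto| |tyv|tyv].
    apply (IHs _ _ N); [nl|auto..].
  - apply eq_lam; auto.
    eapply eq_trans; [|apply eq_eta_tlam; tyv].
    apply eq_tlam.
    assert (T : typed (S n) (Lin (ren_ty S (TPi (subst_ty (up_ty th) s)))
                  :: map shift_decl X) (TApp (Var 0) (TVar 0))
                 (subst_ty (up_ty th) s)).
    { replace (subst_ty (up_ty th) s)
        with (inst_ty (TVar 0) (ren_ty (upren S) (subst_ty (up_ty th) s))) at 2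
        by syn.
      apply ty_tapp; [reflexivity|]; tyv. }
    eapply (exteq_app_id _ _ (Gone :: map shift_decl X)
              (Lin (ren_ty S (TPi (subst_ty (up_ty th) s))) :: map shift_decl X));
      [cbn; apply split_right, split_nolin; nl|nl|auto| |exact T|exact T].
    change (shift_tm 0 1 (shift_tm 1 0 (idtm (th k))))
      with (idtm (ren_ty (fun m => m) (ren_ty S (th k)))).
    replace (ren_ty (fun m => m) (ren_ty S (th k))) with (up_ty th (S k)) by syn.
    apply (IHs _ _ (S N)); [nl|auto|now apply wf_up_ty].
Qed.

(** * Computation rules *)

(* [cbn] must not unfold these constants, or the equations of [syn_hook] no
   longer apply. *)
Arguments nu : simpl never.
Arguments pack : simpl never.
Arguments unfold : simpl never.
Arguments out : simpl never.
Arguments out_arg : simpl never.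
Arguments fmap : simpl never.
Arguments inst_ty : simpl never.

(** Typing of both sides is carried along, which avoids a separate proof that [exteq] relates only
    typed terms. *)
Definition eqv (n : nat) (X : list decl) (t u : tm) (s : ty) : Prop :=
  exteq n X t u s /\ typed n X t s /\ typed n X u s.

Lemma eqv_refl n X t s : typed n X t s -> eqv n X t t s.
Proof. split; auto using eq_refl. Qed.

Lemma eqv_sym n X t u s : eqv n X t u s -> eqv n X u t s.
Proof. intros (? & ? & ?); split; auto using eq_sym. Qed.

Lemma eqv_trans n X t u v s : eqv n X t u s -> eqv n X u v s -> eqv n X t v s.
Proof. intros (? & ? & ?) (? & ? & ?); split; eauto using eq_trans. Qed.

Lemma typed_eq n X t s s' : typed n X t s -> s = s' -> typed n X t s'.
Proof. now intros H <-. Qed.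

Lemma typed_app n X t u s s' :
  nolin X -> typed n X t (TLolli s s') -> typed n X u s ->
  typed n X (App t u) s'.
Proof. intros; eapply ty_app; eauto using split_nolin. Qed.

Lemma typed_tapp n X t s s' r :
  typed n X t (TPi s) -> wf_ty n s' = true -> r = inst_ty s' s ->
  typed n X (TApp t s') r.
Proof. intros T W ->; now apply ty_tapp. Qed.

Lemma eqv_app n X t t' u u' s s' :
  nolin X -> eqv n X t t' (TLolli s s') -> eqv n X u u' s ->
  eqv n X (App t u) (App t' u') s'.
Proof.
  intros N (? & ? & ?) (? & ? & ?); split;
    [eapply eq_app|split; eapply typed_app]; eauto using split_nolin.
Qed.

Lemma eqv_tapp n X t t' s s' r :
  eqv n X t t' (TPi s) -> wf_ty n s' = true -> r = inst_ty s' s ->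
  eqv n X (TApp t s') (TApp t' s') r.
Proof.
  intros (? & ? & ?) W ->; split; [|split]; auto using eq_tapp, ty_tapp.
Qed.

Lemma typed_subst1 n X t u a s :
  nolin X -> typed n (Lin a :: X) t s \/ typed n (Int a :: X) t s ->
  typed n X u a -> typed n X (subst_tm TVar (scons u Var) t) s.
Proof.
  intros N T U; rewrite <- (subst_ty_id TVar s) by auto.
  assert (Tn : forall i, i < n -> wf_ty n (TVar i) = true)
    by (intros; now apply Nat.ltb_lt).
  destruct T as [T|T]; (eapply typed_subst; [exact T|auto|auto|]);
    intros [|i] b [E|E]; try discriminate; cbn in *;
    try (now destruct (N i b)); rewrite subst_ty_id by auto;
    try (injection E as <-; exact U); now apply ty_var_int.
Qed.

(** The head need only be equal to an abstraction, and the result is given up to an equation.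
    Computations of [pack], [unfold] and [out] can thus proceed one argument at a time, each
    intermediate head being written in normal form. *)
Lemma eqv_app_beta n X g a t u s v :
  nolin X -> eqv n X g (Lam a t) (TLolli a s) -> typed n X u a ->
  v = subst_tm TVar (scons u Var) t -> eqv n X (App g u) v s.
Proof.
  intros N E U ->; apply eqv_trans with (App (Lam a t) u).
  - eapply eqv_app; eauto using eqv_refl.
  - destruct E as (_ & _ & T); inversion T; subst.
    assert (typed n X (App (Lam a t) u) s) by eauto using typed_app.
    assert (typed n X (subst_tm TVar (scons u Var) t) s)
      by eauto using typed_subst1.
    split; [|split]; auto; now apply eq_beta_lam.
Qed.

Lemma eqv_tapp_beta n X g t s b v r :
  nolin X -> eqv n X g (TLam t) (TPi s) -> wf_ty n b = true ->
  v = subst_tm (scons b TVar) Var t -> r = inst_ty b s ->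
  eqv n X (TApp g b) v r.
Proof.
  intros N E W -> ->; apply eqv_trans with (TApp (TLam t) b).
  - eapply eqv_tapp; eauto using eqv_refl.
  - destruct E as (_ & _ & T); inversion T; subst.
    assert (typed n X (TApp (TLam t) b) (inst_ty b s)) by now apply ty_tapp.
    assert (typed n X (subst_tm (scons b TVar) Var t) (inst_ty b s)).
    { eapply typed_subst; eauto.
      - intros [|i] Hi; cbn; auto; apply Nat.ltb_lt; lia.
      - intros i c [Ei|Ei]; rewrite nth_error_map in Ei;
          destruct (nth_error X i) as [[]|] eqn:Ei'; try discriminate.
        + injection Ei as <-; apply ty_var_int; auto; rewrite Ei'.
          f_equal; f_equal; syn.
        + now destruct (N i s0). }
    split; [|split]; auto; now apply eq_beta_tlam.
Qed.

Lemma eqv_letbang_beta n X t u a s v :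
  nolin X -> typed n X t a -> typed n (Int a :: X) u s ->
  v = subst_tm TVar (scons t Var) u ->
  eqv n X (LetBang (Bang t) u) v s.
Proof.
  intros N T U ->.
  assert (typed n X (LetBang (Bang t) u) s)
    by (eapply ty_letbang; eauto using split_nolin, ty_bang).
  assert (typed n X (subst_tm TVar (scons t Var) u) s)
    by eauto using typed_subst1.
  split; [|split]; auto; now apply eq_beta_bang.
Qed.

Lemma eqv_lettens_beta n X t1 t2 u a1 a2 s v :
  nolin X -> typed n X t1 a1 -> typed n X t2 a2 ->
  typed n (Lin a2 :: Lin a1 :: X) u s ->
  v = subst_tm TVar (scons t2 (scons t1 Var)) u ->
  eqv n X (LetTens (Tens t1 t2) u) v s.
Proof.
  intros N T1 T2 U ->.
  assert (typed n X (LetTens (Tens t1 t2) u) s)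
    by (eapply ty_lettens; eauto using split_nolin, ty_tens).
  assert (typed n X (subst_tm TVar (scons t2 (scons t1 Var)) u) s).
  { rewrite <- (subst_ty_id TVar s) by auto.
    eapply typed_subst; [exact U|auto|intros; now apply Nat.ltb_lt|].
    intros [|[|i]] b [E|E]; try discriminate; cbn in *;
      try (now destruct (N i b)); rewrite subst_ty_id by auto;
      try (injection E as <-; auto); now apply ty_var_int. }
  split; [|split]; auto; now apply eq_beta_tens.
Qed.

(** * Typing of the final coalgebra and its components *)

Lemma fmap_subst sg t t' f th s :
  wf_ty 1 sg = true ->
  subst_tm th s (fmap sg t t' f) =
  fmap sg (subst_ty th t) (subst_ty th t') (subst_tm th s f).
Proof.
  intros W; unfold fmap; rewrite fmap_rec_subst.
  (* In general the substituted environments agree with the expected ones only at variable 0, which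
     is the only variable of [sg]. *)
  apply (fmap_rec_agree _ 1); auto; intros [|i] Hi; auto; lia.
Qed.

Lemma wf_nu sg : wf_ty 1 sg = true -> wf_ty 0 (nu sg) = true.
Proof.
  intros W; unfold nu; cbn; rewrite !andb_true_iff; intuition;
    apply (wf_ty_le 1); auto.
Qed.

Lemma wf_nu_any n sg : wf_ty 1 sg = true -> wf_ty n (nu sg) = true.
Proof. intros W; apply (wf_ty_le 0); [now apply wf_nu|lia]. Qed.

Lemma wf_coalg n sg : wf_ty 1 sg = true -> wf_ty (S n) (ty_coalg sg) = true.
Proof.
  intros W; cbn; rewrite !andb_true_iff; intuition; apply (wf_ty_le 1); auto; lia.
Qed.

Lemma wf_inst n sg t :
  wf_ty 1 sg = true -> wf_ty n t = true -> wf_ty n (inst_ty t sg) = true.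
Proof. intros W W'; apply wf_inst_ty; auto; apply (wf_ty_le 1); auto; lia. Qed.

Lemma subst_nu th sg : wf_ty 1 sg = true -> subst_ty th (nu sg) = nu sg.
Proof. intros W; now apply subst_ty_closed, wf_nu. Qed.

Lemma typed_fmap n X sg t t' f :
  wf_ty 1 sg = true -> occurs_only true 0 sg = true -> nolin X ->
  wf_ty n t = true -> wf_ty n t' = true -> typed n X f (TLolli t t') ->
  typed n X (fmap sg t t' f) (TLolli (inst_ty t sg) (inst_ty t' sg)).
Proof.
  intros W P N Wt Wt' T; apply (fmap_rec_typed sg n 1 true); auto;
    intros [|i] Hi; cbn; auto; lia.
Qed.

Lemma fmap_id n X sg t :
  wf_ty 1 sg = true -> nolin X -> wf_ty n t = true ->
  exteq n X (fmap sg t t (idtm t)) (idtm (inst_ty t sg))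
    (TLolli (inst_ty t sg) (inst_ty t sg)).
Proof.
  intros W N Wt; apply (fmap_rec_id sg 0 n 1 (scons t TVar)); auto.
  intros [|i] Hi; cbn; auto; lia.
Qed.

Ltac syn_hook ::=
  match goal with
  | W : wf_ty 1 ?sg = true |- _ =>
      rewrite ?(fun t t' f th s => fmap_subst sg t t' f th s W),
        ?(fun th => subst_nu th sg W)
  | _ => idtac
  end.

Ltac wf :=
  cbn; rewrite ?andb_true_iff; repeat split;
  first [ assumption | reflexivity | now apply wf_nu_any | apply wf_inst; wf
        | eapply wf_ty_le; [eassumption|lia]
        | apply wf_ty_shift; wf ].

Lemma typed_pack sg :
  wf_ty 1 sg = true ->
  typed 0 [] (pack sg) (TPi (TLolli (ty_coalg sg) (nu sg))).
Proof.
  intros W; apply ty_tlam, ty_lam; [now apply wf_coalg|].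
  apply ty_tlam, ty_lam.
  { wf. }
  eapply (ty_app _ _ [Lin _; Gone] [Gone; Lin _]); [spl| |tyv].
  eapply typed_tapp; [tyv|reflexivity|].
  syn.
Qed.

Lemma typed_unfold sg :
  wf_ty 1 sg = true ->
  typed 0 [] (unfold sg)
    (TPi (TLolli (TBang (TLolli (TVar 0) sg)) (TLolli (TVar 0) (nu sg)))).
Proof.
  intros W; apply ty_tlam, ty_lam; [wf|].
  apply ty_lam; [reflexivity|].
  eapply (ty_app _ _ [Gone; Gone] [Lin _; Lin _]); [spl| |].
  - eapply typed_tapp; [|reflexivity|].
    + apply typed_closed; [now apply typed_pack|wf|nl].
    + syn_norm; reflexivity.
  - replace (subst_ty (scons (TVar 0) TVar) sg) with sg by syn.
    eapply (ty_tens _ _ [Gone; Lin _] [Lin _; Gone]); [spl|tyv|tyv].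
Qed.

Lemma typed_out_arg sg :
  wf_ty 1 sg = true -> occurs_only true 0 sg = true ->
  typed 0 [] (out_arg sg) (TPi (TLolli (ty_coalg sg) (inst_ty (nu sg) sg))).
Proof.
  intros W P; apply ty_tlam, ty_lam; [wf|].
  eapply (ty_lettens _ _ [Lin _] [Gone]); [spl|tyv|].
  eapply (ty_letbang _ _ [Gone; Lin _; Gone] [Lin _; Gone; Gone]); [spl|tyv|].
  eapply (ty_app _ _ [Int _; Gone; Gone; Gone] [Int _; Lin _; Gone; Gone]);
    [spl| |].
  - apply typed_fmap; [auto|auto|nl|reflexivity|wf|].
    eapply typed_app; [nl| |apply ty_bang; [nl|tyv]].
    eapply typed_tapp; [|reflexivity|].
    + apply typed_closed; [now apply typed_unfold|wf|nl].
    + syn.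
  - replace (inst_ty (TVar 0) sg) with sg by syn.
    eapply (ty_letbang _ _ [Int _; Gone; Gone; Gone] [Int _; Lin _; Gone; Gone]);
      [spl|apply ty_bang; [nl|tyv]|].
    eapply (ty_app _ _ [Int _; Int _; Gone; Gone; Gone]
              [Int _; Int _; Lin _; Gone; Gone]); [spl|tyv|tyv].
Qed.

Lemma typed_out sg :
  wf_ty 1 sg = true -> occurs_only true 0 sg = true ->
  typed 0 [] (out sg) (TLolli (nu sg) (inst_ty (nu sg) sg)).
Proof.
  intros W P; apply ty_lam; [wf|].
  eapply (ty_app _ _ [Lin _] [Gone]); [spl| |].
  - eapply typed_tapp; [tyv|wf|reflexivity].
  - eapply typed_eq; [apply typed_closed; [now apply typed_out_arg|wf|nl]|syn].
Qed.

(** As a closed term, the action of [sg] on morphisms is subject to identity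
    extension. *)
Definition fmap_poly (sg : ty) : tm :=
  TLam (TLam (Lam (TBang (TLolli (TVar 1) (TVar 0)))
    (LetBang (Var 0) (fmap sg (TVar 1) (TVar 0) (Var 0))))).

(** Both copies of [sg], at the source variable 1 and at the target variable 0, are written as
    renamings, the second one by the identity function; [rint_ren_ty] then computes the
    interpretation of either copy. *)
Definition ty_fmap_poly (sg : ty) : ty :=
  TPi (TPi (TLolli (TBang (TLolli (TVar 1) (TVar 0)))
              (TLolli (ren_ty (fun i => S i) sg) (ren_ty (fun i => i) sg)))).

Arguments fmap_poly : simpl never.

Lemma wf_ty_fmap_poly sg :
  wf_ty 1 sg = true -> wf_ty 0 (ty_fmap_poly sg) = true.
Proof.
  intros W; cbn; rewrite !andb_true_iff; repeat split;
    apply (wf_ty_ren 1); auto; lia.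
Qed.

Lemma typed_fmap_poly sg :
  wf_ty 1 sg = true -> occurs_only true 0 sg = true ->
  typed 0 [] (fmap_poly sg) (ty_fmap_poly sg).
Proof.
  intros W P; apply ty_tlam, ty_tlam, ty_lam; [reflexivity|].
  eapply (ty_letbang _ _ [Lin _] [Gone]); [spl|tyv|].
  replace (ren_ty (fun i => S i) sg) with (inst_ty (TVar 1) sg) by syn.
  replace (ren_ty (fun i => i) sg) with (inst_ty (TVar 0) sg) by syn.
  apply typed_fmap; [auto|auto|nl|reflexivity|reflexivity|tyv].
Qed.

Ltac syn_hook ::=
  match goal with
  | W : wf_ty 1 ?sg = true |- _ =>
      rewrite ?(fun t t' f th s => fmap_subst sg t t' f th s W),
        ?(fun th => subst_nu th sg W),
        ?(fun th s => subst_tm_closed _ _ th s (typed_pack sg W)),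
        ?(fun th s => subst_tm_closed _ _ th s (typed_unfold sg W));
      match goal with
      | P : occurs_only true 0 sg = true |- _ =>
          rewrite
            ?(fun th s => subst_tm_closed _ _ th s (typed_out sg W P)),
            ?(fun th s => subst_tm_closed _ _ th s (typed_out_arg sg W P)),
            ?(fun th s => subst_tm_closed _ _ th s (typed_fmap_poly sg W P))
      | _ => idtac
      end
  | _ => idtac
  end.

(** * Beta equations for packing, unfolding and observing *)

Lemma typed_pack_at n X sg t :
  wf_ty 1 sg = true -> wf_ty n t = true -> nolin X ->
  typed n X (TApp (pack sg) t) (TLolli (inst_ty t (ty_coalg sg)) (nu sg)).
Proof.
  intros W Wt N; eapply typed_tapp; [|auto|].
  - apply typed_closed; [now apply typed_pack|wf|auto].
  - syn.
Qed.

Lemma typed_unfold_at n X sg t w :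
  wf_ty 1 sg = true -> wf_ty n t = true -> nolin X ->
  typed n X w (TBang (TLolli t (inst_ty t sg))) ->
  typed n X (App (TApp (unfold sg) t) w) (TLolli t (nu sg)).
Proof.
  intros W Wt N Tw; eapply typed_app; [auto| |exact Tw].
  eapply typed_tapp; [|auto|].
  - apply typed_closed; [now apply typed_unfold|wf|auto].
  - syn.
Qed.

(** [nu] is the impredicative encoding of an existential type, and this is its computation rule:
    opening a package hands its type and its content to the client [k]. *)
Lemma pack_beta n X sg t y b k :
  wf_ty 1 sg = true -> wf_ty n t = true -> wf_ty n b = true -> nolin X ->
  typed n X y (inst_ty t (ty_coalg sg)) ->
  typed n X k (TPi (TLolli (ty_coalg sg) (ren_ty S b))) ->
  eqv n X (App (TApp (App (TApp (pack sg) t) y) b) k) (App (TApp k t) y) b.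
Proof.
  intros W Wt Wb N Ty Tk.
  pose (K := TPi (TLolli (ty_coalg sg) (TVar 1))).
  assert (E1 : eqv n X (TApp (pack sg) t)
    (Lam (inst_ty t (ty_coalg sg))
       (TLam (Lam K (App (TApp (Var 0) (ren_ty S t)) (Var 1)))))
    (TLolli (inst_ty t (ty_coalg sg)) (nu sg))).
  { eapply eqv_tapp_beta; [auto|apply eqv_refl, typed_closed;
      [now apply typed_pack|wf|auto]|auto| |]; unfold K; syn. }
  assert (E2 : eqv n X (App (TApp (pack sg) t) y)
    (TLam (Lam K (App (TApp (Var 0) (ren_ty S t)) (shift_tm 1 1 y)))) (nu sg)).
  { eapply eqv_app_beta; [auto|exact E1|auto|]; unfold K; syn. }
  assert (E3 : eqv n X (TApp (App (TApp (pack sg) t) y) b)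
    (Lam (TPi (TLolli (ty_coalg sg) (ren_ty S b)))
       (App (TApp (Var 0) t) (shift_tm 0 1 y)))
    (TLolli (TPi (TLolli (ty_coalg sg) (ren_ty S b))) b)).
  { eapply eqv_tapp_beta; [auto|exact E2|auto| |]; unfold K; syn. }
  eapply eqv_app_beta; [auto|exact E3|auto|]; syn.
Qed.

Lemma unfold_beta n X sg t w x :
  wf_ty 1 sg = true -> wf_ty n t = true -> nolin X ->
  typed n X w (TBang (TLolli t (inst_ty t sg))) -> typed n X x t ->
  eqv n X (App (App (TApp (unfold sg) t) w) x)
    (App (TApp (pack sg) t) (Tens w x)) (nu sg).
Proof.
  intros W Wt N Tw Tx.
  assert (E1 : eqv n X (TApp (unfold sg) t)
    (Lam (TBang (TLolli t (inst_ty t sg)))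
       (Lam t (App (TApp (pack sg) t) (Tens (Var 1) (Var 0)))))
    (TLolli (TBang (TLolli t (inst_ty t sg))) (TLolli t (nu sg)))).
  { eapply eqv_tapp_beta; [auto|apply eqv_refl, typed_closed;
      [now apply typed_unfold|wf|auto]|auto| |]; syn. }
  assert (E2 : eqv n X (App (TApp (unfold sg) t) w)
    (Lam t (App (TApp (pack sg) t) (Tens (shift_tm 0 1 w) (Var 0))))
    (TLolli t (nu sg))).
  { eapply eqv_app_beta; [auto|exact E1|auto|]; syn. }
  eapply eqv_app_beta; [auto|exact E2|auto|]; syn.
Qed.

(** On a content of the form [Tens (Bang f) x] every let-construct in [out_arg] meets an
    introduction form, so the computation is external. Arbitrary contents are reached only inside
    the logic, by the induction principles for tensor and [!]. *)
Lemma out_beta n X sg t f x :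
  wf_ty 1 sg = true -> occurs_only true 0 sg = true ->
  wf_ty n t = true -> nolin X ->
  typed n X f (TLolli t (inst_ty t sg)) -> typed n X x t ->
  eqv n X (App (out sg) (App (TApp (pack sg) t) (Tens (Bang f) x)))
    (App (fmap sg t (nu sg) (App (TApp (unfold sg) t) (Bang f))) (App f x))
    (inst_ty (nu sg) sg).
Proof.
  intros W P Wt N Tf Tx.
  assert (Wo : wf_ty n (inst_ty (nu sg) sg) = true) by wf.
  assert (Ty : typed n X (Tens (Bang f) x) (inst_ty t (ty_coalg sg))).
  { eapply ty_tens; [now apply split_nolin| |exact Tx].
    apply ty_bang; auto. }
  assert (Ta : typed n X (out_arg sg)
             (TPi (TLolli (ty_coalg sg) (ren_ty S (inst_ty (nu sg) sg))))).
  { replace (ren_ty S (inst_ty (nu sg) sg)) with (inst_ty (nu sg) sg) by syn.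
    apply typed_closed; [now apply typed_out_arg|wf|auto]. }
  assert (Tp : typed n X (App (TApp (pack sg) t) (Tens (Bang f) x)) (nu sg))
    by eauto using typed_app, typed_pack_at.
  apply eqv_trans with (App (TApp (App (TApp (pack sg) t) (Tens (Bang f) x))
                              (inst_ty (nu sg) sg)) (out_arg sg)).
  { eapply eqv_app_beta; [auto|apply eqv_refl, typed_closed;
      [now apply typed_out|wf|auto]|exact Tp|syn]. }
  eapply eqv_trans; [now apply pack_beta|].
  pose (body := App (fmap sg t (nu sg) (App (TApp (unfold sg) t) (Bang (Var 0))))
             (LetBang (Bang (Var 0)) (App (Var 0) (Var 2)))).
  assert (E1 : eqv n X (TApp (out_arg sg) t)
     (Lam (inst_ty t (ty_coalg sg)) (LetTens (Var 0) (LetBang (Var 1) body)))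
     (TLolli (inst_ty t (ty_coalg sg)) (inst_ty (nu sg) sg))).
  { eapply eqv_tapp_beta; [auto|apply eqv_refl, typed_closed;
      [now apply typed_out_arg|wf|auto]|auto| |]; unfold body; syn. }
  assert (Tu : forall D j, nolin (D ++ X) ->
     nth_error (D ++ X) j = Some (Int (TLolli t (inst_ty t sg))) ->
     typed n (D ++ X)
       (fmap sg t (nu sg) (App (TApp (unfold sg) t) (Bang (Var j))))
       (TLolli (inst_ty t sg) (inst_ty (nu sg) sg))).
  { intros D j ND Ej; apply typed_fmap; [auto|auto|auto|auto|wf|].
    apply typed_unfold_at; [auto..|apply ty_bang; [auto|now apply ty_var_int]]. }
  eapply eqv_trans.
  { eapply (eqv_app_beta _ _ _ _ _ _ _
      (LetTens (Tens (Bang f) x) (LetBang (Var 1) body)));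
      [auto|exact E1|exact Ty|]; unfold body; syn. }
  eapply eqv_trans.
  { eapply (eqv_lettens_beta _ _ _ _ _ _ _ _
      (LetBang (Bang f) (App
         (fmap sg t (nu sg) (App (TApp (unfold sg) t) (Bang (Var 0))))
         (LetBang (Bang (Var 0)) (App (Var 0) (shift_tm 0 2 x))))));
      [auto|apply ty_bang; [auto|exact Tf]|exact Tx| |unfold body; syn].
    eapply (ty_letbang _ _ (Gone :: Lin _ :: X) (Lin _ :: Gone :: X));
      [spl|tyv|].
    eapply (ty_app _ _ (Int _ :: Gone :: Gone :: X) (Int _ :: Lin _ :: Gone :: X));
      [spl| |].
    - apply (Tu [Int _; Gone; Gone]); [nl|reflexivity].
    - eapply (ty_letbang _ _ (Int _ :: Gone :: Gone :: X)
                (Int _ :: Lin _ :: Gone :: X)); [spl|apply ty_bang; [nl|tyv]|].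
      eapply (ty_app _ _ (Int _ :: Int _ :: Gone :: Gone :: X)
                (Int _ :: Int _ :: Lin _ :: Gone :: X)); [spl|tyv|tyv]. }
  eapply eqv_trans.
  { eapply (eqv_letbang_beta _ _ _ _ _ _ (App
      (fmap sg t (nu sg) (App (TApp (unfold sg) t) (Bang f)))
      (LetBang (Bang f) (App (Var 0) (shift_tm 0 1 x)))));
      [auto|exact Tf| |syn].
    eapply typed_app; [nl|apply (Tu [Int _]); [nl|reflexivity]|].
    eapply (ty_letbang _ _ (Int _ :: X) (Int _ :: X));
      [spl|apply ty_bang; [nl|tyv]|].
    eapply typed_app; [nl|tyv|].
    apply (typed_weaken [Int _; Int _]); [auto|auto|nl]. }
  eapply eqv_app; [auto|apply eqv_refl, typed_fmap; [auto..|wf|]|].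
  - apply typed_unfold_at; auto; now apply ty_bang.
  - eapply (eqv_letbang_beta _ _ _ _ (TLolli t (inst_ty t sg)));
      [auto|exact Tf| |syn].
    eapply typed_app; [nl|tyv|].
    apply (typed_weaken [Int _]); [auto|auto|nl].
Qed.

Lemma fmap_poly_beta n X sg t t' f :
  wf_ty 1 sg = true -> occurs_only true 0 sg = true ->
  wf_ty n t = true -> wf_ty n t' = true -> nolin X ->
  typed n X f (TLolli t t') ->
  eqv n X (App (TApp (TApp (fmap_poly sg) t) t') (Bang f)) (fmap sg t t' f)
    (TLolli (inst_ty t sg) (inst_ty t' sg)).
Proof.
  intros W P Wt Wt' N Tf.
  assert (E1 : eqv n X (TApp (fmap_poly sg) t)
    (TLam (Lam (TBang (TLolli (ren_ty S t) (TVar 0)))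
       (LetBang (Var 0) (fmap sg (ren_ty S t) (TVar 0) (Var 0)))))
    (TPi (TLolli (TBang (TLolli (ren_ty S t) (TVar 0)))
      (TLolli (inst_ty (ren_ty S t) sg) (inst_ty (TVar 0) sg))))).
  { eapply eqv_tapp_beta; [auto|apply eqv_refl, typed_closed;
      [now apply typed_fmap_poly|now apply wf_ty_fmap_poly|auto]|auto|syn|syn]. }
  assert (E2 : eqv n X (TApp (TApp (fmap_poly sg) t) t')
    (Lam (TBang (TLolli t t')) (LetBang (Var 0) (fmap sg t t' (Var 0))))
    (TLolli (TBang (TLolli t t')) (TLolli (inst_ty t sg) (inst_ty t' sg)))).
  { eapply eqv_tapp_beta; [auto|exact E1|auto|syn|syn]. }
  eapply eqv_trans.
  { eapply (eqv_app_beta _ _ _ _ _ _ _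
      (LetBang (Bang f) (fmap sg t t' (Var 0))));
      [auto|exact E2|now apply ty_bang|syn]. }
  eapply eqv_letbang_beta; [auto|exact Tf| |syn].
  apply typed_fmap; [auto|auto|nl|auto|auto|tyv].
Qed.

(** * Relational interpretation of types *)

Scheme wf_prop_rel_ind := Induction for wf_prop Sort Prop
with wf_rel_prop_ind := Induction for wf_rel Sort Prop.
Combined Scheme wf_prop_rel_mutind from wf_prop_rel_ind, wf_rel_prop_ind.

Definition ren_ctx (m : nat) (xi zeta chi : nat -> nat) (n : nat)
    (G G' : list ty) (Th Th' : list rdecl) : Prop :=
  (forall i, i < n -> xi i < m) /\
  (forall i a, nth_error G i = Some a ->
     nth_error G' (zeta i) = Some (ren_ty xi a)) /\
  (forall i k s t, nth_error Th i = Some (k, s, t) ->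
     nth_error Th' (chi i) = Some (k, ren_ty xi s, ren_ty xi t)).

Lemma ren_ctx_ty m xi zeta chi n G G' Th Th' :
  ren_ctx m xi zeta chi n G G' Th Th' ->
  ren_ctx (S m) (upren xi) zeta chi (S n) (map (ren_ty S) G)
    (map (ren_ty S) G') (map shift_rdecl Th) (map shift_rdecl Th').
Proof.
  intros (H1 & H2 & H3); split; [|split].
  - intros [|i] Hi; cbn; [lia|]; specialize (H1 i); lia.
  - intros i a E; rewrite nth_error_map in *.
    destruct (nth_error G i) eqn:E'; try discriminate; injection E as <-.
    rewrite (H2 _ _ E'); cbn; f_equal; rewrite !ren_ren_ty; reflexivity.
  - intros i k s t E; rewrite nth_error_map in *.
    destruct (nth_error Th i) as [[[k' s'] t']|] eqn:E'; try discriminate.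
    injection E as <- <- <-; rewrite (H3 _ _ _ _ E'); cbn; f_equal;
      rewrite !ren_ren_ty; reflexivity.
Qed.

Lemma ren_ctx_tm m xi zeta chi n G G' Th Th' a :
  ren_ctx m xi zeta chi n G G' Th Th' ->
  ren_ctx m xi (upren zeta) chi n (a :: G) (ren_ty xi a :: G') Th Th'.
Proof.
  intros (H1 & H2 & H3); split; [|split]; auto.
  intros [|i] b E; cbn in *; [now injection E as ->|auto].
Qed.

Lemma ren_ctx_rel m xi zeta chi n G G' Th Th' k s t :
  ren_ctx m xi zeta chi n G G' Th Th' ->
  ren_ctx m xi zeta (upren chi) n G G' ((k, s, t) :: Th)
    ((k, ren_ty xi s, ren_ty xi t) :: Th').
Proof.
  intros (H1 & H2 & H3); split; [|split]; auto.
  intros [|i] k' s' t' E; cbn in *; [now injection E as -> -> ->|auto].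
Qed.

Lemma typed_ren_ctx m xi zeta chi n G G' Th Th' t a :
  typed n (ints G) t a -> ren_ctx m xi zeta chi n G G' Th Th' ->
  typed m (ints G') (ren_tm xi zeta t) (ren_ty xi a).
Proof.
  intros T (H1 & H2 & H3); eapply typed_ren; eauto using nolin_ints.
  intros i b E; unfold ints in *; rewrite nth_error_map in *.
  destruct (nth_error G i) eqn:E'; try discriminate; injection E as ->.
  now rewrite (H2 _ _ E').
Qed.

Lemma wf_ren :
  (forall n G Th p, wf_prop n G Th p ->
     forall m xi zeta chi G' Th', ren_ctx m xi zeta chi n G G' Th Th' ->
     wf_prop m G' Th' (ren_prop xi zeta chi p)) /\
  (forall n G Th r s t, wf_rel n G Th r s t ->
     forall m xi zeta chi G' Th', ren_ctx m xi zeta chi n G G' Th Th' ->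
     wf_rel m G' Th' (ren_rel xi zeta chi r) (ren_ty xi s) (ren_ty xi t)).
Proof.
  apply wf_prop_rel_mutind; intros; cbn;
    match goal with C : ren_ctx _ _ _ _ _ _ _ _ _ |- _ =>
      pose proof (proj1 C) as Hxi; pose proof (proj2 (proj2 C)) as Hchi end;
    econstructor; eauto using typed_ren_ctx, ren_ctx_ty, ren_ctx_tm,
      ren_ctx_rel, wf_ty_ren.
Qed.

Lemma ren_ctx_shift n D E G Th :
  ren_ctx n (Nat.add 0) (Nat.add (length D)) (Nat.add (length E)) n
    G (D ++ G) Th (E ++ Th).
Proof.
  split; [|split]; auto.
  - intros i a H; rewrite nth_error_app2 by lia.
    replace (_ - _) with i by lia; rewrite H; f_equal; syn.
  - intros i k s t H; rewrite nth_error_app2 by lia.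
    replace (_ - _) with i by lia; rewrite H; repeat f_equal; syn.
Qed.

Lemma ren_ctx_shift_ty n G Th :
  ren_ctx (S n) (Nat.add 1) (Nat.add 0) (Nat.add 0) n
    G (map (ren_ty S) G) Th (map shift_rdecl Th).
Proof.
  split; [|split].
  - intros; cbn; lia.
  - intros i a H; cbn; now rewrite nth_error_map, H.
  - intros i k s t H; cbn; now rewrite nth_error_map, H.
Qed.

Lemma wf_rel_shift n D E G Th r s t :
  wf_rel n G Th r s t ->
  wf_rel n (D ++ G) (E ++ Th) (shift_rel 0 (length D) (length E) r) s t.
Proof.
  intros H; replace s with (ren_ty (Nat.add 0) s) by syn.
  replace t with (ren_ty (Nat.add 0) t) by syn.
  eapply wf_ren; eauto using ren_ctx_shift.
Qed.

Lemma wf_rel_shift_ty n G Th r s t :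
  wf_rel n G Th r s t ->
  wf_rel (S n) (map (ren_ty S) G) (map shift_rdecl Th) (shift_rel 1 0 0 r)
    (ren_ty S s) (ren_ty S t).
Proof.
  intros H; eapply wf_ren in H; [exact H|apply ren_ctx_shift_ty].
Qed.

(** * Environments of relations and the laws of [rint] *)

Definition env_ok (N n : nat) (G : list ty) (Th : list rdecl)
    (th th' : nat -> ty) (e : nat -> rel) : Prop :=
  forall i, i < N -> wf_ty n (th i) = true /\ wf_ty n (th' i) = true /\
    wf_rel n G Th (e i) (th i) (th' i).

Lemma env_ok_wf N n G Th th th' e s :
  env_ok N n G Th th th' e -> wf_ty N s = true ->
  wf_ty n (subst_ty th s) = true /\ wf_ty n (subst_ty th' s) = true.
Proof.
  intros H W; split; apply (wf_ty_subst N); auto; intros i Hi; now apply H.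
Qed.

Lemma env_ok_shift N n D E G Th th th' e :
  env_ok N n G Th th th' e ->
  env_ok N n (D ++ G) (E ++ Th) th th'
    (fun i => shift_rel 0 (length D) (length E) (e i)).
Proof.
  intros H i Hi; destruct (H i Hi) as (? & ? & ?); auto using wf_rel_shift.
Qed.

Lemma env_ok_up N n G Th th th' e :
  env_ok N n G Th th th' e ->
  env_ok (S N) (S (S n)) (map (ren_ty S) (map (ren_ty S) G))
    ((KAdm, TVar 1, TVar 0) :: map shift_rdecl (map shift_rdecl Th))
    (scons (TVar 1) (fun i => ren_ty (Nat.add 2) (th i)))
    (scons (TVar 0) (fun i => ren_ty (Nat.add 2) (th' i)))
    (scons (RVar 0) (fun i => shift_rel 2 0 1 (e i))).
Proof.
  intros H [|i] Hi; cbn.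
  - repeat split; auto; now apply (wf_rvar _ _ _ _ KAdm).
  - destruct (H i) as (? & ? & Hr); [lia|].
    repeat split; try (apply (wf_ty_ren n); auto; lia).
    (* The shift by two type variables and one relation variable is composed of two single type
       shifts and one relation shift, and the composite renaming is then merged. *)
    do 2 apply wf_rel_shift_ty in Hr.
    apply (wf_rel_shift _ [] [(KAdm, TVar 1, TVar 0)]) in Hr.
    cbn in Hr; unfold shift_rel in *; rewrite !ren_ren_rel, !ren_ren_ty in Hr.
    exact Hr.
Qed.

Lemma wf_rint s : forall N n G Th th th' e,
  env_ok N n G Th th th' e -> wf_ty N s = true ->
  wf_rel n G Th (rint th th' e s) (subst_ty th s) (subst_ty th' s).
Proof.
  induction s; intros N n G Th th th' e H W;
    pose proof (env_ok_wf _ _ _ _ _ _ _ _ H W) as [W1 W2];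
    cbn [wf_ty rint subst_ty] in *; rewrite ?andb_true_iff in W.
  - now apply H, Nat.ltb_lt.
  - apply wf_rabs; auto.
    apply wf_allrel; auto; apply wf_imp.
    + eapply wf_app; [now apply (wf_rvar _ _ _ _ KAdm)|apply ty_star; nl..].
    + eapply wf_app; [now apply (wf_rvar _ _ _ _ KAdm)|tyv|tyv].
  - assert (W1' := W1); assert (W2' := W2).
    cbn in W1', W2'; rewrite andb_true_iff in W1', W2'.
    apply wf_rabs; auto; apply wf_allrel; auto; apply wf_imp.
    + do 4 (apply wf_all; [now intuition|]); apply wf_imp; [|apply wf_imp].
      * eapply wf_app; [|tyv|tyv].
        apply (wf_rel_shift _ [_;_;_;_;_;_] [_]); now apply (IHs1 N).
      * eapply wf_app; [|tyv|tyv].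
        apply (wf_rel_shift _ [_;_;_;_;_;_] [_]); now apply (IHs2 N).
      * eapply wf_app; [now apply (wf_rvar _ _ _ _ KAdm)| |];
          (eapply ty_tens; [apply split_nolin; nl|tyv|tyv]).
    + eapply wf_app; [now apply (wf_rvar _ _ _ _ KAdm)|tyv|tyv].
  - assert (W1' := W1); assert (W2' := W2).
    cbn in W1', W2'; rewrite andb_true_iff in W1', W2'.
    apply wf_rabs; auto.
    do 2 (apply wf_all; [now intuition|]); apply wf_imp.
    + eapply wf_app; [|tyv|tyv].
      apply (wf_rel_shift _ [_;_;_;_] []); now apply (IHs1 N).
    + eapply wf_app; [apply (wf_rel_shift _ [_;_;_;_] []); now apply (IHs2 N)| |];
        (eapply typed_app; [nl|tyv|tyv]).
  - apply wf_rabs; auto; apply wf_allrel; auto; apply wf_imp.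
    + do 2 (apply wf_all; [now intuition|]); apply wf_imp.
      * eapply wf_app; [|tyv|tyv].
        apply (wf_rel_shift _ [_;_;_;_] [_]); now apply (IHs N).
      * eapply wf_app; [now apply (wf_rvar _ _ _ _ KAdm)| |];
          (apply ty_bang; [nl|tyv]).
    + eapply wf_app; [now apply (wf_rvar _ _ _ _ KAdm)|tyv|tyv].
  - apply wf_rabs; auto; do 2 apply wf_allty; apply wf_allrel; auto.
    eapply wf_app.
    + apply (wf_rel_shift _ [_;_] []).
      apply (IHs (S N)); [now apply env_ok_up|auto].
    + eapply typed_tapp; [tyv|reflexivity|]; syn.
    + eapply typed_tapp; [tyv|reflexivity|]; syn.
Qed.

(** Outside of its environments the interpretation of a type contains no free variables, so a
    substitution acts on the environments alone. *)
Lemma rint_subst s : forall th th' e th0 s0 e0,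
  subst_rel th0 s0 e0 (rint th th' e s) =
  rint (fun i => subst_ty th0 (th i)) (fun i => subst_ty th0 (th' i))
    (fun i => subst_rel th0 s0 e0 (e i)) s.
Proof.
  induction s; intros th th' e th0 s0 e0; cbn [rint].
  - reflexivity.
  - reflexivity.
  - rewrite <- (IHs1 th th' e th0 s0 e0), <- (IHs2 th th' e th0 s0 e0).
    unfold rtensor; syn.
  - rewrite <- (IHs1 th th' e th0 s0 e0), <- (IHs2 th th' e th0 s0 e0).
    unfold rlolli; syn.
  - rewrite <- (IHs th th' e th0 s0 e0); unfold rbang; syn.
  - match goal with |- _ = rpi _ _ (rint ?a ?b ?c s) =>
      replace (rint a b c s) with
       (subst_rel (up_ty (up_ty th0))
          (fun i => shift_tm 2 0 (s0 i))
          (up_rel (fun i => shift_rel 2 0 0 (e0 i)))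
          (rint (scons (TVar 1) (fun i => ren_ty (Nat.add 2) (th i)))
              (scons (TVar 0) (fun i => ren_ty (Nat.add 2) (th' i)))
              (scons (RVar 0) (fun i => shift_rel 2 0 1 (e i))) s)) end.
    + unfold rpi; syn.
    + rewrite IHs; f_equal; syn.
Qed.

Lemma rint_agree s : forall N th th' e th1 th1' e1,
  wf_ty N s = true -> (forall i, i < N -> th i = th1 i) ->
  (forall i, i < N -> th' i = th1' i) -> (forall i, i < N -> e i = e1 i) ->
  rint th th' e s = rint th1 th1' e1 s.
Proof.
  induction s; intros N th th' e th1 th1' e1 W H H' He; cbn [wf_ty rint] in *;
    rewrite ?andb_true_iff in W; auto.
  - now apply He, Nat.ltb_lt.
  - rewrite (IHs1 N th th' e th1 th1' e1), (IHs2 N th th' e th1 th1' e1),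
      (subst_ty_agree N th th1 s1), (subst_ty_agree N th' th1' s1),
      (subst_ty_agree N th th1 s2), (subst_ty_agree N th' th1' s2)
      by intuition; auto.
  - rewrite (IHs1 N th th' e th1 th1' e1), (IHs2 N th th' e th1 th1' e1),
      (subst_ty_agree N th th1 s1), (subst_ty_agree N th' th1' s1),
      (subst_ty_agree N th th1 s2), (subst_ty_agree N th' th1' s2)
      by intuition; auto.
  - rewrite (IHs N th th' e th1 th1' e1),
      (subst_ty_agree N th th1 s), (subst_ty_agree N th' th1' s)
      by intuition; auto.
  - rewrite (subst_ty_agree (S N) (up_ty th) (up_ty th1)),
      (subst_ty_agree (S N) (up_ty th') (up_ty th1')); auto.
    + f_equal; apply (IHs (S N)); auto; intros [|i] Hi; cbn; auto;
        rewrite ?H, ?H', ?He by lia; auto.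
    + intros [|i] Hi; cbn; auto; rewrite H' by lia; auto.
    + intros [|i] Hi; cbn; auto; rewrite H by lia; auto.
Qed.

Lemma rint_ren_ty s : forall th th' e xi,
  rint th th' e (ren_ty xi s) =
  rint (fun i => th (xi i)) (fun i => th' (xi i)) (fun i => e (xi i)) s.
Proof.
  induction s; intros th th' e xi; cbn [rint ren_ty];
    rewrite ?subst_ren_ty, ?IHs1, ?IHs2, ?IHs; auto.
  f_equal; try (apply subst_ty_ext; now intros [|i]).
  f_equal; apply functional_extensionality; now intros [|i].
Qed.

(** * Derived rules of the logic *)

(** The elimination rules are restated with the instance as a separate equation: the conclusion can
    then be given in normal form and the substitution be checked by [syn]. *)
Lemma prv_allE n G Th Phi s p t q :
  prv n G Th Phi (PAll s p) -> typed n (ints G) t s ->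
  inst_prop_tm t p = q -> prv n G Th Phi q.
Proof. intros H T <-; now apply p_allE with s. Qed.

Lemma prv_alltyE n G Th Phi p s q :
  prv n G Th Phi (PAllTy p) -> wf_ty n s = true ->
  inst_prop_ty s p = q -> prv n G Th Phi q.
Proof. intros H T <-; now apply p_alltyE. Qed.

Lemma prv_allrelE n G Th Phi k s t p r q :
  prv n G Th Phi (PAllRel k s t p) -> isrel n G Th k r s t ->
  inst_prop_rel r p = q -> prv n G Th Phi q.
Proof. intros H T <-; now apply p_allrelE with k s t. Qed.

Lemma prv_relE n G Th Phi s t p x y q :
  prv n G Th Phi (PRel (RAbs s t p) x y) ->
  inst_prop_tm2 x y p = q -> prv n G Th Phi q.
Proof. intros H <-; now apply p_relE in H. Qed.

Lemma prv_relI n G Th Phi s t p x y q :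
  wf_rel n G Th (RAbs s t p) s t -> typed n (ints G) x s ->
  typed n (ints G) y t ->
  inst_prop_tm2 x y p = q -> prv n G Th Phi q ->
  prv n G Th Phi (PRel (RAbs s t p) x y).
Proof. intros W Tx Ty <- H; apply p_relI; auto; now apply wf_app with s t. Qed.

Lemma prv_subst n G Th Phi s t u p P Q :
  prv n G Th Phi (PEq s t u) -> wf_prop n (s :: G) Th p ->
  inst_prop_tm t p = P -> inst_prop_tm u p = Q ->
  prv n G Th Phi P -> prv n G Th Phi Q.
Proof. intros H W <- <- HP; now apply p_subst with s t. Qed.

Lemma prv_hyp n G Th Phi p : wf_prop n G Th p -> prv n G Th (p :: Phi) p.
Proof. intros; apply p_hyp; cbn; auto. Qed.

(** This replaces weakening: once cut in as a hypothesis, a fact is shifted by every quantifier rule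
    and can be recalled by [p_hyp] below any number of binders. *)
Lemma prv_cut n G Th Phi p q :
  wf_prop n G Th p -> prv n G Th Phi p -> prv n G Th (p :: Phi) q ->
  prv n G Th Phi q.
Proof. intros W Hp Hq; eapply p_impE; [exact (p_impI _ _ _ _ _ _ W Hq)|exact Hp]. Qed.

Lemma map_shift_prop j k l j' k' l' Phi :
  map (shift_prop j k l) (map (shift_prop j' k' l') Phi) =
  map (shift_prop (j + j') (k + k') (l + l')) Phi.
Proof.
  rewrite map_map; apply map_ext; intros p; unfold shift_prop.
  rewrite !ren_prop_subst, subst_subst_prop; apply subst_prop_ext;
    intros i; cbn; f_equal; lia.
Qed.

(** * Internal equality as a congruence *)

Definition peq (n : nat) (G : list ty) (Th : list rdecl) (Phi : list prop)
    (s : ty) (t u : tm) : Prop :=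
  prv n G Th Phi (PEq s t u) /\ typed n (ints G) t s /\ typed n (ints G) u s.

Lemma peq_eqv n G Th Phi s t u : eqv n (ints G) t u s -> peq n G Th Phi s t u.
Proof. intros (? & ? & ?); split; auto; now apply p_ext. Qed.

Lemma peq_refl n G Th Phi s t : typed n (ints G) t s -> peq n G Th Phi s t t.
Proof. intros; now apply peq_eqv, eqv_refl. Qed.

Lemma typed_shift_tm n G t s a :
  typed n (ints G) t s -> typed n (ints (a :: G)) (shift_tm 0 1 t) s.
Proof. intros T; apply (typed_weaken [Int a]); auto; nl. Qed.

Lemma prel_conv n G Th Phi r s t x y x' y' :
  wf_rel n G Th r s t -> peq n G Th Phi s x x' -> peq n G Th Phi t y y' ->
  prv n G Th Phi (PRel r x y) -> prv n G Th Phi (PRel r x' y').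
Proof.
  intros W (Hx & Tx & Tx') (Hy & Ty & Ty') H.
  eapply prv_subst with (p := PRel (shift_rel 0 1 0 r) (shift_tm 0 1 x') (Var 0));
    [exact Hy| | | |].
  - eapply wf_app; [apply (wf_rel_shift _ [t] []); exact W| |tyv].
    now apply typed_shift_tm.
  - reflexivity.
  - unfold inst_prop_tm; syn.
  - eapply prv_subst with
      (p := PRel (shift_rel 0 1 0 r) (Var 0) (shift_tm 0 1 y));
      [exact Hx| | | |].
    + eapply wf_app; [apply (wf_rel_shift _ [s] []); exact W|tyv|].
      now apply typed_shift_tm.
    + reflexivity.
    + unfold inst_prop_tm; syn.
    + replace (inst_prop_tm x _) with (PRel r x y); auto.
      unfold inst_prop_tm; syn.
Qed.

(** Leibniz substitution in the predicate [C[t] = C[x]], which holds at [x = t] by reflexivity;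
    variable 0 marks the hole of [C]. *)
Lemma peq_cong n G Th Phi s s' t u C :
  peq n G Th Phi s t u -> typed n (ints (s :: G)) C s' ->
  peq n G Th Phi s' (subst_tm TVar (scons t Var) C)
    (subst_tm TVar (scons u Var) C).
Proof.
  intros (H & Tt & Tu) TC.
  assert (Tt' : typed n (ints G) (subst_tm TVar (scons t Var) C) s')
    by (eapply typed_subst1; eauto; nl).
  split; [|split]; [|auto|eapply typed_subst1; eauto; nl].
  eapply prv_subst with
    (p := PEq s' (shift_tm 0 1 (subst_tm TVar (scons t Var) C)) C);
    [exact H|apply wf_eq; auto using typed_shift_tm| | |].
  - reflexivity.
  - unfold inst_prop_tm; cbn; f_equal; syn.
  - replace (inst_prop_tm t _) with (PEq s' (subst_tm TVar (scons t Var) C)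
      (subst_tm TVar (scons t Var) C)).
    + now apply peq_refl.
    + unfold inst_prop_tm; cbn; f_equal; syn.
Qed.

Lemma peq_sym n G Th Phi s t u : peq n G Th Phi s t u -> peq n G Th Phi s u t.
Proof.
  intros (H & Tt & Tu); split; auto.
  eapply prv_subst with (p := PEq s (Var 0) (shift_tm 0 1 t));
    [exact H|apply wf_eq; [tyv|now apply typed_shift_tm]|reflexivity| |].
  - unfold inst_prop_tm; syn.
  - replace (inst_prop_tm t _) with (PEq s t t);
      [now apply peq_refl|unfold inst_prop_tm; syn].
Qed.

Lemma peq_trans n G Th Phi s t u v :
  peq n G Th Phi s t u -> peq n G Th Phi s u v -> peq n G Th Phi s t v.
Proof.
  intros (H & Tt & Tu) (H' & _ & Tv); split; auto.
  eapply prv_subst with (p := PEq s (shift_tm 0 1 t) (Var 0));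
    [exact H'|apply wf_eq; [now apply typed_shift_tm|tyv]|reflexivity| |].
  - unfold inst_prop_tm; syn.
  - replace (inst_prop_tm u _) with (PEq s t u); auto.
    unfold inst_prop_tm; syn.
Qed.

Lemma peq_app n G Th Phi s s' t t' u u' :
  peq n G Th Phi (TLolli s s') t t' -> peq n G Th Phi s u u' ->
  peq n G Th Phi s' (App t u) (App t' u').
Proof.
  intros H H'; apply peq_trans with (App t u').
  - replace (App t u)
      with (subst_tm TVar (scons u Var) (App (shift_tm 0 1 t) (Var 0))) by syn.
    replace (App t u')
      with (subst_tm TVar (scons u' Var) (App (shift_tm 0 1 t) (Var 0))) by syn.
    apply peq_cong with s; auto; eapply typed_app; [nl| |tyv].
    apply typed_shift_tm, H.
  - replace (App t u')
      with (subst_tm TVar (scons t Var) (App (Var 0) (shift_tm 0 1 u'))) by syn.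
    replace (App t' u')
      with (subst_tm TVar (scons t' Var) (App (Var 0) (shift_tm 0 1 u'))) by syn.
    apply peq_cong with (TLolli s s'); auto; eapply typed_app; [nl|tyv|].
    apply typed_shift_tm, H'.
Qed.

Lemma peq_tapp n G Th Phi s a t t' r :
  peq n G Th Phi (TPi s) t t' -> wf_ty n a = true -> r = inst_ty a s ->
  peq n G Th Phi r (TApp t a) (TApp t' a).
Proof.
  intros H W ->.
  replace (TApp t a)
    with (subst_tm TVar (scons t Var) (TApp (Var 0) a)) by syn.
  replace (TApp t' a)
    with (subst_tm TVar (scons t' Var) (TApp (Var 0) a)) by syn.
  apply peq_cong with (TPi s); auto; apply ty_tapp; auto; tyv.
Qed.

Lemma peq_funext n G Th Phi s s' t u :
  wf_ty n s = true ->
  typed n (ints G) t (TLolli s s') -> typed n (ints G) u (TLolli s s') ->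
  peq n (s :: G) Th (map (shift_prop 0 1 0) Phi) s'
    (App (shift_tm 0 1 t) (Var 0)) (App (shift_tm 0 1 u) (Var 0)) ->
  peq n G Th Phi (TLolli s s') t u.
Proof.
  intros W Tt Tu H; split; auto.
  eapply p_impE; [now apply p_funext|apply p_allI; auto; apply H].
Qed.

Lemma peq_tyext n G Th Phi s t u :
  typed n (ints G) t (TPi s) -> typed n (ints G) u (TPi s) ->
  peq (S n) (map (ren_ty S) G) (map shift_rdecl Th)
    (map (shift_prop 1 0 0) Phi) s
    (TApp (shift_tm 1 0 t) (TVar 0)) (TApp (shift_tm 1 0 u) (TVar 0)) ->
  peq n G Th Phi (TPi s) t u.
Proof.
  intros Tt Tu H; split; auto.
  eapply p_impE; [now apply p_tyext|apply p_alltyI; apply H].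
Qed.

(** The relation [f x = g y], kept literally in the shape of [adm_preimage] applied to an equality
    relation, so that its admissibility needs no appeal to [adm_equiv]. Graphs and the relations
    behind the induction principles for [!] and tensor are instances. *)
Definition rpreim (b s t : ty) (f g : tm) : rel :=
  RAbs s t (PRel (shift_rel 0 2 0 (req b))
              (App (shift_tm 0 2 f) (Var 1)) (App (shift_tm 0 2 g) (Var 0))).

Lemma wf_req n G Th b : wf_ty n b = true -> wf_rel n G Th (req b) b b.
Proof. intros W; apply wf_rabs; auto; apply wf_eq; tyv. Qed.

Lemma isrel_rpreim n G Th b s t f g :
  wf_ty n b = true -> wf_ty n s = true -> wf_ty n t = true ->
  typed n (ints G) f (TLolli s b) -> typed n (ints G) g (TLolli t b) ->
  isrel n G Th KAdm (rpreim b s t f g) s t.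
Proof. intros; eapply adm_preimage; eauto; now apply adm_eq. Qed.

Lemma typed_shift_tms D n G t s :
  typed n (ints G) t s -> typed n (ints (D ++ G)) (shift_tm 0 (length D) t) s.
Proof.
  intros T; unfold ints; rewrite map_app, <- (length_map Int D).
  apply typed_weaken; [exact T|nl|rewrite <- map_app; nl].
Qed.

Lemma wf_rpreim n G Th b s t f g :
  wf_ty n b = true -> wf_ty n s = true -> wf_ty n t = true ->
  typed n (ints G) f (TLolli s b) -> typed n (ints G) g (TLolli t b) ->
  wf_rel n G Th (rpreim b s t f g) s t.
Proof.
  intros Wb Ws Wt Tf Tg; apply wf_rabs; auto.
  eapply wf_app.
  - apply (wf_rel_shift _ [t; s] []); now apply wf_req.
  - eapply typed_app; [nl|exact (typed_shift_tms [t; s] _ _ _ _ Tf)|tyv].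
  - eapply typed_app; [nl|exact (typed_shift_tms [t; s] _ _ _ _ Tg)|tyv].
Qed.

Lemma rpreimE n G Th Phi b s t f g x y :
  typed n (ints G) f (TLolli s b) -> typed n (ints G) g (TLolli t b) ->
  typed n (ints G) x s -> typed n (ints G) y t ->
  prv n G Th Phi (PRel (rpreim b s t f g) x y) ->
  peq n G Th Phi b (App f x) (App g y).
Proof.
  intros Tf Tg Tx Ty H; split; [|split; eapply typed_app; eauto; nl].
  apply prv_relE with (q := PRel (req b) (App f x) (App g y)) in H.
  - eapply prv_relE; [exact H|unfold inst_prop_tm2; syn].
  - unfold inst_prop_tm2, req; syn.
Qed.

Lemma rpreimI n G Th Phi b s t f g x y :
  wf_ty n b = true -> wf_ty n s = true -> wf_ty n t = true ->
  typed n (ints G) f (TLolli s b) -> typed n (ints G) g (TLolli t b) ->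
  typed n (ints G) x s -> typed n (ints G) y t ->
  prv n G Th Phi (PEq b (App f x) (App g y)) ->
  prv n G Th Phi (PRel (rpreim b s t f g) x y).
Proof.
  intros Wb Ws Wt Tf Tg Tx Ty H.
  eapply prv_relI with (q := PRel (req b) (App f x) (App g y));
    [now apply wf_rpreim|auto|auto|unfold inst_prop_tm2, req; syn|].
  eapply prv_relI; [now apply wf_req|eapply typed_app; eauto; nl..| |exact H].
  unfold inst_prop_tm2; syn.
Qed.

Lemma prv_eq n G Th Phi p q : prv n G Th Phi p -> p = q -> prv n G Th Phi q.
Proof. now intros H <-. Qed.

Lemma prv_eq_hyps n G Th Phi Phi' p q :
  prv n G Th Phi p -> Phi = Phi' -> p = q -> prv n G Th Phi' q.
Proof. now intros H <- <-. Qed.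

Lemma isrel_eq n G Th k r s t s' t' :
  isrel n G Th k r s t -> s = s' -> t = t' -> isrel n G Th k r s' t'.
Proof. now intros H <- <-. Qed.

Lemma wf_rel_eq n G Th r r' s t :
  wf_rel n G Th r s t -> r = r' -> wf_rel n G Th r' s t.
Proof. now intros H <-. Qed.

Ltac inst_norm :=
  unfold inst_prop_tm, inst_prop_tm2, inst_prop_ty, inst_prop_rel;
  cbn [subst_prop subst_rel].

Ltac inst_norm_in H :=
  unfold inst_prop_tm, inst_prop_tm2, inst_prop_ty, inst_prop_rel in H;
  cbn [subst_prop subst_rel] in H.

(** * Introduction and elimination rules for the relational interpretation *)

Lemma rint_lolliE n G Th Phi th th' e a b f g x y :
  prv n G Th Phi (PRel (rint th th' e (TLolli a b)) f g) ->
  typed n (ints G) x (subst_ty th a) -> typed n (ints G) y (subst_ty th' a) ->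
  prv n G Th Phi (PRel (rint th th' e a) x y) ->
  prv n G Th Phi (PRel (rint th th' e b) (App f x) (App g y)).
Proof.
  intros H Tx Ty Hr; cbn [rint] in H; unfold rlolli in H; eapply prv_relE in H; [|reflexivity]; inst_norm_in H.
  rewrite !(subst_ty_id TVar) in H by auto.
  eapply prv_allE in H; [|exact Tx|reflexivity]; inst_norm_in H.
  rewrite !(subst_ty_id TVar) in H by auto.
  eapply prv_allE in H; [|exact Ty|reflexivity]; inst_norm_in H.
  eapply prv_eq; [eapply p_impE; [exact H|eapply prv_eq; [exact Hr|syn]]|syn].
Qed.

Lemma rint_piE n G Th Phi th th' e a f g t t' R :
  prv n G Th Phi (PRel (rint th th' e (TPi a)) f g) ->
  wf_ty n t = true -> wf_ty n t' = true -> isrel n G Th KAdm R t t' ->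
  prv n G Th Phi (PRel (rint (scons t th) (scons t' th') (scons R e) a)
                    (TApp f t) (TApp g t')).
Proof.
  intros H Wt Wt' HR; cbn [rint] in H; unfold rpi in H; eapply prv_relE in H; [|reflexivity]; inst_norm_in H.
  eapply prv_alltyE in H; [|exact Wt|reflexivity]; inst_norm_in H.
  eapply prv_alltyE in H; [|exact Wt'|reflexivity]; inst_norm_in H.
  eapply prv_allrelE in H; [|eapply isrel_eq; [exact HR|syn..]|reflexivity].
  eapply prv_eq; [exact H|].
  inst_norm; syn_norm; rewrite rint_subst; f_equal; f_equal; syn.
Qed.

Lemma rint_lolliI N n G Th Phi th th' e a b f g :
  env_ok N n G Th th th' e -> wf_ty N (TLolli a b) = true ->
  typed n (ints G) f (subst_ty th (TLolli a b)) ->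
  typed n (ints G) g (subst_ty th' (TLolli a b)) ->
  prv n (subst_ty th' a :: subst_ty th a :: G) Th
    (PRel (rint th th' (fun i => shift_rel 0 2 0 (e i)) a) (Var 1) (Var 0)
       :: map (shift_prop 0 2 0) Phi)
    (PRel (rint th th' (fun i => shift_rel 0 2 0 (e i)) b)
       (App (shift_tm 0 2 f) (Var 1)) (App (shift_tm 0 2 g) (Var 0))) ->
  prv n G Th Phi (PRel (rint th th' e (TLolli a b)) f g).
Proof.
  intros HE W Tf Tg H.
  pose proof (wf_rint _ _ _ _ _ _ _ _ HE W) as Wr.
  pose proof W as W'; cbn in W'; apply andb_true_iff in W' as [Wa Wb].
  destruct (env_ok_wf _ _ _ _ _ _ _ _ HE Wa) as [Wa1 Wa2].
  cbn [rint] in *; unfold rlolli in *.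
  eapply prv_relI; [exact Wr|auto|auto|reflexivity|]; inst_norm.
  rewrite !(subst_ty_id TVar) by auto.
  apply p_allI; auto; apply p_allI; auto.
  rewrite map_shift_prop; apply p_impI.
  - eapply wf_app; [|cbn; tyv|cbn; tyv].
    pose proof (wf_rel_shift _ [subst_ty th' a; subst_ty th a] [] _ _ _ _ _
      (wf_rint _ _ _ _ _ _ _ _ HE Wa)) as Wr'.
    eapply wf_rel_eq; [exact Wr'|syn].
  - eapply prv_eq_hyps; [exact H|f_equal|].
    + f_equal; auto.
      transitivity (shift_rel 0 2 0 (rint th th' e a)); [|syn].
      unfold shift_rel; rewrite ren_rel_subst, rint_subst; f_equal; syn.
    + f_equal; [|syn|syn].
      transitivity (shift_rel 0 2 0 (rint th th' e b)); [|syn].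
      unfold shift_rel; rewrite ren_rel_subst, rint_subst; f_equal; syn.
Qed.

Lemma rint_ren th th' e s xi zeta chi :
  ren_rel xi zeta chi (rint th th' e s) =
  rint (fun i => ren_ty xi (th i)) (fun i => ren_ty xi (th' i))
    (fun i => ren_rel xi zeta chi (e i)) s.
Proof. rewrite ren_rel_subst, rint_subst; f_equal; syn. Qed.

Lemma rint_piI N n G Th Phi th th' e a f g :
  env_ok N n G Th th th' e -> wf_ty N (TPi a) = true ->
  typed n (ints G) f (subst_ty th (TPi a)) ->
  typed n (ints G) g (subst_ty th' (TPi a)) ->
  prv (S (S n)) (map (ren_ty S) (map (ren_ty S) G))
    ((KAdm, TVar 1, TVar 0) :: map shift_rdecl (map shift_rdecl Th))
    (map (shift_prop 2 0 1) Phi)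
    (PRel (rint (scons (TVar 1) (fun i => ren_ty (Nat.add 2) (th i)))
              (scons (TVar 0) (fun i => ren_ty (Nat.add 2) (th' i)))
              (scons (RVar 0) (fun i => shift_rel 2 0 1 (e i))) a)
       (TApp (shift_tm 2 0 f) (TVar 1)) (TApp (shift_tm 2 0 g) (TVar 0))) ->
  prv n G Th Phi (PRel (rint th th' e (TPi a)) f g).
Proof.
  intros HE W Tf Tg H.
  pose proof (wf_rint _ _ _ _ _ _ _ _ HE W) as Wr.
  cbn [rint] in *; unfold rpi in *.
  eapply prv_relI; [exact Wr|auto|auto|reflexivity|]; inst_norm.
  apply p_alltyI, p_alltyI.
  replace (subst_ty _ (TVar 1)) with (TVar 1) by syn.
  replace (subst_ty _ (TVar 0)) with (TVar 0) by syn.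
  apply p_allrelI; auto; rewrite !map_shift_prop.
  eapply prv_eq_hyps; [exact H|reflexivity|].
  symmetry; syn_norm; rewrite rint_subst; f_equal; f_equal; syn.
Qed.

Lemma isrel_var0 n G Th s t :
  isrel n G ((KAdm, s, t) :: Th) KAdm (RVar 0) s t.
Proof. now apply adm_var. Qed.

Lemma wf_rvar0 n G Th s t :
  wf_rel n G ((KAdm, s, t) :: Th) (RVar 0) s t.
Proof. now apply (wf_rvar _ _ _ _ KAdm). Qed.

(** Membership in a least relation: any admissible relation closed under [Bang] contains the pair,
    by its closure hypothesis at [f] and [g]. The premise is cut in first so that it can be recalled
    below the quantifier over that relation. *)
Lemma rint_bangI N n G Th Phi th th' e a f g :
  env_ok N n G Th th th' e -> wf_ty N a = true ->
  typed n (ints G) f (subst_ty th a) -> typed n (ints G) g (subst_ty th' a) ->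
  prv n G Th Phi (PRel (rint th th' e a) f g) ->
  prv n G Th Phi (PRel (rint th th' e (TBang a)) (Bang f) (Bang g)).
Proof.
  intros HE W Tf Tg H.
  pose proof (wf_rint a _ _ _ _ _ _ _ HE W) as Wa.
  pose proof (wf_rint (TBang a) _ _ _ _ _ _ _ HE W) as Wr.
  destruct (env_ok_wf _ _ _ _ _ _ _ _ HE W) as [W1 W2].
  assert (Wp : wf_prop n G Th (PRel (rint th th' e a) f g))
    by (eapply wf_app; eauto).
  eapply prv_cut; [exact Wp|exact H|].
  cbn [rint] in *; unfold rbang in *.
  eapply prv_relI; [exact Wr|apply ty_bang; [nl|auto]..|reflexivity|]; inst_norm.
  rewrite !(subst_ty_id TVar) by auto; apply p_allrelI; auto.
  match goal with |- prv ?n ?G ?Th ?Phi (PImp ?p _) =>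
    assert (WC : wf_prop n G Th p);
    [|assert (HC : prv n G Th (p :: Phi) p) by (now apply prv_hyp)] end.
  { do 2 (apply wf_all; auto); apply wf_imp.
    - eapply wf_app; [|cbn; tyv|cbn; tyv].
      eapply wf_rel_eq; [apply (wf_rel_shift _ [_; _] [_]); exact Wa|syn].
    - eapply wf_app; [apply wf_rvar0| |]; apply ty_bang; [nl|tyv|nl|tyv]. }
  apply p_impI; [exact WC|].
  eapply prv_allE in HC; [|exact Tf|reflexivity]; inst_norm_in HC.
  rewrite !(subst_ty_id TVar) in HC by auto.
  eapply prv_allE in HC; [|exact Tg|reflexivity]; inst_norm_in HC.
  eapply prv_eq; [eapply p_impE; [exact HC|]|syn].
  eapply prv_eq; [apply p_hyp; [right; left; reflexivity|]|].
  - change Th with ([] ++ Th) in Wp.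
    apply wf_ren with (1 := Wp), (ren_ctx_shift _ [] [_]).
  - unfold shift_prop; cbn; f_equal; syn.
Qed.

Lemma rint_tensorI N n G Th Phi th th' e a b f g f' g' :
  env_ok N n G Th th th' e -> wf_ty N a = true -> wf_ty N b = true ->
  typed n (ints G) f (subst_ty th a) -> typed n (ints G) g (subst_ty th' a) ->
  typed n (ints G) f' (subst_ty th b) -> typed n (ints G) g' (subst_ty th' b) ->
  prv n G Th Phi (PRel (rint th th' e a) f g) ->
  prv n G Th Phi (PRel (rint th th' e b) f' g') ->
  prv n G Th Phi (PRel (rint th th' e (TTensor a b)) (Tens f f') (Tens g g')).
Proof.
  intros HE Wa Wb Tf Tg Tf' Tg' H H'.
  assert (W : wf_ty N (TTensor a b) = true) by (cbn; now rewrite Wa, Wb).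
  pose proof (wf_rint a _ _ _ _ _ _ _ HE Wa) as Wra.
  pose proof (wf_rint b _ _ _ _ _ _ _ HE Wb) as Wrb.
  pose proof (wf_rint (TTensor a b) _ _ _ _ _ _ _ HE W) as Wr.
  destruct (env_ok_wf _ _ _ _ _ _ _ _ HE Wa) as [Wa1 Wa2].
  destruct (env_ok_wf _ _ _ _ _ _ _ _ HE Wb) as [Wb1 Wb2].
  assert (Wp : wf_prop n G Th (PAnd (PRel (rint th th' e a) f g)
                                    (PRel (rint th th' e b) f' g')))
    by (apply wf_and; eapply wf_app; eauto).
  (* The two premises travel as one conjunction, so a single cut carries both below the relation
     quantifier. *)
  eapply prv_cut; [exact Wp|now apply p_andI|].
  cbn [rint] in *; unfold rtensor in *.
  assert (NS := split_nolin _ (nolin_ints G)).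
  eapply prv_relI; [exact Wr|eapply ty_tens; eauto..|reflexivity|]; inst_norm.
  rewrite !(subst_ty_id TVar) by auto.
  apply p_allrelI; [cbn; apply andb_true_iff; auto..|].
  match goal with |- prv ?n ?G ?Th ?Phi (PImp ?p _) =>
    assert (WC : wf_prop n G Th p);
    [|assert (HC : prv n G Th (p :: Phi) p) by (now apply prv_hyp)] end.
  { do 4 (apply wf_all; auto); repeat apply wf_imp.
    - eapply wf_app; [|cbn; tyv|cbn; tyv].
      eapply wf_rel_eq; [apply (wf_rel_shift _ [_; _; _; _] [_]); exact Wra|syn].
    - eapply wf_app; [|cbn; tyv|cbn; tyv].
      eapply wf_rel_eq; [apply (wf_rel_shift _ [_; _; _; _] [_]); exact Wrb|syn].
    - eapply wf_app; [apply wf_rvar0| |];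
        (eapply ty_tens; [apply split_nolin; nl|cbn; tyv|cbn; tyv]). }
  apply p_impI; [exact WC|].
  eapply prv_allE in HC; [|exact Tf|reflexivity]; inst_norm_in HC.
  rewrite !(subst_ty_id TVar) in HC by auto.
  eapply prv_allE in HC; [|exact Tg|reflexivity]; inst_norm_in HC.
  rewrite !(subst_ty_id TVar) in HC by auto.
  eapply prv_allE in HC; [|exact Tf'|reflexivity]; inst_norm_in HC.
  rewrite !(subst_ty_id TVar) in HC by auto.
  eapply prv_allE in HC; [|exact Tg'|reflexivity]; inst_norm_in HC.
  match goal with HC : prv ?n ?G ?Th ?Phi _ |- _ =>
    assert (HH : prv n G Th Phi (shift_prop 0 0 1
      (PAnd (PRel (rint th th' e a) f g) (PRel (rint th th' e b) f' g')))) end.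
  { apply p_hyp; [right; left; reflexivity|].
    apply wf_ren with (1 := Wp), (ren_ctx_shift _ [] [_]). }
  eapply prv_eq; [eapply p_impE; [eapply p_impE; [exact HC|]|]|syn].
  - eapply prv_eq; [eapply p_andE1, HH|syn].
  - eapply prv_eq; [eapply p_andE2, HH|syn].
Qed.

(** * Identity extension *)

Lemma requivE n G Th Phi s t r r' x y :
  prv n G Th Phi (requiv s t r r') -> typed n (ints G) x s ->
  typed n (ints G) y t ->
  (prv n G Th Phi (PRel r x y) -> prv n G Th Phi (PRel r' x y)) /\
  (prv n G Th Phi (PRel r' x y) -> prv n G Th Phi (PRel r x y)).
Proof.
  intros H Tx Ty; unfold requiv in H.
  eapply prv_allE in H; [|exact Tx|reflexivity]; inst_norm_in H.
  rewrite !(subst_ty_id TVar) in H by auto.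
  eapply prv_allE in H; [|exact Ty|reflexivity]; inst_norm_in H.
  split; intros Hr.
  - eapply prv_eq; [eapply p_impE; [eapply p_andE1, H|]|syn].
    eapply prv_eq; [exact Hr|syn].
  - eapply prv_eq; [eapply p_impE; [eapply p_andE2, H|]|syn].
    eapply prv_eq; [exact Hr|syn].
Qed.

Lemma prv_req n G Th Phi s x y :
  wf_ty n s = true -> typed n (ints G) x s -> typed n (ints G) y s ->
  (prv n G Th Phi (PRel (req s) x y) <-> prv n G Th Phi (PEq s x y)).
Proof.
  intros W Tx Ty; split; intros H.
  - eapply prv_relE; [exact H|inst_norm; syn].
  - eapply prv_relI; [now apply wf_req|auto|auto| |exact H]; inst_norm; syn.
Qed.

Notation eq_env := (fun i => req (TVar i)).

Lemma idext_elim n G Th Phi s x y :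
  wf_ty n s = true -> typed n (ints G) x s -> typed n (ints G) y s ->
  prv n G Th Phi (PRel (rint TVar TVar eq_env s) x y) -> peq n G Th Phi s x y.
Proof.
  intros W Tx Ty H; split; auto; apply prv_req; auto.
  now apply (requivE _ _ _ _ _ _ _ _ _ _ (p_idext n G Th Phi s W) Tx Ty).
Qed.

Lemma idext_intro n G Th Phi s x y :
  wf_ty n s = true -> peq n G Th Phi s x y ->
  prv n G Th Phi (PRel (rint TVar TVar eq_env s) x y).
Proof.
  intros W (H & Tx & Ty); apply prv_req in H; auto.
  now apply (requivE _ _ _ _ _ _ _ _ _ _ (p_idext n G Th Phi s W) Tx Ty).
Qed.

Lemma requiv_subst th s0 e s t r r' :
  subst_prop th s0 e (requiv s t r r') =
  requiv (subst_ty th s) (subst_ty th t) (subst_rel th s0 e r)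
    (subst_rel th s0 e r').
Proof. unfold requiv, PIff; cbn [subst_prop]; syn. Qed.

(** The schema interprets type variables by their equality relations. Generalising its last type
    variable and instantiating it at [t] yields equality on an arbitrary type as a parameter. *)
Lemma idext_inst n G Th Phi s t x y :
  wf_ty (S n) s = true -> wf_ty n t = true ->
  peq n G Th Phi (inst_ty t s) x y ->
  prv n G Th Phi
    (PRel (rint (scons t TVar) (scons t TVar)
             (scons (req t) eq_env) s) x y).
Proof.
  intros W Wt (H & Tx & Ty); apply prv_req in H; auto using wf_inst_ty.
  refine (proj2 (requivE _ _ _ _ _ _ _ _ _ _ _ Tx Ty) H).
  eapply prv_alltyE; [apply p_alltyI, p_idext, W|exact Wt|].
  unfold inst_prop_ty; rewrite requiv_subst, rint_subst; f_equal; f_equal; syn.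
Qed.

Lemma env_ok_eq n G Th : env_ok n n G Th TVar TVar eq_env.
Proof.
  intros i Hi; apply Nat.ltb_lt in Hi; repeat split; auto; now apply wf_req.
Qed.

(** The impredicative definition read as induction: [R] contains the interpretation of [TBang a]
    once it is closed under [Bang]. The quantifier in [rbang] ranges over admissible relations,
    hence the condition on [R]. *)
Lemma rint_bangE N n G Th Phi th th' e a R x y :
  env_ok N n G Th th th' e -> wf_ty N a = true ->
  isrel n G Th KAdm R (subst_ty th (TBang a)) (subst_ty th' (TBang a)) ->
  prv n G Th Phi (PRel (rint th th' e (TBang a)) x y) ->
  prv n (subst_ty th' a :: subst_ty th a :: G) Th
    (PRel (shift_rel 0 2 0 (rint th th' e a)) (Var 1) (Var 0)
       :: map (shift_prop 0 2 0) Phi)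
    (PRel (shift_rel 0 2 0 R) (Bang (Var 1)) (Bang (Var 0))) ->
  prv n G Th Phi (PRel R x y).
Proof.
  intros HE W HR H HC.
  pose proof (wf_rint a _ _ _ _ _ _ _ HE W) as Wr.
  destruct (env_ok_wf _ _ _ _ _ _ _ _ HE W) as [W1 W2].
  cbn [rint] in H; unfold rbang in H.
  eapply prv_relE in H; [|reflexivity]; inst_norm_in H.
  rewrite !(subst_ty_id TVar) in H by auto.
  eapply prv_allrelE in H; [|exact HR|reflexivity]; inst_norm_in H.
  rewrite !(subst_ty_id TVar) in H by auto.
  eapply prv_eq; [eapply p_impE; [exact H|]|syn].
  apply p_allI; auto; apply p_allI; auto; rewrite map_shift_prop; apply p_impI.
  - eapply wf_app; [|cbn; tyv|cbn; tyv].
    eapply wf_rel_eq; [apply (wf_rel_shift _ [_; _] []); exact Wr|syn].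
  - eapply prv_eq_hyps; [exact HC|f_equal; syn|syn].
Qed.

Lemma rint_tensorE N n G Th Phi th th' e a b R x y :
  env_ok N n G Th th th' e -> wf_ty N a = true -> wf_ty N b = true ->
  isrel n G Th KAdm R (subst_ty th (TTensor a b)) (subst_ty th' (TTensor a b)) ->
  prv n G Th Phi (PRel (rint th th' e (TTensor a b)) x y) ->
  prv n (subst_ty th' b :: subst_ty th b :: subst_ty th' a :: subst_ty th a :: G)
    Th
    (PRel (shift_rel 0 4 0 (rint th th' e b)) (Var 1) (Var 0)
       :: PRel (shift_rel 0 4 0 (rint th th' e a)) (Var 3) (Var 2)
       :: map (shift_prop 0 4 0) Phi)
    (PRel (shift_rel 0 4 0 R) (Tens (Var 3) (Var 1)) (Tens (Var 2) (Var 0))) ->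
  prv n G Th Phi (PRel R x y).
Proof.
  intros HE Wa Wb HR H HC.
  pose proof (wf_rint a _ _ _ _ _ _ _ HE Wa) as Wra.
  pose proof (wf_rint b _ _ _ _ _ _ _ HE Wb) as Wrb.
  destruct (env_ok_wf _ _ _ _ _ _ _ _ HE Wa) as [Wa1 Wa2].
  destruct (env_ok_wf _ _ _ _ _ _ _ _ HE Wb) as [Wb1 Wb2].
  cbn [rint] in H; unfold rtensor in H.
  eapply prv_relE in H; [|reflexivity]; inst_norm_in H.
  rewrite !(subst_ty_id TVar) in H by auto.
  eapply prv_allrelE in H; [|exact HR|reflexivity]; inst_norm_in H.
  rewrite !(subst_ty_id TVar) in H by auto.
  eapply prv_eq; [eapply p_impE; [exact H|]|syn].
  do 4 (apply p_allI; auto); rewrite !map_shift_prop; repeat apply p_impI.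
  - eapply wf_app; [|cbn; tyv|cbn; tyv].
    eapply wf_rel_eq; [apply (wf_rel_shift _ [_; _; _; _] []); exact Wra|syn].
  - eapply wf_app; [|cbn; tyv|cbn; tyv].
    eapply wf_rel_eq; [apply (wf_rel_shift _ [_; _; _; _] []); exact Wrb|syn].
  - eapply prv_eq_hyps; [exact HC|f_equal; [syn|f_equal; syn]|syn].
Qed.

(** * Induction principles for [!] and tensor *)

Lemma peq_bang n G Th Phi s t u :
  peq n G Th Phi s t u -> peq n G Th Phi (TBang s) (Bang t) (Bang u).
Proof.
  intros H; apply (peq_cong n G Th Phi s (TBang s) t u (Bang (Var 0)) H).
  apply ty_bang; [nl|tyv].
Qed.

Lemma peq_tens n G Th Phi s s' t t' u u' :
  peq n G Th Phi s t u -> peq n G Th Phi s' t' u' ->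
  peq n G Th Phi (TTensor s s') (Tens t t') (Tens u u').
Proof.
  intros H H'; apply peq_trans with (Tens u t').
  - replace (Tens t t')
      with (subst_tm TVar (scons t Var) (Tens (Var 0) (shift_tm 0 1 t'))) by syn.
    replace (Tens u t')
      with (subst_tm TVar (scons u Var) (Tens (Var 0) (shift_tm 0 1 t'))) by syn.
    apply peq_cong with s; auto.
    eapply ty_tens; [apply split_nolin; nl|tyv|apply typed_shift_tm, H'].
  - replace (Tens u t')
      with (subst_tm TVar (scons t' Var) (Tens (shift_tm 0 1 u) (Var 0))) by syn.
    replace (Tens u u')
      with (subst_tm TVar (scons u' Var) (Tens (shift_tm 0 1 u) (Var 0))) by syn.
    apply peq_cong with s'; auto.
    eapply ty_tens; [apply split_nolin; nl|apply typed_shift_tm, H|tyv].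
Qed.

(** By identity extension [w] is related to itself by the least admissible relation closed under
    [Bang], hence also by the admissible relation [g1 x = g2 y] as soon as that one is closed under
    [Bang]. Two maps out of [!a] therefore agree everywhere if they agree on banged elements. *)
Lemma bang_ind n G Th Phi a b g1 g2 w :
  wf_ty n a = true -> wf_ty n b = true ->
  typed n (ints G) g1 (TLolli (TBang a) b) ->
  typed n (ints G) g2 (TLolli (TBang a) b) ->
  typed n (ints G) w (TBang a) ->
  prv n (a :: G) Th (map (shift_prop 0 1 0) Phi)
    (PEq b (App (shift_tm 0 1 g1) (Bang (Var 0)))
           (App (shift_tm 0 1 g2) (Bang (Var 0)))) ->
  peq n G Th Phi b (App g1 w) (App g2 w).
Proof.
  intros Wa Wb T1 T2 Tw H.
  pose (q := PAll a (PEq b (App (shift_tm 0 1 g1) (Bang (Var 0)))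
           (App (shift_tm 0 1 g2) (Bang (Var 0))))).
  assert (Wq : wf_prop n G Th q).
  { apply wf_all; auto; apply wf_eq; (eapply typed_app;
      [nl|apply typed_shift_tm; eassumption|apply ty_bang; [nl|tyv]]). }
  split; [|split; eapply typed_app; eauto; nl].
  (* The agreement of [g1] and [g2] on banged elements is given below one variable but used below
     two; quantified and cut in, it can be instantiated there. *)
  eapply prv_cut; [exact Wq|now apply p_allI|].
  eapply rpreimE; [exact T1|exact T2|exact Tw|exact Tw|].
  eapply (rint_bangE n n G Th (q :: Phi) TVar TVar eq_env a);
    [apply env_ok_eq|auto| | |].
  - rewrite subst_ty_id by auto; now apply isrel_rpreim.
  - apply idext_intro; auto; now apply peq_refl.
  - rewrite subst_ty_id by auto.
    set (hp := PRel _ (Var 1) (Var 0)).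
    assert (Whp : wf_prop n (a :: a :: G) Th hp).
    { eapply wf_app; [|cbn; tyv|cbn; tyv].
      apply (wf_rel_shift _ [a; a] []).
      eapply wf_rint in Wa; [|apply env_ok_eq].
      rewrite !subst_ty_id in Wa by auto; exact Wa. }
    assert (HE : peq n (a :: a :: G) Th
       (hp :: map (shift_prop 0 2 0) (q :: Phi)) a (Var 1) (Var 0)).
    { apply idext_elim; [auto|cbn; tyv|cbn; tyv|].
      eapply prv_eq; [now apply prv_hyp|unfold hp; f_equal].
      unfold shift_rel; rewrite rint_ren; f_equal; unfold req; syn. }
    assert (HQ : prv n (a :: a :: G) Th (hp :: map (shift_prop 0 2 0) (q :: Phi))
       (shift_prop 0 2 0 q)).
    { apply p_hyp; [right; left; reflexivity|].
      apply (wf_ren) with (1 := Wq).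
      apply (ren_ctx_shift n [a; a] []). }
    unfold q in HQ at 2; unfold shift_prop in HQ at 2; cbn [ren_prop] in HQ.
    eapply prv_allE with (t := Var 1) in HQ; [|cbn|reflexivity].
    2:{ rewrite ren_ty_subst, subst_ty_id by auto; tyv. }
    replace (shift_rel 0 2 0 (rpreim b (TBang a) (TBang a) g1 g2))
      with (rpreim b (TBang a) (TBang a) (shift_tm 0 2 g1) (shift_tm 0 2 g2))
      by (unfold rpreim, req; syn).
    pose proof (typed_shift_tms [a; a] _ _ _ _ T1) as T1'.
    pose proof (typed_shift_tms [a; a] _ _ _ _ T2) as T2'.
    apply rpreimI; [auto|auto|auto|exact T1'|exact T2'
      |apply ty_bang; [nl|cbn; tyv]..|].
    (* Closure under [Bang], for related components x and y: [g1 !x = g2 !x] is the cut hypothesis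
       at x, and [g2 !x = g2 !y] holds because identity extension makes x and y equal. *)
    eapply peq_trans with (u := App (shift_tm 0 2 g2) (Bang (Var 1))).
    + split; [|split; (eapply typed_app; [nl|exact T1' || exact T2'
        |apply ty_bang; [nl|cbn; tyv]])].
      eapply prv_eq; [exact HQ|inst_norm; syn].
    + apply peq_app with (TBang a); [now apply peq_refl|now apply peq_bang].
Qed.

(** The argument for [!] with two components: both pairs of related components become equal by
    identity extension, and the hypothesis is used at the left members of the pairs. *)
Lemma tensor_ind n G Th Phi a a' b g1 g2 w :
  wf_ty n a = true -> wf_ty n a' = true -> wf_ty n b = true ->
  typed n (ints G) g1 (TLolli (TTensor a a') b) ->
  typed n (ints G) g2 (TLolli (TTensor a a') b) ->
  typed n (ints G) w (TTensor a a') ->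
  prv n (a' :: a :: G) Th (map (shift_prop 0 2 0) Phi)
    (PEq b (App (shift_tm 0 2 g1) (Tens (Var 1) (Var 0)))
           (App (shift_tm 0 2 g2) (Tens (Var 1) (Var 0)))) ->
  peq n G Th Phi b (App g1 w) (App g2 w).
Proof.
  intros Wa Wa' Wb T1 T2 Tw H.
  assert (Wt : wf_ty n (TTensor a a') = true) by (cbn; now rewrite Wa, Wa').
  pose (q := PAll a (PAll a'
    (PEq b (App (shift_tm 0 2 g1) (Tens (Var 1) (Var 0)))
           (App (shift_tm 0 2 g2) (Tens (Var 1) (Var 0)))))).
  assert (Wq : wf_prop n G Th q).
  { pose proof (typed_shift_tms [a'; a] _ _ _ _ T1) as T1'.
    pose proof (typed_shift_tms [a'; a] _ _ _ _ T2) as T2'.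
    do 2 (apply wf_all; auto); apply wf_eq; (eapply typed_app;
      [nl|exact T1' || exact T2'
      |eapply ty_tens; [apply split_nolin; nl|cbn; tyv|cbn; tyv]]). }
  split; [|split; eapply typed_app; eauto; nl].
  eapply prv_cut; [exact Wq|do 2 (apply p_allI; auto);
    now rewrite map_shift_prop|].
  eapply rpreimE; [exact T1|exact T2|exact Tw|exact Tw|].
  eapply (rint_tensorE n n G Th (q :: Phi) TVar TVar eq_env a a');
    [apply env_ok_eq|auto|auto| | |].
  - rewrite subst_ty_id by auto; now apply isrel_rpreim.
  - apply idext_intro; auto; now apply peq_refl.
  - rewrite !(subst_ty_id TVar) by auto.
    match goal with |- prv _ _ _ (?p1 :: ?p2 :: _) _ =>
      set (hp' := p1); set (hp := p2) end.
    set (HY := hp' :: hp :: _).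
    assert (Whp : wf_prop n (a' :: a' :: a :: a :: G) Th hp).
    { eapply wf_app; [|cbn; tyv|cbn; tyv].
      apply (wf_rel_shift _ [a'; a'; a; a] []).
      eapply wf_rint in Wa; [|apply env_ok_eq].
      rewrite !subst_ty_id in Wa by auto; exact Wa. }
    assert (Whp' : wf_prop n (a' :: a' :: a :: a :: G) Th hp').
    { eapply wf_app; [|cbn; tyv|cbn; tyv].
      apply (wf_rel_shift _ [a'; a'; a; a] []).
      eapply wf_rint in Wa'; [|apply env_ok_eq].
      rewrite !subst_ty_id in Wa' by auto; exact Wa'. }
    assert (HE : peq n (a' :: a' :: a :: a :: G) Th HY a (Var 3) (Var 2)).
    { apply idext_elim; [auto|cbn; tyv|cbn; tyv|].
      eapply prv_eq; [apply p_hyp; [right; left; reflexivity|exact Whp]|].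
      unfold hp; f_equal.
      unfold shift_rel; rewrite rint_ren; f_equal; unfold req; syn. }
    assert (HE' : peq n (a' :: a' :: a :: a :: G) Th HY a' (Var 1) (Var 0)).
    { apply idext_elim; [auto|cbn; tyv|cbn; tyv|].
      eapply prv_eq; [now apply prv_hyp|unfold hp'; f_equal].
      unfold shift_rel; rewrite rint_ren; f_equal; unfold req; syn. }
    assert (HQ : prv n (a' :: a' :: a :: a :: G) Th HY (shift_prop 0 4 0 q)).
    { apply p_hyp; [right; right; left; reflexivity|].
      apply (wf_ren) with (1 := Wq).
      apply (ren_ctx_shift n [a'; a'; a; a] []). }
    unfold q, shift_prop in HQ; cbn [ren_prop] in HQ.
    eapply prv_allE with (t := Var 3) in HQ; [|cbn|reflexivity].
    2:{ rewrite ren_ty_subst, subst_ty_id by auto; tyv. }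
    inst_norm_in HQ.
    eapply prv_allE with (t := Var 1) in HQ; [|cbn|reflexivity].
    2:{ rewrite ren_ty_subst, !subst_ty_id by auto; tyv. }
    replace (shift_rel 0 4 0 (rpreim b (TTensor a a') (TTensor a a') g1 g2))
      with (rpreim b (TTensor a a') (TTensor a a')
              (shift_tm 0 4 g1) (shift_tm 0 4 g2))
      by (unfold rpreim, req; syn).
    pose proof (typed_shift_tms [a'; a'; a; a] _ _ _ _ T1) as T1'.
    pose proof (typed_shift_tms [a'; a'; a; a] _ _ _ _ T2) as T2'.
    assert (Tt : typed n (ints (a' :: a' :: a :: a :: G)) (Tens (Var 3) (Var 1))
                   (TTensor a a'))
      by (eapply ty_tens; [apply split_nolin; nl|cbn; tyv|cbn; tyv]).
    assert (Tt' : typed n (ints (a' :: a' :: a :: a :: G)) (Tens (Var 2) (Var 0))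
                   (TTensor a a'))
      by (eapply ty_tens; [apply split_nolin; nl|cbn; tyv|cbn; tyv]).
    apply rpreimI; [auto|auto|auto|exact T1'|exact T2'|auto|auto|].
    eapply peq_trans with (u := App (shift_tm 0 4 g2) (Tens (Var 3) (Var 1))).
    + split; [|split; (eapply typed_app; [nl|exact T1' || exact T2'|auto])].
      eapply prv_eq; [exact HQ|inst_norm; syn].
    + apply peq_app with (TTensor a a'); [now apply peq_refl|now apply peq_tens].
Qed.

(** * Parametricity of the functorial action and of packing *)

Lemma idtm_beta n X a x :
  nolin X -> wf_ty n a = true -> typed n X x a -> eqv n X (App (idtm a) x) x a.
Proof.
  intros N W Tx; eapply eqv_app_beta;
    [auto|now apply eqv_refl, typed_idtm|auto|reflexivity].
Qed.

Lemma typed_comp n X a b c g f :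
  nolin X -> wf_ty n a = true -> typed n X g (TLolli b c) ->
  typed n X f (TLolli a b) -> typed n X (comp a g f) (TLolli a c).
Proof.
  intros N W Tg Tf; apply ty_lam; auto.
  eapply (ty_app _ _ (Gone :: X) (Lin a :: X)); [spl| |].
  - apply (typed_weaken [Gone]); [exact Tg|nl|nl].
  - eapply (ty_app _ _ (Gone :: X) (Lin a :: X)); [spl| |tyv].
    apply (typed_weaken [Gone]); [exact Tf|nl|nl].
Qed.

Lemma comp_beta n X a b c g f x :
  nolin X -> wf_ty n a = true -> typed n X g (TLolli b c) ->
  typed n X f (TLolli a b) -> typed n X x a ->
  eqv n X (App (comp a g f) x) (App g (App f x)) c.
Proof.
  intros N W Tg Tf Tx; eapply eqv_app_beta;
    [auto|eapply eqv_refl, typed_comp; eauto|auto|]; syn.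
Qed.

Lemma env_ok_1 n G Th t t' R e :
  wf_ty n t = true -> wf_ty n t' = true -> wf_rel n G Th R t t' ->
  env_ok 1 n G Th (scons t TVar) (scons t' TVar) (scons R e).
Proof. intros W W' H [|i] Hi; [auto|lia]. Qed.

(** The preimage of equality under (h, id). The identity on the right keeps the graph within the
    form of [rpreim]; [graphE] and [graphI] remove it by beta. *)
Definition graph (t t' : ty) (h : tm) : rel := rpreim t' t t' h (idtm t').

Lemma isrel_graph n G Th t t' h :
  wf_ty n t = true -> wf_ty n t' = true -> typed n (ints G) h (TLolli t t') ->
  isrel n G Th KAdm (graph t t' h) t t'.
Proof.
  intros; apply isrel_rpreim; auto; apply typed_idtm; auto; nl.
Qed.

Lemma wf_graph n G Th t t' h :
  wf_ty n t = true -> wf_ty n t' = true -> typed n (ints G) h (TLolli t t') ->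
  wf_rel n G Th (graph t t' h) t t'.
Proof.
  intros; apply wf_rpreim; auto; apply typed_idtm; auto; nl.
Qed.

Lemma graph_ren t t' h xi zeta chi :
  ren_rel xi zeta chi (graph t t' h) =
  graph (ren_ty xi t) (ren_ty xi t') (ren_tm xi zeta h).
Proof. unfold graph, rpreim, req; syn. Qed.

Lemma graph_shift t t' h j k :
  shift_rel 0 j k (graph t t' h) = graph t t' (shift_tm 0 j h).
Proof. unfold shift_rel; rewrite graph_ren; f_equal; syn. Qed.

Lemma graphE n G Th Phi t t' h x y :
  wf_ty n t' = true -> typed n (ints G) h (TLolli t t') ->
  typed n (ints G) x t -> typed n (ints G) y t' ->
  prv n G Th Phi (PRel (graph t t' h) x y) ->
  peq n G Th Phi t' (App h x) y.
Proof.
  intros W Th' Tx Ty H; apply rpreimE in H; auto.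
  - apply peq_trans with (1 := H), peq_eqv, idtm_beta; auto; nl.
  - apply typed_idtm; auto; nl.
Qed.

Lemma graphI n G Th Phi t t' h x y :
  wf_ty n t = true -> wf_ty n t' = true -> typed n (ints G) h (TLolli t t') ->
  typed n (ints G) x t -> peq n G Th Phi t' (App h x) y ->
  prv n G Th Phi (PRel (graph t t' h) x y).
Proof.
  intros W W' Th' Tx H; assert (Ty := proj2 (proj2 H)).
  apply rpreimI; auto; [apply typed_idtm; auto; nl|].
  apply peq_trans with (1 := H), peq_sym, peq_eqv, idtm_beta; auto; nl.
Qed.

(** One half of the equivalence of [sigma[<h>]] and [<sigma(h)>]: the pair
    [(id, h)] lies in [eq -o <h>], and [sigma(id) = id]. *)
Lemma fmap_graph n G Th Phi sg t t' h u :
  wf_ty 1 sg = true -> occurs_only true 0 sg = true ->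
  wf_ty n t = true -> wf_ty n t' = true ->
  typed n (ints G) h (TLolli t t') -> typed n (ints G) u (inst_ty t sg) ->
  prv n G Th Phi
    (PRel (rint (scons t TVar) (scons t' TVar) (scons (graph t t' h) eq_env) sg)
       u (App (fmap sg t t' h) u)).
Proof.
  intros W P Wt Wt' Tyh Tu.
  assert (NG := nolin_ints G).
  assert (Tid : typed n (ints G) (idtm t) (TLolli t t)) by now apply typed_idtm.
  assert (H : prv n G Th Phi (PRel (rint TVar TVar eq_env (ty_fmap_poly sg))
                                (fmap_poly sg) (fmap_poly sg))).
  { apply idext_intro;
      [apply (wf_ty_le 0); [now apply wf_ty_fmap_poly|lia]|].
    apply peq_refl, typed_closed; auto using typed_fmap_poly, wf_ty_fmap_poly. }
  unfold ty_fmap_poly in H.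
  (* The source variable becomes [t] on both sides, with equality; the target variable becomes [t]
     on the left and [t'] on the right, with the graph. The left instance can then be fed the
     identity and the right one [h]. *)
  eapply (rint_piE _ _ _ _ _ _ _ _ _ _ t t (req t)) in H;
    [|auto|auto|now apply adm_eq].
  eapply (rint_piE _ _ _ _ _ _ _ _ _ _ t t' (graph t t' h)) in H;
    [|auto|auto|now apply isrel_graph].
  assert (HE : env_ok 2 n G Th (scons t (scons t TVar)) (scons t' (scons t TVar))
                 (scons (graph t t' h) (scons (req t) eq_env))).
  { intros [|[|i]] Hi; cbn; auto using wf_graph, wf_req; lia. }
  eapply rint_lolliE with (x := Bang (idtm t)) (y := Bang h) in H;
    [|now apply ty_bang|now apply ty_bang|].
  2:{ apply (rint_bangI 2); auto.
      apply (rint_lolliI 2); auto; cbn [rint scons subst_ty].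
      rewrite graph_shift.
      pose proof (typed_shift_tms [t; t] _ _ _ _ Tyh) as Tyh'.
      cbn [length app] in Tyh'.
      change (shift_tm 0 2 (idtm t)) with (idtm (ren_ty (Nat.add 0) t)).
      replace (ren_ty (Nat.add 0) t) with t by syn.
      assert (Ti : eqv n (ints (t :: t :: G)) (App (idtm t) (Var 1)) (Var 1) t)
        by (apply idtm_beta; [nl|auto|cbn; tyv]).
      (* The pair (id, h) sends equal arguments x and y into the graph, since
         [h (id x) = h x = h y]. *)
      apply graphI; auto; [apply Ti|].
      apply peq_app with t; [now apply peq_refl|].
      apply peq_trans with (Var 1); [now apply peq_eqv|].
      split; [|split; cbn; tyv].
      apply (prv_req n); [auto|cbn; tyv|cbn; tyv|].
      eapply prv_eq; [apply p_hyp; [left; reflexivity|]|unfold req; syn].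
      eapply wf_app; [|cbn; tyv|cbn; tyv].
      apply (wf_rel_shift _ [t; t] []); now apply wf_req. }
  eapply rint_lolliE with (x := u) (y := u) in H.
  2,3: rewrite subst_ren_ty; exact Tu.
  (* The source copy of [sg] is interpreted at equality on [t], where identity extension relates [u]
     to itself. *)
  2:{ rewrite rint_ren_ty; cbn [scons].
      eapply prv_eq; [apply (idext_inst _ _ _ _ sg t u u);
        [apply (wf_ty_le 1); auto; lia|auto|now apply peq_refl]|].
      reflexivity. }
  rewrite rint_ren_ty in H.
  rewrite (rint_agree sg 1 _ _ _ (scons t TVar) (scons t' TVar)
    (scons (graph t t' h) eq_env)) in H
    by (auto; intros [|i] Hi; auto; lia).
  (* The left member reduces to the action of the identity on [u], hence to [u] by the identity law;
     the right one reduces to the action of [h] on [u]. *)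
  eapply prel_conv; [|  | |exact H].
  - apply (wf_rint sg 1); auto; apply env_ok_1; auto; now apply wf_graph.
  - apply peq_eqv; apply eqv_trans with (App (fmap sg t t (idtm t)) u).
    + eapply eqv_app; [auto|now apply fmap_poly_beta|now apply eqv_refl].
    + apply eqv_trans with (App (idtm (inst_ty t sg)) u).
      * eapply eqv_app; [auto| |apply eqv_refl; exact Tu].
        split; [|split]; [now apply fmap_id|now apply typed_fmap|].
        apply typed_idtm; auto; now apply wf_inst.
      * apply idtm_beta; auto; now apply wf_inst.
  - apply peq_eqv; eapply eqv_app; [auto|now apply fmap_poly_beta|now apply eqv_refl].
Qed.

(** The result type [b] does not mention the quantified variable, so its interpretation is equality
    by identity extension. A polymorphic client [k] thus gives equal results on contents related
    through any admissible [R]. *)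
Lemma coalg_parametricity n G Th Phi sg b k t t' R y y' :
  wf_ty 1 sg = true -> wf_ty n b = true ->
  wf_ty n t = true -> wf_ty n t' = true -> isrel n G Th KAdm R t t' ->
  typed n (ints G) k (TPi (TLolli (ty_coalg sg) (ren_ty S b))) ->
  typed n (ints G) y (inst_ty t (ty_coalg sg)) ->
  typed n (ints G) y' (inst_ty t' (ty_coalg sg)) ->
  prv n G Th Phi
    (PRel (rint (scons t TVar) (scons t' TVar) (scons R eq_env) (ty_coalg sg))
       y y') ->
  peq n G Th Phi b (App (TApp k t) y) (App (TApp k t') y').
Proof.
  intros W Wb Wt Wt' HR Tk Ty Ty' H.
  assert (Hk : prv n G Th Phi (PRel (rint TVar TVar eq_env
                 (TPi (TLolli (ty_coalg sg) (ren_ty S b)))) k k)).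
  { apply idext_intro; [|now apply peq_refl].
    cbn [wf_ty]; rewrite andb_true_iff; split;
      [now apply wf_coalg|now apply wf_ty_shift]. }
  eapply rint_piE in Hk; [|exact Wt|exact Wt'|exact HR].
  pose proof (rint_lolliE _ _ _ _ _ _ _ _ _ _ _ _ _ Hk Ty Ty' H) as Hy.
  rewrite rint_ren_ty in Hy.
  apply idext_elim; auto.
  - eapply typed_app; [nl| |exact Ty].
    eapply typed_tapp; [exact Tk|auto|syn].
  - eapply typed_app; [nl| |exact Ty'].
    eapply typed_tapp; [exact Tk|auto|syn].
Qed.

Lemma pack_parametricity n G Th Phi sg t t' R y y' :
  wf_ty 1 sg = true -> wf_ty n t = true -> wf_ty n t' = true ->
  isrel n G Th KAdm R t t' ->
  typed n (ints G) y (inst_ty t (ty_coalg sg)) ->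
  typed n (ints G) y' (inst_ty t' (ty_coalg sg)) ->
  prv n G Th Phi
    (PRel (rint (scons t TVar) (scons t' TVar) (scons R eq_env) (ty_coalg sg))
       y y') ->
  peq n G Th Phi (nu sg) (App (TApp (pack sg) t) y) (App (TApp (pack sg) t') y').
Proof.
  intros W Wt Wt' HR Ty Ty' H.
  apply (coalg_parametricity n G Th Phi sg) with (R := R); auto;
    [wf|].
  replace (ren_ty S (nu sg)) with (nu sg) by syn.
  apply typed_closed; [now apply typed_pack|wf|nl].
Qed.

(** The content relation splits into factors: [x] and [h x] lie in the graph by definition, and it
    remains to relate [f] to [out] as functions from the graph to [sigma] of the graph. *)
Lemma coalg_map_pack n G Th Phi sg t f h x :
  wf_ty 1 sg = true -> occurs_only true 0 sg = true -> wf_ty n t = true ->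
  typed n (ints G) f (TLolli t (inst_ty t sg)) ->
  typed n (ints G) h (TLolli t (nu sg)) -> typed n (ints G) x t ->
  prv n G Th Phi (PEq (TLolli t (inst_ty (nu sg) sg))
                    (comp t (out sg) h) (comp t (fmap sg t (nu sg) h) f)) ->
  peq n G Th Phi (nu sg)
    (App (TApp (pack sg) t) (Tens (Bang f) x))
    (App (TApp (pack sg) (nu sg)) (Tens (Bang (out sg)) (App h x))).
Proof.
  intros W P Wt Tf Tyh Tx E.
  assert (NG := nolin_ints G).
  assert (Wn : wf_ty n (nu sg) = true) by wf.
  assert (To : forall n X, nolin X ->
            typed n X (out sg) (TLolli (nu sg) (inst_ty (nu sg) sg)))
    by (intros; apply typed_closed; [now apply typed_out|wf|auto]).
  assert (Thx : typed n (ints G) (App h x) (nu sg)) by eauto using typed_app.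
  assert (HE : env_ok 1 n G Th (scons t TVar) (scons (nu sg) TVar)
                 (scons (graph t (nu sg) h) eq_env))
    by (apply env_ok_1; auto; now apply wf_graph).
  apply pack_parametricity with (R := graph t (nu sg) h); auto.
  - now apply isrel_graph.
  - eapply ty_tens; [now apply split_nolin|now apply ty_bang|exact Tx].
  - eapply ty_tens; [now apply split_nolin|apply ty_bang; auto; now apply To
      |exact Thx].
  - apply (rint_tensorI 1); auto; [apply ty_bang; auto..| |].
    2:{ cbn [rint scons]; apply graphI; auto; now apply peq_refl. }
    apply (rint_bangI 1); auto.
    (* The coalgebra equation is needed below the two variables introduced for related arguments of
       [f] and [out]. *)
    eapply prv_cut; [|exact E|].
    { apply wf_eq; eapply typed_comp; eauto; now apply typed_fmap. }
    apply (rint_lolliI 1); auto.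
    cbn [subst_ty scons rint].
    rewrite graph_shift; set (Hyp := _ :: map _ _).
    pose proof (typed_shift_tms [nu sg; t] _ _ _ _ Tyh) as Tyh'.
    pose proof (typed_shift_tms [nu sg; t] _ _ _ _ Tf) as Tf'.
    cbn [length app] in Tyh', Tf'.
    replace (shift_tm 0 2 (out sg)) with (out sg) by syn.
    assert (Tv1 : typed n (ints (nu sg :: t :: G)) (Var 1) t) by (cbn; tyv).
    assert (Tv0 : typed n (ints (nu sg :: t :: G)) (Var 0) (nu sg))
      by (cbn; tyv).
    assert (Tfx : typed n (ints (nu sg :: t :: G)) (App (shift_tm 0 2 f) (Var 1))
               (inst_ty t sg)) by (eapply typed_app; [nl|exact Tf'|auto]).
    assert (Hh : peq n (nu sg :: t :: G) Th Hyp (nu sg)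
                   (App (shift_tm 0 2 h) (Var 1)) (Var 0)).
    { apply graphE with t; auto.
      apply p_hyp; [left; reflexivity|].
      eapply wf_app; [now apply wf_graph|auto|auto]. }
    (* The half graph lemma relates [f x] to [sigma(h) (f x)], while the goal asks for [out y]. The
       coalgebra equation gives [sigma(h) (f x) = out (h x)], and [h x = y] holds because x and y
       lie in the graph. *)
    assert (HC : peq n (nu sg :: t :: G) Th Hyp (inst_ty (nu sg) sg)
                   (App (fmap sg t (nu sg) (shift_tm 0 2 h))
                      (App (shift_tm 0 2 f) (Var 1))) (App (out sg) (Var 0))).
    { apply peq_trans with
        (App (comp t (fmap sg t (nu sg) (shift_tm 0 2 h)) (shift_tm 0 2 f))
           (Var 1)).
      { apply peq_sym, peq_eqv; eapply comp_beta; eauto; [nl|].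
        apply typed_fmap; auto; nl. }
      apply peq_trans with (App (comp t (out sg) (shift_tm 0 2 h)) (Var 1)).
      { apply peq_app with t; [|now apply peq_refl].
        assert (W1 : typed n (ints (nu sg :: t :: G))
            (comp t (out sg) (shift_tm 0 2 h)) (TLolli t (inst_ty (nu sg) sg)))
          by (eapply typed_comp; eauto; [nl|apply To; nl]).
        assert (W2 : typed n (ints (nu sg :: t :: G))
            (comp t (fmap sg t (nu sg) (shift_tm 0 2 h)) (shift_tm 0 2 f))
            (TLolli t (inst_ty (nu sg) sg)))
          by (eapply typed_comp; eauto; [nl|apply typed_fmap; auto; nl]).
        apply peq_sym; split; auto.
        apply p_hyp; [|now apply wf_eq].
        right; left; unfold shift_prop; cbn [ren_prop]; f_equal; syn. }
      apply peq_trans with (App (out sg) (App (shift_tm 0 2 h) (Var 1))).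
      { apply peq_eqv; eapply comp_beta; eauto; [nl|apply To; nl]. }
      apply peq_app with (nu sg); [apply peq_refl, To; nl|exact Hh]. }
    eapply prv_eq.
    + eapply prel_conv; [|apply peq_refl, Tfx|exact HC
        |apply fmap_graph; auto].
      apply (wf_rint sg 1); auto; apply env_ok_1; auto; now apply wf_graph.
    + f_equal; apply (rint_agree sg 1); auto.
      intros [|i] Hi; [|lia]; cbn [scons]; now rewrite graph_shift.
Qed.

(** At a point the equation is external, by [unfold_beta] and [out_beta]. Extensionality serves to
    turn the linear argument of the composites into an intuitionistic variable, as required by these
    beta equations. *)
Lemma unfold_coalg_map n G Th Phi sg t f :
  wf_ty 1 sg = true -> occurs_only true 0 sg = true -> wf_ty n t = true ->
  typed n (ints G) f (TLolli t (inst_ty t sg)) ->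
  peq n G Th Phi (TLolli t (inst_ty (nu sg) sg))
    (comp t (out sg) (App (TApp (unfold sg) t) (Bang f)))
    (comp t (fmap sg t (nu sg) (App (TApp (unfold sg) t) (Bang f))) f).
Proof.
  intros W P Wt Tf.
  assert (Wn : forall n, wf_ty n (nu sg) = true) by (intros; wf).
  assert (To : forall n X, nolin X ->
            typed n X (out sg) (TLolli (nu sg) (inst_ty (nu sg) sg)))
    by (intros; apply typed_closed; [now apply typed_out|wf|auto]).
  assert (Tu : forall G f, typed n (ints G) f (TLolli t (inst_ty t sg)) ->
            typed n (ints G) (App (TApp (unfold sg) t) (Bang f))
              (TLolli t (nu sg)))
    by (intros; apply typed_unfold_at; auto; [nl|apply ty_bang; auto; nl]).
  apply peq_funext; auto.
  { eapply typed_comp; eauto; [nl|apply To; nl]. }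
  { eapply typed_comp; eauto; [nl|apply typed_fmap; auto; nl]. }
  pose proof (typed_shift_tm _ _ _ _ t Tf) as Tf'.
  assert (Tv : typed n (ints (t :: G)) (Var 0) t) by (cbn; tyv).
  apply peq_eqv.
  replace (shift_tm 0 1 (comp t (out sg) (App (TApp (unfold sg) t) (Bang f))))
    with (comp t (out sg) (App (TApp (unfold sg) t) (Bang (shift_tm 0 1 f))))
    by syn.
  replace (shift_tm 0 1 (comp t
      (fmap sg t (nu sg) (App (TApp (unfold sg) t) (Bang f))) f))
    with (comp t (fmap sg t (nu sg)
            (App (TApp (unfold sg) t) (Bang (shift_tm 0 1 f))))
            (shift_tm 0 1 f)) by syn.
  eapply eqv_trans; [eapply comp_beta; eauto; [nl|apply To; nl]|].
  eapply eqv_trans.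
  { eapply eqv_app; [nl|apply eqv_refl, To; nl|].
    apply unfold_beta; auto; [nl|apply ty_bang; auto; nl]. }
  eapply eqv_trans; [apply out_beta; auto; nl|].
  apply eqv_sym; eapply comp_beta; eauto; [nl|apply typed_fmap; auto; nl].
Qed.

(** * Repacking an element of the encoded existential type *)

Lemma typed_nu_tapp n X sg z b :
  wf_ty 1 sg = true -> wf_ty n b = true -> typed n X z (nu sg) ->
  typed n X (TApp z b)
    (TLolli (TPi (TLolli (ty_coalg sg) (ren_ty S b))) b).
Proof. intros W Wb Tz; eapply typed_tapp; [exact Tz|auto|syn]. Qed.

Lemma typed_pack_nu n X sg :
  wf_ty 1 sg = true -> nolin X ->
  typed n X (pack sg) (TPi (TLolli (ty_coalg sg) (ren_ty S (nu sg)))).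
Proof.
  intros W N; replace (ren_ty S (nu sg)) with (nu sg) by syn.
  apply typed_closed; [now apply typed_pack|wf|auto].
Qed.

(** The relation [R(u, v) := (g u) b k = v] between [nu] and [b] is preserved
    by [pack] and [k], so parametricity of [z] relates [z nu pack] and [z b k]. *)
Lemma repack_app n G Th Phi sg g z b k :
  wf_ty 1 sg = true -> typed 0 [] g (TLolli (nu sg) (nu sg)) ->
  (forall n G Th Phi t y, wf_ty n t = true ->
     typed n (ints G) y (inst_ty t (ty_coalg sg)) ->
     peq n G Th Phi (nu sg) (App g (App (TApp (pack sg) t) y))
       (App (TApp (pack sg) t) y)) ->
  wf_ty n b = true -> typed n (ints G) z (nu sg) ->
  typed n (ints G) k (TPi (TLolli (ty_coalg sg) (ren_ty S b))) ->
  peq n G Th Phi b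
    (App (TApp (App g (App (TApp z (nu sg)) (pack sg))) b) k)
    (App (TApp z b) k).
Proof.
  intros W Tg Hg Wb Tz Tk.
  assert (Wn : forall n, wf_ty n (nu sg) = true) by (intros; wf).
  assert (Tg' : forall n X, nolin X -> typed n X g (TLolli (nu sg) (nu sg)))
    by (intros; apply typed_closed; [auto|wf|auto]).
  (* The relation R is the graph of this linear map, which settles its admissibility. The parameters
     [b] and [k] are kept explicit because the map recurs in a context with two more type
     variables. *)
  pose (m b k := Lam (nu sg) (App (TApp (App g (Var 0)) b) (shift_tm 0 1 k))).
  assert (Tm : forall n G b k, wf_ty n b = true ->
     typed n (ints G) k (TPi (TLolli (ty_coalg sg) (ren_ty S b))) ->
     typed n (ints G) (m b k) (TLolli (nu sg) b)).
  { intros n' G' b' k' Wb' Tk'; apply ty_lam; auto.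
    eapply (ty_app _ _ (Lin _ :: ints G') (Gone :: ints G')); [spl| |].
    - apply (typed_nu_tapp _ _ sg); auto.
      eapply (ty_app _ _ (Gone :: ints G') (Lin _ :: ints G')); [spl| |tyv].
      apply Tg'; nl.
    - apply (typed_weaken [Gone]); [exact Tk'|nl|nl]. }
  assert (Bm : forall n G b k v, wf_ty n b = true ->
     typed n (ints G) k (TPi (TLolli (ty_coalg sg) (ren_ty S b))) ->
     typed n (ints G) v (nu sg) ->
     eqv n (ints G) (App (m b k) v) (App (TApp (App g v) b) k) b).
  { intros n' G' b' k' v Wb' Tk' Tv.
    eapply eqv_app_beta; [nl|apply eqv_refl, Tm; auto|auto|].
    cbn; rewrite (subst_tm_closed _ _ _ _ Tg); syn. }
  assert (Tzp : typed n (ints G) (App (TApp z (nu sg)) (pack sg)) (nu sg)).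
  { eapply typed_app; [nl|apply (typed_nu_tapp _ _ sg); auto|
      apply typed_pack_nu; auto; nl]. }
  assert (Tzk : typed n (ints G) (App (TApp z b) k) b)
    by (eapply typed_app; [nl|apply (typed_nu_tapp _ _ sg); auto|exact Tk]).
  eapply peq_trans; [apply peq_sym, peq_eqv, Bm; auto|].
  apply graphE with (nu sg); auto.
  pose proof (idext_intro n G Th Phi (nu sg) z z (Wn n)
                (peq_refl _ _ _ _ _ _ Tz)) as H.
  unfold nu at 1 in H.
  eapply (rint_piE _ _ _ _ _ _ _ _ _ _ (nu sg) b (graph (nu sg) b (m b k))) in H;
    [|auto|auto|apply isrel_graph; auto].
  eapply rint_lolliE with (x := pack sg) (y := k) in H.
  { exact H. }
  { eapply typed_eq; [apply typed_pack_nu; auto; nl|syn]. }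
  { eapply typed_eq; [exact Tk|syn]. }
  assert (HE : env_ok 1 n G Th (scons (nu sg) TVar) (scons b TVar)
                 (scons (graph (nu sg) b (m b k)) eq_env))
    by (apply env_ok_1; auto; apply wf_graph; auto).
  apply (rint_piI 1); auto.
  { cbn [wf_ty]; rewrite andb_true_iff; split; auto; now apply wf_coalg. }
  { eapply typed_eq; [apply typed_pack_nu; auto; nl|syn]. }
  { eapply typed_eq; [exact Tk|syn]. }
  apply env_ok_up in HE.
  set (G2 := map (ren_ty S) (map (ren_ty S) G)) in *.
  set (Th2 := (KAdm, TVar 1, TVar 0) :: map shift_rdecl (map shift_rdecl Th))
    in *.
  pose (b2 := ren_ty (Nat.add 2) b).
  assert (Wb2 : wf_ty (S (S n)) b2 = true)
    by (apply (wf_ty_ren n); auto; cbn; lia).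
  assert (Tk2 : typed (S (S n)) (ints G2) (shift_tm 2 0 k)
                  (TPi (TLolli (ty_coalg sg) (ren_ty S b2)))).
  { eapply typed_eq; [eapply (typed_ren n _ (Nat.add 2) (Nat.add 0));
      [exact Tk|nl|nl|cbn; lia|]|unfold b2; syn].
    intros i c Hi; unfold G2, ints in *; cbn; rewrite !nth_error_map in *.
    destruct (nth_error G i); cbn in *; try discriminate.
    injection Hi as ->; f_equal; f_equal; syn. }
  replace (shift_tm 2 0 (pack sg)) with (pack sg) by syn.
  apply (rint_lolliI 2); auto.
  { cbn [wf_ty]; rewrite andb_true_iff; split; auto; now apply wf_coalg. }
  { eapply typed_eq; [apply typed_pack_at; auto; nl|syn]. }
  { eapply typed_eq; [eapply typed_tapp; [exact Tk2|reflexivity|reflexivity]|].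
    unfold b2; syn. }
  set (A' := subst_ty _ (ty_coalg sg)); set (A := subst_ty _ (ty_coalg sg)).
  set (Hyp := _ :: map _ _).
  pose proof (typed_shift_tms [A'; A] _ _ _ _ Tk2) as Tk3.
  cbn [length app] in Tk3; set (k3 := shift_tm 0 2 (shift_tm 2 0 k)) in *.
  assert (Ty : typed (S (S n)) (ints (A' :: A :: G2)) (Var 1)
                 (inst_ty (TVar 1) (ty_coalg sg)))
    by (eapply typed_eq; [cbn; tyv|unfold A; syn]).
  assert (Ty' : typed (S (S n)) (ints (A' :: A :: G2)) (Var 0)
                 (inst_ty (TVar 0) (ty_coalg sg)))
    by (eapply typed_eq; [cbn; tyv|unfold A'; syn]).
  change (shift_tm 0 2 (TApp (pack sg) (TVar 1)))
    with (TApp (shift_tm 0 2 (pack sg)) (TVar 1)).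
  change (shift_tm 0 2 (TApp (shift_tm 2 0 k) (TVar 0))) with (TApp k3 (TVar 0)).
  replace (shift_tm 0 2 (pack sg)) with (pack sg) by syn.
  assert (Tp : typed (S (S n)) (ints (A' :: A :: G2))
                 (App (TApp (pack sg) (TVar 1)) (Var 1)) (nu sg))
    by (eapply typed_app; [nl|apply typed_pack_at; auto; nl|exact Ty]).
  assert (HR : peq (S (S n)) (A' :: A :: G2) Th2 Hyp b2
    (App (m b2 k3) (App (TApp (pack sg) (TVar 1)) (Var 1)))
    (App (TApp k3 (TVar 0)) (Var 0))).
  (* For related contents y and y' at types a and a': [m (pack a y)] is [(g (pack a y)) b k], which
     is [(pack a y) b k] since [g] fixes packages, then [k a y] by [pack_beta], and finally
     [k a' y'] by parametricity of [k] in the fresh relation variable. *)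
  { eapply peq_trans; [apply peq_eqv, Bm; auto|].
    eapply peq_trans.
    { eapply peq_app; [|apply peq_refl, Tk3].
      eapply (peq_tapp _ _ _ _
        (TLolli (TPi (TLolli (ty_coalg sg) (TVar 1))) (TVar 0)));
        [now apply Hg|auto|syn]. }
    eapply peq_trans; [apply peq_eqv, pack_beta; auto; nl|].
    apply (coalg_parametricity _ _ _ _ sg) with (R := RVar 0); auto.
    { apply isrel_var0. }
    eapply prv_eq; [apply p_hyp; [left; reflexivity|]|].
    - apply (wf_app _ _ _ _ A A'); [|tyv|tyv].
      apply (wf_rint _ 2); [|now apply wf_coalg].
      apply (env_ok_shift _ _ [A'; A] [] G2 Th2) in HE; exact HE.
    (* The two environments share their entry at variable 0, the only variable of [ty_coalg sg]. *)
    - f_equal; apply (rint_agree _ 1); [now apply wf_coalg|..];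
        intros [|i] Hi; auto; lia. }
  eapply prv_eq; [apply graphI with (h := m b2 k3) (t := nu sg) (t' := b2);
    [auto|auto|now apply Tm|exact Tp|exact HR]|].
  cbn [rint scons]; f_equal; unfold m, k3, b2, graph, rpreim, req.
  assert (Eg : forall th s, subst_tm th s g = g)
    by (intros; now apply subst_tm_closed with (1 := Tg)).
  syn_norm; rewrite !Eg; syn.
Qed.

(** * Uniqueness *)

(** Elements of [nu] are polymorphic functions, so type and function extensionality reduce their
    equality to agreement on a generic result type and a generic client. *)
Lemma repack n G Th Phi sg g z :
  wf_ty 1 sg = true -> typed 0 [] g (TLolli (nu sg) (nu sg)) ->
  (forall n G Th Phi t y, wf_ty n t = true ->
     typed n (ints G) y (inst_ty t (ty_coalg sg)) ->
     peq n G Th Phi (nu sg) (App g (App (TApp (pack sg) t) y))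
       (App (TApp (pack sg) t) y)) ->
  typed n (ints G) z (nu sg) ->
  peq n G Th Phi (nu sg) (App g (App (TApp z (nu sg)) (pack sg))) z.
Proof.
  intros W Tg Hg Tz.
  assert (Wn : forall n, wf_ty n (nu sg) = true) by (intros; wf).
  assert (Tg' : forall n X, nolin X -> typed n X g (TLolli (nu sg) (nu sg)))
    by (intros; apply typed_closed; [auto|wf|auto]).
  assert (Tr : typed n (ints G) (App g (App (TApp z (nu sg)) (pack sg))) (nu sg)).
  { eapply typed_app; [nl|apply Tg'; nl|].
    eapply typed_app; [nl|apply (typed_nu_tapp _ _ sg); auto
      |apply typed_pack_nu; auto; nl]. }
  pose (K := TPi (TLolli (ty_coalg sg) (TVar 1))).
  assert (WK : wf_ty (S n) K = true)
    by (cbn [K wf_ty]; rewrite andb_true_iff; split; auto; now apply wf_coalg).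
  assert (EG : map shift_decl (ints G) = ints (map (ren_ty S) G))
    by (unfold ints; now rewrite !map_map).
  pose proof (typed_weaken_ty _ _ _ _ Tz (nolin_ints G)) as Tz1.
  pose proof (typed_weaken_ty _ _ _ _ Tr (nolin_ints G)) as Tr1.
  replace (ren_ty S (nu sg)) with (nu sg) in Tz1, Tr1 by syn.
  rewrite EG in Tz1, Tr1.
  apply peq_tyext; auto.
  apply peq_funext; [exact WK| | |].
  - eapply typed_tapp; [exact Tr1|reflexivity|unfold K; syn].
  - eapply typed_tapp; [exact Tz1|reflexivity|unfold K; syn].
  - set (G' := K :: map (ren_ty S) G).
    pose proof (typed_shift_tm _ _ _ _ K Tz1) as Tz2.
    replace (App (shift_tm 0 1 (TApp (shift_tm 1 0
               (App g (App (TApp z (nu sg)) (pack sg)))) (TVar 0))) (Var 0))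
      with (App (TApp (App g (App (TApp (shift_tm 0 1 (shift_tm 1 0 z)) (nu sg))
               (pack sg))) (TVar 0)) (Var 0)).
    (* The generic result type is [TVar 0] and the generic client is [Var 0], both freshly
       introduced by extensionality. *)
    + apply repack_app; auto; cbn; tyv.
    + assert (Eg : forall th s, subst_tm th s g = g)
        by (intros; now apply subst_tm_closed with (1 := Tg)).
      syn_norm; rewrite !Eg; syn.
Qed.

(** The coalgebra map from [out] to itself given by unfolding; uniqueness comes down to its being
    the identity. *)
Definition unfold_out (sg : ty) : tm :=
  App (TApp (unfold sg) (nu sg)) (Bang (out sg)).

Lemma typed_unfold_out sg :
  wf_ty 1 sg = true -> occurs_only true 0 sg = true ->
  typed 0 [] (unfold_out sg) (TLolli (nu sg) (nu sg)).
Proof.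
  intros W P; apply typed_unfold_at; [auto|wf|nl|].
  apply ty_bang; [nl|now apply typed_out].
Qed.

Lemma unfold_out_coalg_map n G Th Phi sg t f h x :
  wf_ty 1 sg = true -> occurs_only true 0 sg = true -> wf_ty n t = true ->
  typed n (ints G) f (TLolli t (inst_ty t sg)) ->
  typed n (ints G) h (TLolli t (nu sg)) -> typed n (ints G) x t ->
  prv n G Th Phi (PEq (TLolli t (inst_ty (nu sg) sg))
                    (comp t (out sg) h) (comp t (fmap sg t (nu sg) h) f)) ->
  peq n G Th Phi (nu sg) (App (unfold_out sg) (App h x))
    (App (TApp (pack sg) t) (Tens (Bang f) x)).
Proof.
  intros W P Wt Tf Tyh Tx E.
  eapply peq_trans; [|apply peq_sym; eapply coalg_map_pack with (h := h); eauto].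
  apply peq_eqv, unfold_beta; [auto|wf|nl| |eapply typed_app; eauto; nl].
  apply ty_bang; [nl|apply typed_closed; [now apply typed_out|wf|nl]].
Qed.

(** This extends a property from packages with explicit content [Tens (Bang f) x], where external
    computation is available, to packages with arbitrary content: tensor induction splits the
    content, and [!] induction then opens its first factor. *)
Lemma pack_ind n G Th Phi sg g t y :
  wf_ty 1 sg = true -> typed 0 [] g (TLolli (nu sg) (nu sg)) ->
  (forall n G Th Phi t f x, wf_ty n t = true ->
     typed n (ints G) f (TLolli t (inst_ty t sg)) -> typed n (ints G) x t ->
     peq n G Th Phi (nu sg)
       (App g (App (TApp (pack sg) t) (Tens (Bang f) x)))
       (App (TApp (pack sg) t) (Tens (Bang f) x))) ->
  wf_ty n t = true -> typed n (ints G) y (inst_ty t (ty_coalg sg)) ->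
  peq n G Th Phi (nu sg) (App g (App (TApp (pack sg) t) y))
    (App (TApp (pack sg) t) y).
Proof.
  intros W Tg Hg Wt Ty.
  assert (Wn : forall n, wf_ty n (nu sg) = true) by (intros; wf).
  assert (Tu : forall X, nolin X -> typed n X g (TLolli (nu sg) (nu sg)))
    by (intros; apply typed_closed; [auto|wf|auto]).
  assert (Eg : forall th s, subst_tm th s g = g)
    by (intros; now apply subst_tm_closed with (1 := Tg)).
  assert (Wi : wf_ty n (inst_ty t sg) = true) by wf.
  pose (B := TLolli t (inst_ty t sg)); pose (A := TBang B).
  assert (WA : wf_ty n A = true) by (cbn; now rewrite Wt, Wi).
  change (inst_ty t (ty_coalg sg)) with (TTensor A t) in Ty.
  assert (Tp : forall X, nolin X ->
            typed n X (TApp (pack sg) t) (TLolli (TTensor A t) (nu sg)))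
    by (intros; now apply typed_pack_at).
  (* [tensor_ind] compares two linear maps out of the tensor: here [g] after packing, and packing
     itself. *)
  pose (g1 := Lam (TTensor A t) (App g (App (TApp (pack sg) t) (Var 0)))).
  assert (Tg1 : forall X, nolin X -> typed n X g1 (TLolli (TTensor A t) (nu sg))).
  { intros X N; apply ty_lam; [cbn; now rewrite Wt, Wi|].
    eapply (ty_app _ _ (Gone :: X) (Lin _ :: X)); [spl|apply Tu; nl|].
    eapply (ty_app _ _ (Gone :: X) (Lin _ :: X)); [spl|apply Tp; nl|tyv]. }
  assert (B1 : forall X v, nolin X -> typed n X v (TTensor A t) ->
     eqv n X (App g1 v) (App g (App (TApp (pack sg) t) v)) (nu sg)).
  { intros X v N Tv; eapply eqv_app_beta; [auto|now apply eqv_refl, Tg1|auto|].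
    cbn; rewrite Eg; syn. }
  eapply peq_trans; [apply peq_sym, peq_eqv, B1; [nl|auto]|].
  apply tensor_ind with A t; auto; [apply Tg1; nl|apply Tp; nl|].
  replace (shift_tm 0 2 g1) with g1
    by (unfold g1, A, B; syn_norm; rewrite Eg; syn).
  replace (shift_tm 0 2 (TApp (pack sg) t)) with (TApp (pack sg) t) by syn.
  pose (G1 := t :: A :: G).
  (* The same two maps as functions of the [!] factor alone, for a fixed state. The index j of the
     state is a parameter: it is 1 under this abstraction, and 2 once [!] induction adds a
     variable. *)
  pose (k j := Lam A (App (TApp (pack sg) t) (Tens (Var 0) (Var j)))).
  pose (gk j := Lam A (App g (App (TApp (pack sg) t) (Tens (Var 0) (Var j))))).
  assert (T2 : typed n (Lin A :: ints G1)
                 (App (TApp (pack sg) t) (Tens (Var 0) (Var 1))) (nu sg)).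
  { eapply (ty_app _ _ (Gone :: ints G1) (Lin _ :: ints G1));
      [spl|apply Tp; nl|].
    eapply (ty_tens _ _ (Lin _ :: ints G1) (Gone :: ints G1)); [spl|tyv|tyv]. }
  assert (Tk : typed n (ints G1) (k 1) (TLolli A (nu sg))) by now apply ty_lam.
  assert (Tgk : typed n (ints G1) (gk 1) (TLolli A (nu sg))).
  { apply ty_lam; auto.
    eapply (ty_app _ _ (Gone :: ints G1) (Lin _ :: ints G1));
      [spl|apply Tu; nl|exact T2]. }
  assert (Tv0 : typed n (ints G1) (Var 0) t) by (cbn; tyv).
  assert (Tv1 : typed n (ints G1) (Var 1) A) by (cbn; tyv).
  assert (Tv : typed n (ints G1) (Tens (Var 1) (Var 0)) (TTensor A t))
    by (eapply ty_tens; [apply split_nolin; nl|exact Tv1|exact Tv0]).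
  eapply peq_trans; [apply peq_eqv, B1; [nl|exact Tv]|].
  eapply peq_trans with (u := App (gk 1) (Var 1)).
  { apply peq_sym, peq_eqv.
    eapply eqv_app_beta; [nl|apply eqv_refl, Tgk|exact Tv1|].
    cbn; rewrite Eg; syn. }
  eapply peq_trans with (u := App (k 1) (Var 1)).
  2:{ apply peq_eqv.
      eapply eqv_app_beta; [nl|apply eqv_refl, Tk|exact Tv1|]; syn. }
  apply bang_ind with B; auto.
  pose proof (typed_shift_tm _ _ _ _ B Tk) as Tk'.
  pose proof (typed_shift_tm _ _ _ _ B Tgk) as Tgk'.
  replace (shift_tm 0 1 (gk 1)) with (gk 2) in *
    by (unfold gk, A, B; syn_norm; rewrite Eg; syn).
  replace (shift_tm 0 1 (k 1)) with (k 2) in * by (unfold k, A, B; syn).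
  assert (Tf : typed n (ints (B :: G1)) (Var 0) B) by (cbn; tyv).
  assert (Tx : typed n (ints (B :: G1)) (Var 1) t) by (cbn; tyv).
  assert (Tb : typed n (ints (B :: G1)) (Bang (Var 0)) A)
    by (apply ty_bang; [nl|exact Tf]).
  eapply peq_trans with
    (u := App g (App (TApp (pack sg) t) (Tens (Bang (Var 0)) (Var 1)))).
  { apply peq_eqv; eapply eqv_app_beta; [nl|apply eqv_refl, Tgk'|exact Tb|].
    cbn; rewrite Eg; syn. }
  eapply peq_trans; [apply Hg; auto|].
  apply peq_sym, peq_eqv; eapply eqv_app_beta; [nl|apply eqv_refl, Tk'|exact Tb|].
  syn.
Qed.

Lemma unfold_out_pack n G Th Phi sg t y :
  wf_ty 1 sg = true -> occurs_only true 0 sg = true -> wf_ty n t = true ->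
  typed n (ints G) y (inst_ty t (ty_coalg sg)) ->
  peq n G Th Phi (nu sg) (App (unfold_out sg) (App (TApp (pack sg) t) y))
    (App (TApp (pack sg) t) y).
Proof.
  intros W P Wt Ty; apply pack_ind; auto; [now apply typed_unfold_out|].
  clear - W P; intros n G Th Phi t f x Wt Tf Tx.
  assert (Tb : typed n (ints G) (Bang f) (TBang (TLolli t (inst_ty t sg))))
    by (apply ty_bang; [nl|auto]).
  eapply peq_trans.
  - eapply peq_app.
    + apply peq_refl, typed_closed; [now apply typed_unfold_out|wf|nl].
    (* The package is read backwards as the value of [unfold t !f] at [x], so that the result on
       coalgebra maps applies. *)
    + apply peq_sym, peq_eqv, unfold_beta; auto; nl.
  - apply unfold_out_coalg_map; auto; [apply typed_unfold_at; auto; nl|].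
    now apply unfold_coalg_map.
Qed.

Lemma unfold_out_id n G Th Phi sg z :
  wf_ty 1 sg = true -> occurs_only true 0 sg = true ->
  typed n (ints G) z (nu sg) ->
  peq n G Th Phi (nu sg) (App (unfold_out sg) z) z.
Proof.
  intros W P Tz.
  assert (Wn : forall n, wf_ty n (nu sg) = true) by (intros; wf).
  assert (Tp : typed n (ints G) (App (TApp z (nu sg)) (pack sg)) (nu sg)).
  { eapply typed_app; [nl|apply (typed_nu_tapp _ _ sg); auto
      |apply typed_pack_nu; auto; nl]. }
  assert (Hid : peq n G Th Phi (nu sg) (App (TApp z (nu sg)) (pack sg)) z).
  { eapply peq_trans; [apply peq_sym, peq_eqv, idtm_beta; auto; nl|].
    apply repack; auto; [apply typed_idtm; auto; nl|].
    intros m G' Th' Phi' t y Wt Ty; apply peq_eqv, idtm_beta; auto; [nl|].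
    eapply typed_app; [nl|apply typed_pack_at; auto; nl|exact Ty]. }
  eapply peq_trans; [|apply repack with (g := unfold_out sg); auto;
    [now apply typed_unfold_out|intros; now apply unfold_out_pack]].
  eapply peq_app; [|apply peq_sym, Hid].
  apply peq_refl, typed_closed; [now apply typed_unfold_out|wf|nl].
Qed.

Lemma coalg_map_unique n sg t f h :
  wf_ty 1 sg = true -> occurs_only true 0 sg = true ->
  is_coalg n sg t f -> coalg_map n sg t f (nu sg) (out sg) h ->
  provable n (PEq (TLolli t (nu sg)) h (App (TApp (unfold sg) t) (Bang f))).
Proof.
  intros W P [Wt Tf] [Th E].
  assert (Wn : wf_ty n (nu sg) = true) by wf.
  change (@nil decl) with (ints []) in Tf, Th.
  assert (Tu : forall G f, typed n (ints G) f (TLolli t (inst_ty t sg)) ->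
            typed n (ints G) (App (TApp (unfold sg) t) (Bang f))
              (TLolli t (nu sg)))
    by (intros; apply typed_unfold_at; auto; [nl|apply ty_bang; auto; nl]).
  assert (Wc : forall G Th f h, typed n (ints G) f (TLolli t (inst_ty t sg)) ->
            typed n (ints G) h (TLolli t (nu sg)) ->
            wf_prop n G Th (PEq (TLolli t (inst_ty (nu sg) sg))
              (comp t (out sg) h) (comp t (fmap sg t (nu sg) h) f))).
  { intros G Th' f' h' Tf' Th''; apply wf_eq.
    - eapply typed_comp; [nl|auto| |exact Th''].
      apply typed_closed; [now apply typed_out|wf|nl].
    - eapply typed_comp; [nl|auto| |exact Tf'].
      apply typed_fmap; auto; nl. }
  (* The coalgebra equation is given in empty contexts; as a hypothesis it survives the variable
     introduced by function extensionality. *)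
  eapply prv_cut; [|exact E|]; [now apply Wc|].
  apply peq_funext; auto.
  pose proof (typed_shift_tm _ _ _ _ t Tf) as Tf'.
  pose proof (typed_shift_tm _ _ _ _ t Th) as Th'.
  assert (Tx : typed n (ints [t]) (Var 0) t) by (cbn; tyv).
  assert (Thx : typed n (ints [t]) (App (shift_tm 0 1 h) (Var 0)) (nu sg))
    by (eapply typed_app; [nl|exact Th'|exact Tx]).
  replace (shift_tm 0 1 (App (TApp (unfold sg) t) (Bang f)))
    with (App (TApp (unfold sg) t) (Bang (shift_tm 0 1 f))) by syn.
  eapply peq_trans; [apply peq_sym, unfold_out_id; auto|].
  eapply peq_trans.
  - apply unfold_out_coalg_map with (t := t) (f := shift_tm 0 1 f); auto.
    apply p_hyp.
    + left; unfold shift_prop; cbn [ren_prop]; f_equal; syn.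
    + now apply Wc.
  - apply peq_sym, peq_eqv, unfold_beta; auto; [nl|apply ty_bang; auto; nl].
Qed.

Theorem theorem2p31 (n : nat) (sigma : ty)
    (Hwf : wf_ty 1 sigma = true)
    (Hic : inductively_constructed sigma)
    (Hpos : occurs_only true 0 sigma = true) :
  (forall (tau : ty) (f h : tm),
      is_coalg n sigma tau f ->
      coalg_map n sigma tau f (nu sigma) (out sigma) h ->
      provable n (PEq (TLolli tau (nu sigma)) h
                    (App (TApp (unfold sigma) tau) (Bang f))))
  /\ final_coalg n sigma (nu sigma) (out sigma).
Proof.
  split; [intros; now apply coalg_map_unique|].
  split.
  - split; [now apply wf_nu_any|].
    apply typed_closed; [now apply typed_out|wf|nl].
  - intros t f Hf; exists (App (TApp (unfold sigma) t) (Bang f)); split.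
    + destruct Hf as [Wt Tf]; split.
      * apply typed_unfold_at; auto; [nl|apply ty_bang; auto; nl].
      * now apply (unfold_coalg_map n [] [] []).
    + intros h' Hh'; now apply coalg_map_unique.
Qed.
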